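(* Let $(\{S_k\}_{k=1}^n,\{S_k\}_{k=n+1}^{n+m})$ be a centred self-adjoint bi-free central limit distribution with respect to $\varphi$ in a C$^*$-non-commutative probability space $(\mathcal A,\varphi)$ (with $S_1,\ldots,S_n$ the left variables and $S_{n+1},\ldots,S_{n+m}$ the right variables) such that $\varphi(S_k^2)=1$ for all $k$. Its joint distribution is completely determined by the positive matrix $A=[\varphi(S_iS_j)]_{i,j=1}^{n+m}\in\mathcal M_{n+m}(\mathbb R)$. Then the microstate bi-free entropy dimension satisfies \[ \delta(S_1,\ldots,S_n\sqcup S_{n+1},\ldots,S_{n+m})=\mathrm{rank}(A). \]
   Context: A C$^*$-non-commutative probability space $(\mathcal A,\varphi)$ is a unital C$^*$-algebra with a state $\varphi$. A system of self-adjoint operators $X_1,\ldots,X_n$ (left variables), $Y_1,\ldots,Y_m$ (right variables) is tracially bi-partite if left variables commute with right variables (in distribution) and $\varphi$ is tracial on the unital algebra generated by the $X_i$ and on the one generated by the $Y_j$. Centred self-adjoint bi-free central limit distribution: self-adjoint operators $S_1,\ldots,S_n$ (left) and $S_{n+1},\ldots,S_{n+m}$ (right) for which there are a real Hilbert space $\mathcal H$ and vectors $e_1,\ldots,e_{n+m}\in\mathcal H$ with $\langle e_i,e_j\rangle=\varphi(S_iS_j)$ such that the joint moments of the $S_k$ with respect to $\varphi$ equal the joint moments, with respect to the vacuum vector state, of the operators $l(e_k)+l^*(e_k)$ for $1\le k\le n$ and $r(e_k)+r^*(e_k)$ for $n+1\le k\le n+m$ acting on the full Fock space $\mathcal F(\mathcal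 H)$, where $l(e),r(e)$ are the left and right creation operators and $l^*(e),r^*(e)$ the corresponding annihilation operators. Such a system is tracially bi-partite. Microstate bi-free entropy of a tracially bi-partite system. $\mathcal M_d$ is the algebra of complex $d\times d$ matrices, $\mathcal M_d^{sa}$ its self-adjoint part, $\mathrm{Tr}_d$ the trace, $\tau_d=\frac1d\mathrm{Tr}_d$, $\|\cdot\|$ the operator norm, and $\lambda_{d,p}$ is Lebesgue measure on $(\mathcal M_d^{sa})^p$ normalized by the inner product $\langle (A_i),(B_i)\rangle=\sum_i\mathrm{Tr}_d(A_iB_i)$. For $M,d\in\mathbb N$ and $R,\epsilon>0$, $\Gamma_R(X_1,\ldots,X_n\sqcup Y_1,\ldots,Y_m;M,d,\epsilon)$ is the set of $(A_1,\ldots,A_n,B_1,\ldots,B_m)\in(\mathcal M_d^{sa})^{n+m}$ with $\|A_i\|,\|B_j\|\le R$ for all $i,j$ and \[ |\varphi(X_{i_1}\cdots X_{i_p}Y_{j_1}\cdots Y_{j_q})-\tau_d(A_{i_1}\cdots A_{i_p}B_{j_q}\cdots B_{j_1})|<\epsilon \] for all $p,q\ge0$ with $1\le p+q\le M$ and all indices. Define (with $\log 0=-\infty$) $\chi_R(\cdot;M,d,\epsilon)=\log\lambda_{d,n+m}(\Gamma_R(\cdot;M,d,\epsilon))$, $\chi_R(\cdot;M,\epsilon)=\limsup_{d\to\infty}\big(\frac1{d^2}\chi_R(\cdot;M,d,\epsilon)+\frac{n+m}2\log d\big)$, $\chi_R(\cdot)=\inf_{M\in\mathbb N,\epsilon>0}\chi_R(\cdot;M,\epsilon)$,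 and $\chi(X_1,\ldots,X_n\sqcup Y_1,\ldots,Y_m)=\sup_{R>0}\chi_R(X_1,\ldots,X_n\sqcup Y_1,\ldots,Y_m)\in[-\infty,\infty)$. Microstate bi-free entropy dimension: \[ \delta(X_1,\ldots,X_n\sqcup Y_1,\ldots,Y_m)=n+m+\limsup_{\epsilon\to0^+}\frac{\chi(X_1+\sqrt\epsilon\,S'_1,\ldots,X_n+\sqrt\epsilon\,S'_n\sqcup Y_1+\sqrt\epsilon\,T'_1,\ldots,Y_m+\sqrt\epsilon\,T'_m)}{|\log(\sqrt\epsilon)|}, \] where $\{S'_i\}_{i=1}^n$ (left) and $\{T'_j\}_{j=1}^m$ (right) form a centred bi-free central limit distribution of semicircular operators with variances $1$ and all covariances $0$, bi-free from $(\{X_i\}_{i=1}^n,\{Y_j\}_{j=1}^m)$ (after enlarging the probability space if necessary). Bi-freeness. Given vector spaces with specified state vectors $(\mathcal X_k,\mathcal X_k^\circ,\xi_k)$, $\mathcal X_k=\mathbb C\xi_k\oplus\mathcal X_k^\circ$, their free product is $\mathcal X=\mathbb C\xi\oplus\bigoplus_{r\ge1}\bigoplus_{k_1\ne k_2\ne\cdots\ne k_r}\mathcal X_{k_1}^\circ\otimes\cdots\otimes\mathcal X_{k_r}^\circ$. Let $\mathcal X(\ell,k)$ (resp. $\mathcal X(r,k)$) be the span of $\xi$ and the summands with first index (resp. last index) $\neq k$. Using the canonical isomorphisms $V_k:\mathcal X_k\otimes\mathcal X(\ell,k)\to\mathcal X$ and $W_k:\mathcal X(r,k)\otimes\mathcal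 X_k\to\mathcal X$, put $\lambda_k(T)=V_k(T\otimes I)V_k^{-1}$ and $\rho_k(T)=W_k(I\otimes T)W_k^{-1}$ for linear maps $T$ on $\mathcal X_k$. Pairs $(C_k,D_k)_{k\in K}$ of unital subalgebras (left face, right face) are bi-free with respect to $\varphi$ if there exist such $\mathcal X_k$ and unital homomorphisms $l_k:C_k\to L(\mathcal X_k)$, $r_k:D_k\to L(\mathcal X_k)$ such that for every word $z_1\cdots z_N$ in elements of the $C_k$'s and $D_k$'s, $\varphi(z_1\cdots z_N)$ equals the $\xi$-coefficient of $T_1\cdots T_N\xi$, where $T_i=\lambda_k(l_k(z_i))$ if $z_i$ is taken from $C_k$ and $T_i=\rho_k(r_k(z_i))$ if $z_i$ is taken from $D_k$. Families are bi-free if the pairs of unital algebras generated by their left and right variables are. *)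

(* Defs.v *)
From HB Require Import structures.
From mathcomp Require Import all_boot all_order all_algebra.
From mathcomp Require Import all_classical all_reals all_analysis.
From mathcomp Require Import complex.

Set Implicit Arguments.
Unset Strict Implicit.
Unset Printing Implicit Defensive.

Import Order.TTheory GRing.Theory Num.Theory.
Import numFieldNormedType.Exports.

Local Open Scope classical_set_scope.
Local Open Scope ring_scope.
Local Open Scope complex_scope.

(* Complex scalars are R[i]; in its order, [x <= y] means that [y - x] is a
   nonnegative real, and the modulus `|x| is an element of R[i]; [normc x] is
   the same modulus as an element of R. *)
Notation normc := ComplexField.Normc.normc.

Record cstarAlgebra (R : realType) := CstarAlgebra {
  cstar_car :> algType R[i] ;
  star : cstar_car -> cstar_car ;
  cstar_norm : cstar_car -> R ;
  star_conj_linear : forall (a : R[i]) x y,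
    star (a *: x + y) = a^* *: star x + star y ;
  starM : forall x y, star (x * y) = star y * star x ;
  starK : involutive star ;
  cstar_norm0_eq0 : forall x, cstar_norm x = 0 -> x = 0 ;
  cstar_normD : forall x y, cstar_norm (x + y) <= cstar_norm x + cstar_norm y ;
  cstar_normZ : forall (a : R[i]) x,
    cstar_norm (a *: x) = normc a * cstar_norm x ;
  cstar_normM : forall x y, cstar_norm (x * y) <= cstar_norm x * cstar_norm y ;
  cstar_identity : forall x, cstar_norm (star x * x) = cstar_norm x ^+ 2 ;
  cstar_complete : forall u : nat -> cstar_car,
    (forall eps : R, 0 < eps -> exists N, forall i j, (N <= i)%N -> (N <= j)%N ->
       cstar_norm (u i - u j) < eps) ->
    exists l, forall eps : R, 0 < eps -> exists N, forall i, (N <= i)%N ->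
       cstar_norm (u i - l) < eps }.

Definition is_state (R : realType) (A : cstarAlgebra R) (phi : {scalar A}) :=
  phi 1 = 1 /\ forall a : A, 0 <= phi (star a * a).

(* [theta] is the identity for real spaces and conjugation for complex ones;
   inner products are linear in their first argument. *)
Record hilbert (K : numFieldType) (theta : K -> K) := Hilbert {
  hil_car :> completeNormedModType K ;
  inner : {dot hil_car for theta} ;
  inner_norm : forall x : hil_car, `|x| ^+ 2 = inner x x }.

Notation real_hilbert R := (@hilbert R idfun).
Notation complex_hilbert R := (@hilbert R[i] (@conjc R)).

(* The full Fock space C Omega + sum_r (H_C)^(tensor r), presented (up to
   unitary isomorphism) as the complex Hilbert space generated by the
   elementary tensors [elt [:: x1; ...; xr]] of vectors of the real space H,
   with the usual inner products; the vacuum vector is [elt [::]]. *)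
Record full_fock (R : realType) (H : real_hilbert R) := FullFock {
  fock_car :> complex_hilbert R ;
  elt : seq H -> fock_car ;
  elt_multilinear : forall (u v : seq H) (a : R) (x y : H),
    elt (u ++ (a *: x + y) :: v) =
      a%:C *: elt (u ++ x :: v) + elt (u ++ y :: v) ;
  elt_inner : forall u v : seq H,
    inner fock_car (elt u) (elt v) =
      if size u == size v then (\prod_(p <- zip u v) inner H p.1 p.2)%:C else 0 ;
  elt_total :
    closure [set x : fock_car | exists s : seq (R[i] * seq H),
                               x = \sum_(p <- s) p.1 *: elt p.2] = setT }.

Section FockOperators.
Variables (R : realType) (H : real_hilbert R) (F : full_fock H).

Definition vacuum : F := elt F [::].

Definition left_creation (e : H) (c : {linear F -> F}) :=
  continuous c /\ forall u, c (elt F u) = elt F (e :: u).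

Definition right_creation (e : H) (c : {linear F -> F}) :=
  continuous c /\ forall u, c (elt F u) = elt F (rcons u e).

Definition is_adjoint (c c' : {linear F -> F}) :=
  forall x y : F, inner F (c x) y = inner F x (c' y).

End FockOperators.

(* A system of n left and m right variables is one family indexed by
   'I_(n + m): [lshift m i] is the i-th left variable, [rshift n j] the j-th
   right one. *)
Definition bifree_clt (R : realType) (n m : nat) (A : cstarAlgebra R)
    (phi : {scalar A}) (S : 'I_(n + m) -> A) :=
  (forall k, star (S k) = S k) /\
  exists (H : real_hilbert R) (F : full_fock H) (e : 'I_(n + m) -> H)
         (c c' : 'I_(n + m) -> {linear F -> F}),
  [/\ forall i j, (inner H (e i) (e j))%:C = phi (S i * S j),
      forall k : 'I_(n + m), if (k < n)%N then left_creation (e k) (c k)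
                else right_creation (e k) (c k),
      forall k, is_adjoint (c k) (c' k)
    & forall w : seq 'I_(n + m),
        phi (\prod_(k <- w) S k) =
        inner F (foldr (fun k x => c k x + c' k x) (vacuum F) w) (vacuum F)].

(* (X, X°, xi), with X° given as the kernel of the xi-coefficient. *)
Record svspace (K : fieldType) := SvSpace {
  sv_car :> lmodType K ;
  sv_vec : sv_car ;
  sv_coef : {scalar sv_car} ;
  sv_coef_vec : sv_coef sv_vec = 1 }.

Section FreeProduct.
Variables (K : fieldType) (I : eqType) (X : I -> svspace K).

Definition letter := {k : I & X k}.
Definition mkletter (k : I) (x : X k) : letter := existT _ k x.

(* words x_1 ... x_r with x_i in X°_(k_i) and k_1 <> k_2 <> ... <> k_r *)
Definition reduced (w : seq letter) : bool :=
  sorted (fun a b => tag a != tag b) w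
  && all (fun a => sv_coef (X (tag a)) (tagged a) == 0) w.

Definition multilinear_on_reduced (Z : lmodType K) (f : seq letter -> Z) :=
  forall (u v : seq letter) (k : I) (a : K) (x y : X k),
    reduced (u ++ mkletter x :: v) -> reduced (u ++ mkletter y :: v) ->
    f (u ++ mkletter (a *: x + y) :: v) =
      a *: f (u ++ mkletter x :: v) + f (u ++ mkletter y :: v).

(* The direct sum of K xi and of all X°_(k_1) (x) ... (x) X°_(k_r), presented
   by its universal property: [tens w] is the elementary tensor of the reduced
   word w, with [tens [::] = xi]; values of [tens] off reduced words are
   irrelevant. *)
Record free_product := FreeProd {
  fp_car :> svspace K ;
  tens : seq letter -> fp_car ;
  tens_nil : tens [::] = sv_vec fp_car ;
  tens_coef : forall w, reduced w -> (0 < size w)%N ->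
    sv_coef fp_car (tens w) = 0 ;
  tens_multilinear : multilinear_on_reduced tens ;
  tens_universal : forall (Z : lmodType K) (f : seq letter -> Z),
    multilinear_on_reduced f ->
    exists g : {linear fp_car -> Z},
      (forall w, reduced w -> g (tens w) = f w) /\
      forall g' : {linear fp_car -> Z},
        (forall w, reduced w -> g' (tens w) = f w) -> g' =1 g }.

Variable P : free_product.

(* the component of x in X°_k *)
Definition centre k (x : X k) : X k := x - sv_coef (X k) x *: sv_vec (X k).

(* V_k (x (x) w) and W_k (w (x) x) for w a reduced word *)
Definition tens_left k (x : X k) (w : seq letter) : P :=
  sv_coef (X k) x *: tens P w + tens P (mkletter (centre x) :: w).
Definition tens_right k (x : X k) (w : seq letter) : P :=
  sv_coef (X k) x *: tens P w + tens P (rcons w (mkletter (centre x))).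

(* L = lambda_k(T) and L = rho_k(T); the reduced words starting
   (resp. ending) outside k span X(l, k) (resp. X(r, k)) *)
Definition is_lambda k (T : {linear X k -> X k}) (L : {linear P -> P}) :=
  forall (x : X k) (w : seq letter),
    reduced w -> (if w is a :: _ then tag a != k else true) ->
    L (tens_left x w) = tens_left (T x) w.
Definition is_rho k (T : {linear X k -> X k}) (L : {linear P -> P}) :=
  forall (x : X k) (w : seq letter),
    reduced w -> (if rev w is a :: _ then tag a != k else true) ->
    L (tens_right x w) = tens_right (T x) w.

End FreeProduct.

Section BiFree.
Variables (R : realType) (A : cstarAlgebra R).

Definition is_subalgebra (B : set A) :=
  [/\ B 1, forall (a : R[i]) x y, B x -> B y -> B (a *: x + y)
    & forall x y, B x -> B y -> B (x * y)].

Definition generated_algebra (G : set A) : set A := smallest is_subalgebra G.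

(* unital homomorphism B -> L(X); values outside B are irrelevant *)
Definition is_unital_rep (X : lmodType R[i]) (B : set A)
    (l : A -> {linear X -> X}) :=
  [/\ forall v, l 1 v = v,
      forall (a : R[i]) x y, B x -> B y ->
        forall v, l (a *: x + y) v = a *: l x v + l y v
    & forall x y, B x -> B y -> forall v, l (x * y) v = l x (l y v)].

(* [C k] and [D k] are the left and right faces; a letter (s, k, a) of a word
   is an element a of C k if s = true, and of D k if s = false. *)
Definition bifree (phi : {scalar A}) (I : eqType) (C D : I -> set A) :=
  exists (X : I -> svspace R[i]) (P : free_product X)
         (l r : forall k, A -> {linear X k -> X k})
         (lam rho : I -> A -> {linear P -> P}),
  [/\ forall k, is_unital_rep (C k) (l k) /\ is_unital_rep (D k) (r k),
      forall k a, C k a -> is_lambda (l k a) (lam k a),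
      forall k a, D k a -> is_rho (r k a) (rho k a)
    & forall w : seq (bool * I * A),
        (forall s k a, (s, k, a) \in w -> (if s then C k else D k) a) ->
        phi (\prod_(z <- w) z.2) =
        sv_coef P (foldr (fun z x => (if z.1.1 then lam else rho) z.1.2 z.2 x)
                         (sv_vec P) w)].

End BiFree.

Section Matrices.
Variable R : realType.

Definition l2norm d (v : 'cV[R[i]]_d) : R :=
  Num.sqrt (\sum_i normc (v i 0) ^+ 2).

Definition opnorm d (B : 'M[R[i]]_d) : R :=
  sup [set l2norm (B *m v) | v in [set v | l2norm v <= 1]].

Definition self_adjoint_mx d (B : 'M[R[i]]_d) :=
  map_mx (@conjc R) B^T = B.

Definition ntrace d (B : 'M[R[i]]_d) : R[i] := d%:R^-1 * \tr B.

(* Lebesgue measure on R^N, as an iterated product measure *)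
Fixpoint lebesgue_tuple (N : nat) : set (N.-tuple R) -> \bar R :=
  match N with
  | 0 => fun E => \d_([tuple] : 0.-tuple R) E
  | N'.+1 => fun E => (@lebesgue_measure R \x @lebesgue_tuple N')%E
                        [set p : R * N'.-tuple R | E [tuple of p.1 :: p.2]]
  end.

(* The coordinates of a self-adjoint matrix in the orthonormal basis, for
   (A, B) |-> Tr (A B), made of E_ii, (E_ij + E_ji)/sqrt 2 and
   i (E_ij - E_ji)/sqrt 2 for i < j. *)
Definition sa_of_coords d (x : 'I_d -> 'I_d -> R) : 'M[R[i]]_d :=
  \matrix_(i, j)
    if i == j then (x i i)%:C
    else if (i < j)%N
         then (x i j / Num.sqrt 2) +i* (x j i / Num.sqrt 2)
         else (x j i / Num.sqrt 2) -i* (x i j / Num.sqrt 2).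

Definition sa_family_of_coords d p (t : (p * (d * d)).-tuple R) :
    'I_p -> 'M[R[i]]_d :=
  fun k => sa_of_coords
             (fun i j => tnth t (mxvec_index k (mxvec_index i j))).

(* lambda_(d, p) on sets of p-tuples of self-adjoint d x d matrices *)
Definition lebesgue_sa d p (G : set ('I_p -> 'M[R[i]]_d)) : \bar R :=
  lebesgue_tuple (@sa_family_of_coords d p @^-1` G).

End Matrices.

Section Entropy.
Variables (R : realType) (n m : nat) (A : cstarAlgebra R) (phi : {scalar A}).
Variable Z : 'I_(n + m) -> A.

Definition microstates (r : R) (M d : nat) (eps : R) :
    set ('I_(n + m) -> 'M[R[i]]_d) :=
  [set B | [/\ forall k, self_adjoint_mx (B k),
               forall k, opnorm (B k) <= r
             & forall (I : seq 'I_n) (J : seq 'I_m),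
                 (1 <= size I + size J <= M)%N ->
                 `| phi ((\prod_(i <- I) Z (lshift m i)) *
                         (\prod_(j <- J) Z (rshift n j)))
                    - ntrace ((\prod_(i <- I) B (lshift m i)) *
                              (\prod_(j <- rev J) B (rshift n j))) |
                 < eps%:C ]].

Local Open Scope ereal_scope.

Definition chi_RMe (r : R) (M : nat) (eps : R) : \bar R :=
  limn_esup (fun d =>
    (d%:R ^- 2)%:E * lne (lebesgue_sa (microstates r M (d := d) eps))
    + ((n + m)%:R / 2 * ln d%:R)%:E).

Definition chi_R (r : R) : \bar R :=
  ereal_inf [set y | exists M (eps : R), (0 < eps)%R /\ y = chi_RMe r M eps].

Definition chi : \bar R :=
  ereal_sup [set y | exists r : R, (0 < r)%R /\ y = chi_R r].

End Entropy.

(* (B, psi) carries a copy Z' of the system Z and a standard semicircular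
   system S', bi-free from Z'.  "Enlarging the probability space" is read in
   distribution: an operator of A may be both a left and a right variable, in
   which case A itself need not embed in a space containing such an S'. *)
Definition perturbation_space (R : realType) (n m : nat)
    (A : cstarAlgebra R) (phi : {scalar A}) (Z : 'I_(n + m) -> A)
    (B : cstarAlgebra R) (psi : {scalar B}) (Z' S' : 'I_(n + m) -> B) :=
  [/\ is_state psi,
      forall k, star (Z' k) = Z' k,
      forall w : seq 'I_(n + m),
        psi (\prod_(k <- w) Z' k) = phi (\prod_(k <- w) Z k),
      bifree_clt psi S' /\ (forall i j, psi (S' i * S' j) = (i == j)%:R)
    & let faces (sh : set 'I_(n + m)) (b : bool) :=
        generated_algebra ((if b then Z' else S') @` sh) in
      bifree psi (faces (range (@lshift n m))) (faces (range (@rshift n m)))].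

Definition perturbed_dimension (R : realType) (n m : nat)
    (B : cstarAlgebra R) (psi : {scalar B}) (Z S : 'I_(n + m) -> B) : \bar R :=
  ((n + m)%:R%:E +
   limf_esup (fun eps : R =>
     chi psi (fun k => Z k + (Num.sqrt eps)%:C *: S k)%R
     * (`|ln (Num.sqrt eps)|^-1)%:E) 0^'+)%E.

(* delta(Z) = y: the defining formula makes sense, and it gives y for every
   choice of the auxiliary probability space. *)
Definition entropy_dimension_is (R : realType) (n m : nat)
    (A : cstarAlgebra R) (phi : {scalar A}) (Z : 'I_(n + m) -> A)
    (y : \bar R) :=
  (exists (B : cstarAlgebra R) (psi : {scalar B}) (Z' S' : 'I_(n + m) -> B),
     perturbation_space phi Z psi Z' S') /\
  (forall (B : cstarAlgebra R) (psi : {scalar B}) (Z' S' : 'I_(n + m) -> B),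
     perturbation_space phi Z psi Z' S' -> perturbed_dimension psi Z' S' = y).

Definition positive_mx (R : realType) p (M : 'M[R]_p) :=
  M^T = M /\ forall v : 'rV[R]_p, 0 <= (v *m M *m v^T) 0 0.

(* Main.v *)
(* The entropy of a bi-free central limit distribution with invertible
   covariance C is 1/2 log det C up to a constant depending only on n + m.
   Adding sqrt epsilon times an independent system replaces the covariance A by
   A + epsilon I, whose determinant is comparable to epsilon^(n + m - rank A),
   and the dimension n + m - (n + m - rank A) = rank A follows.

   Left and right field operators on the Fock space commute and agree on the
   vacuum, so the moments of (left variables) (reversed right variables)
   are those of a semicircular family with covariance C.  They satisfy
   m(k w) = sum of C_(k j) m(u) m(v) over the splittings w = u j v.

   Upper bound on the volume of the microstates: the second moments force
   sum_k |(L^-1 B)_k|^2 <= const * d^2 for the Cholesky factor L of C, so the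
   volume is at most a Gaussian integral.  Lower bound: for a tuple G of
   independent GUE matrices, the traces of words in L G / sqrt d satisfy the loop
   equations, i.e. the above recursion with an error of order d^-2.  They give
   convergence of the expected trace moments, and a Catalan type bound on
   moments of degree up to a power of d; the trace of a power of order log d
   then controls the operator norm.  As these estimates are of the Chebyshev
   type, a single polynomial in the entries bounds the indicator function of the
   microstates from below, so only moments of one-dimensional Gaussians are
   needed.  It suffices to do this along d = 8^j, as the entropy is a limsup.

   A perturbed system exists in the full Fock space over the two-coloured
   letters, where bi-freeness comes from splitting off the maximal monochromatic
   prefix of a word; and bi-freeness determines the moments, because the vectors
   T_1 ... T_N xi can be computed formally from the moments within each pair of
   faces. *)
From HB Require Import structures.
Require Import Defs.
From mathcomp Require Import all_boot all_order all_algebra.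
From mathcomp Require Import all_classical all_reals all_analysis.
From mathcomp Require Import measurable_realfun complex ring lra zify.
From mathcomp Require mpoly ssrcomplements spectral.

Set Implicit Arguments.
Unset Strict Implicit.
Unset Printing Implicit Defensive.

Import Order.TTheory GRing.Theory Num.Theory.
Import numFieldNormedType.Exports.

Local Open Scope classical_set_scope.
Local Open Scope ring_scope.
Local Open Scope complex_scope.

(** * Gaussian integrals *)

(** Microstate sets are never shown to be measurable: the volume of an arbitrary set is an iterated
    integral, of which only positivity and monotonicity are used. The Cholesky factor is triangular
    for a related reason: it turns the passage from independent to correlated coordinates into an
    affine substitution in one variable at a time, with the earlier variables frozen, so the
    determinant appears as a product of one-dimensional factors and no change of variables in
    several dimensions occurs. The two bounds on the entropy differ by a constant that depends on
    [n + m] only; it may be crude, since it is divided by [|ln (sqrt epsilon)|]. The operator norm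
    cut-off 24 is uniform too, because the entries of [A + epsilon I] are at most 2 in modulus. The
    lower bound has to hold for every degree and tolerance, whereas degree 2 and one tolerance
    suffice above. For the auxiliary system, free products being algebraic, bi-freeness is realized
    on finitely supported functions on words, inside the Hilbert space of square summable ones. *)

Section GaussMoments.
Variable R : realType.
Local Notation mu := (@lebesgue_measure R).

(** The fundamental theorem gives the integral over [[-(n+1), n+1]], with boundary terms tending to
    0, and dominated convergence with bound [|g|] removes the cut-off. The endpoints use [n.+1] so
    that the interval is never a point. *)
Lemma integral_derivative_eq0 (g G : R -> R) :
  continuous g -> mu.-integrable setT (EFin \o g) ->
  (forall x : R, is_derive x 1 G (g x)) ->
  G n%:R @[n --> \oo] --> (0 : R) -> G (- n%:R) @[n --> \oo] --> (0 : R) ->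
  (\int[mu]_x (g x)%:E = 0)%E.
Proof.
move=> cg ig dG Gp Gm.
pose gn (n : nat) x := (g x * \1_(`[- n.+1%:R, n.+1%:R]%classic) x)%:E.
have mg : measurable_fun setT g by exact: continuous_measurable_fun.
have gnE n : (\int[mu]_x gn n x = (G n.+1%:R - G (- n.+1%:R))%R%:E)%E.
  transitivity (\int[mu]_(x in `[(- n.+1%:R)%R, n.+1%:R%R]) (g x)%:E)%E.
    rewrite [RHS]integral_mkcond; apply: eq_integral => x _.
    rewrite /gn patchE indicE; case: ifP => _; by rewrite ?mulr1 ?mulr0.
  rewrite (@continuous_FTC2 _ g G) ?EFinB//.
  - by rewrite (@lt_trans _ _ 0)// ?oppr_lt0 ltr0n.
  - by apply: continuous_subspaceT => x; exact: cg.
  - have dfG x : derivable G x 1 by case: (dG x).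
    split=> [x _||]; first exact: dfG.
    + apply: cvg_at_right_filter; apply: differentiable_continuous.
      exact/derivable1_diffP/dfG.
    + apply: cvg_at_left_filter; apply: differentiable_continuous.
      exact/derivable1_diffP/dfG.
  - by move=> x _; rewrite derive1E; case: (dG x).
have lim1 : ((fun n => \int[mu]_x gn n x) @ \oo --> \int[mu]_x (g x)%:E)%E.
  apply: (@dominated_cvg _ _ _ mu setT _ gn (EFin \o g) (fun x => `|(g x)%:E|)%E) => //.
  - by move=> n; apply/measurable_EFinP; apply: measurable_funM.
  - move=> x _; apply: cvg_near_cst.
    exists (`|Num.trunc `|x| |.+1)%N => // n /= hn.
    rewrite /gn indicE mem_set ?mulr1//= in_itv/=.
    rewrite -ler_norml; apply: (@le_trans _ _ (Num.trunc `|x|).+1%:R).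
      by apply/ltW/truncnS_gt.
    by rewrite ler_nat; move: hn; lia.
  - exact: integrable_abse.
  - move=> n x _; rewrite /gn/= lee_fin normrM ler_piMr//.
    by rewrite indicE; case: (_ \in _); rewrite ?normr1 ?normr0.
have lim2 : ((fun n => \int[mu]_x gn n x) @ \oo --> 0)%E.
  under eq_fun do rewrite gnE.
  apply: cvg_EFin; first by near=> n.
  rewrite -(subrr 0); apply: cvgB.
    by move: Gp => /(cvg_comp _ _ (cvg_addnr 1)); under eq_cvg do rewrite /= addn1.
  by move: Gm => /(cvg_comp _ _ (cvg_addnr 1)); under eq_cvg do rewrite /= addn1.
by rewrite -(cvg_lim _ lim1)//; exact: cvg_lim.
Unshelve. all: by end_near. Qed.

(** Moments of the standard normal law: [(k-1)!!] for even [k] and 0 for odd [k]. *)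
Fixpoint gmom (k : nat) : R :=
  match k with 0 => 1 | 1 => 0 | (j.+1 as k').+1 => k'%:R * gmom j end.

Let sqr_normr (y : R) : `|y| ^+ 2 = y ^+ 2 := real_normK (num_real y).

(** The Gaussian is [exp(-2u)]: one factor [exp(-u)] is the wider Gaussian of the bound, the other
    absorbs the power because [u^k <= k! exp u]. The power is first bounded by [1 + y^(2k)], a
    polynomial in [u]. *)
Lemma normal_fun_decay (m s : R) k : s != 0 -> exists C : R, 0 <= C /\
  forall x, `|x - m| ^+ k * normal_fun m s x <= C * normal_fun m (s * Num.sqrt 2) x.
Proof.
move=> s0; exists (1 + (s ^+ 2 *+ 4) ^+ k * k`!%:R); split.
  by rewrite addr_ge0// mulr_ge0// exprn_ge0// mulrn_wge0// sqr_ge0.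
move=> x; set y := x - m; pose u := y ^+ 2 / (s ^+ 2 *+ 4).
have s2 : 0 < s ^+ 2 *+ 4 by rewrite pmulrn_lgt0// exprn_even_gt0.
have u0 : 0 <= u by rewrite divr_ge0// ?sqr_ge0// ltW.
have -> : normal_fun m s x = expR (- u) * expR (- u).
  rewrite -expRD /normal_fun -/y /u; congr expR; rewrite !mulNr -opprD; congr (- _).
  by rewrite -mulr_natr -[in RHS]mulr_natr; field.
have -> : normal_fun m (s * Num.sqrt 2) x = expR (- u).
  rewrite /normal_fun -/y /u; congr expR; rewrite !mulNr; congr (- (_ / _)).
  by rewrite exprMn sqr_sqrtr// -mulr_natr -[in RHS]mulr_natr; field.
rewrite mulrA ler_wpM2r ?expR_ge0//.
have : `|y| ^+ k <= 1 + y ^+ 2 ^+ k.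
  rewrite -[y ^+ 2]sqr_normr; case: (leP `|y| 1) => h.
    by apply: (@le_trans _ _ 1); rewrite ?exprn_ile1// lerDl exprn_ge0// sqr_ge0.
  rewrite -exprM mulnC muln2 -addnn exprD (@le_trans _ _ (`|y| ^+ k * `|y| ^+ k))//.
    by rewrite ler_peMl// ?exprn_ge0// exprn_ege1// ltW.
  by rewrite lerDr.
have uk : u ^+ k <= k`!%:R * expR u.
  case: k => [|k]; first by rewrite expr0 fact0 mul1r -expR0 ler_expR.
  have := expR_ge1Dxn k u0; rewrite -ler_pdivrMl ?ltr0n ?fact_gt0// => h.
  by rewrite mulrC; apply: le_trans h; rewrite lerDr.
have yk : y ^+ 2 ^+ k <= (s ^+ 2 *+ 4) ^+ k * k`!%:R * expR u.
  have -> : y ^+ 2 = (s ^+ 2 *+ 4) * u by rewrite /u mulrC divfK// gt_eqF.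
  by rewrite exprMn -mulrA ler_wpM2l// exprn_ge0// ltW.
move=> h; apply: (@le_trans _ _ ((1 + y ^+ 2 ^+ k) * expR (- u))).
  by rewrite ler_wpM2r ?expR_ge0.
rewrite mulrDl mul1r lerD//; first by rewrite -[leRHS]expR0 ler_expR oppr_le0.
by rewrite expRN ler_pdivrMr ?expR_gt0.
Qed.

Lemma integrable_normal_fun (m s : R) : s != 0 ->
  mu.-integrable setT (EFin \o normal_fun m s).
Proof.
move=> s0; have := integrable_normal_pdf m s.
move=> /(integrableZl measurableT (normal_peak s)^-1).
apply: eq_integrable => // x _ /=; rewrite normal_pdfE// -EFinM mulrA mulVf ?mul1r//.
by rewrite gt_eqF// normal_peak_gt0.
Qed.

Lemma continuous_normal_fun (m s : R) : continuous (normal_fun m s).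
Proof.
move=> x; apply: (cvg_comp _ expR); last exact: continuous_expR.
apply: cvgM; last exact: cvg_cst.
apply: (@cvgN _ R^o).
apply: (cvg_comp (fun x => x - m) (fun x => x ^+ 2)).
  by apply: (@cvgB _ R^o) => //; [exact: cvg_id|exact: cvg_cst].
exact: sqr_continuous.
Qed.

Lemma continuous_monomial_normal (m s : R) k :
  continuous (fun x => (x - m) ^+ k * normal_fun m s x).
Proof.
move=> x; apply: cvgM; last exact: continuous_normal_fun.
apply: (cvg_comp (fun x => x - m) (fun x => x ^+ k)).
  by apply: (@cvgB _ R^o) => //; [exact: cvg_id|exact: cvg_cst].
exact: exprn_continuous.
Qed.

Lemma integrable_monomial_normal (m s : R) k : s != 0 ->
  mu.-integrable setT (EFin \o (fun x => (x - m) ^+ k * normal_fun m s x)).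
Proof.
move=> s0; have [C [C0 hC]] := normal_fun_decay m k s0.
have s20 : s * Num.sqrt 2 != 0 by rewrite mulf_neq0// sqrtr_eq0 -ltNge.
apply: (@le_integrable _ _ _ mu setT measurableT _
  (fun x => C%:E * (normal_fun m (s * Num.sqrt 2) x)%:E)%E).
- apply/measurable_EFinP; apply: continuous_measurable_fun.
  exact: continuous_monomial_normal.
- move=> x _ /=; rewrite lee_fin normrM normrX (ger0_norm (normal_fun_ge0 _ _ _)).
  by rewrite [leRHS]ger0_norm ?mulr_ge0 ?normal_fun_ge0.
- exact/integrableZl/integrable_normal_fun.
Qed.

Lemma cvg_monomial_normal (m s : R) k (u : nat -> R) : s != 0 ->
  (forall n, n%:R <= `|u n|) ->
  (u n - m) ^+ k * normal_fun m s (u n) @[n --> \oo] --> (0 : R).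
Proof.
move=> s0 hu; have [C [C0 hC]] := normal_fun_decay m k s0.
have s20 : s * Num.sqrt 2 != 0 by rewrite mulf_neq0// sqrtr_eq0 -ltNge.
set s' := s * Num.sqrt 2 in hC s20.
have s2 : 0 < s' ^+ 2 *+ 2 by rewrite pmulrn_lgt0// exprn_even_gt0.
pose K := C * ((s' ^+ 2 *+ 2) * 4).
have K0 : 0 <= K by rewrite !mulr_ge0// ltW.
have lim : (K * 2) * harmonic n @[n --> \oo] --> (0 : R).
  by rewrite -(mulr0 (K * 2)); apply: cvgMr; exact: cvg_harmonic.
apply/norm_cvg0P; apply: (squeeze_cvgr _ (cvg_cst 0) lim).
(* From this rank on [2|m| <= n <= |u n|], hence [|u n - m| >= n/2]. *)
exists (2 * (Num.trunc `|m|).+1 + 1)%N => // n /= hn.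
rewrite normr_ge0/= normrM normrX (ger0_norm (normal_fun_ge0 _ _ _)).
apply: (le_trans (hC (u n))).
have hm : `|m| *+ 2 <= n%:R.
  have := truncnS_gt `|m|; set t := (Num.trunc _) in hn * => ht.
  apply: (@le_trans _ _ (t.+1%:R *+ 2)); first by rewrite lerMn2r ltW.
  by rewrite -mulr_natr -natrM ler_nat; move: hn; lia.
have n0 : 0 < n%:R :> R by rewrite ltr0n; move: hn; lia.
have n1 : 1 <= n%:R :> R by rewrite ler1n; move: hn; lia.
have yn : n%:R / 2 <= `|u n - m|.
  have := lerB_dist (u n) m; have := hu n; move: hm; rewrite -mulr_natr.
  move: `|u n| `|m| `|u n - m| (n%:R) => a b c e; lra.
set y := u n - m in yn *.
have v0 : 0 < y ^+ 2 / (s' ^+ 2 *+ 2).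
  rewrite divr_gt0// -sqr_normr exprn_gt0//; apply: lt_le_trans yn.
  by rewrite divr_gt0.
have : normal_fun m s' (u n) <= (s' ^+ 2 *+ 2) / y ^+ 2.
  rewrite /normal_fun -/y mulNr expRN -[X in _ <= X]invrK invf_div lef_pV2 ?posrE ?expR_gt0//.
  by apply: le_trans (expR_ge1Dx _); rewrite lerDr.
move=> /(ler_wpM2l C0)/le_trans; apply.
rewrite -!mulrA; apply: ler_wpM2l => //; rewrite !mulrA -!mulrA.
apply: ler_wpM2l; first exact: ltW.
have yn2 : (n%:R / 2) ^+ 2 <= y ^+ 2.
  by rewrite -[y ^+ 2]sqr_normr lerXn2r// nnegrE divr_ge0// ltW.
have : (y ^+ 2)^-1 <= ((n%:R / 2) ^+ 2)^-1.
  have n20 : 0 < (n%:R / 2) ^+ 2 :> R by rewrite exprn_gt0// divr_gt0.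
  by rewrite lef_pV2 ?posrE// (lt_le_trans n20).
move=> /le_trans; apply; rewrite expr_div_n invf_div /harmonic /=.
rewrite (_ : 2 ^+ 2 = 4 :> R); last by rewrite expr2; lra.
rewrite ler_wpM2l// ler_pdivlMr ?ltr0n// mulrC ler_pdivrMr ?exprn_gt0//.
rewrite expr2.
by rewrite -natr1; nra.
Qed.

(** The derivative of [(x-m)^(k+1)] times the Gaussian is the combination [g] of the two integrands,
    and its integral vanishes by decay at infinity. *)
Lemma integral_monomial_normal_step (m s : R) k : s != 0 ->
  (\int[mu]_x ((x - m) ^+ k.+2 * normal_fun m s x)%:E =
   (s ^+ 2 * k.+1%:R)%:E * \int[mu]_x ((x - m) ^+ k * normal_fun m s x)%:E)%E.
Proof.
move=> s0.
pose f j (x : R) := (x - m) ^+ j * normal_fun m s x.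
pose g (x : R) := k.+1%:R * f k x - (s ^+ 2)^-1 * f k.+2 x.
have s20 : s ^+ 2 != 0 by rewrite expf_neq0.
have dn x : is_derive (x : R) 1 (normal_fun m s) (- (x - m) / s ^+ 2 * normal_fun m s x).
  apply: is_derive_eq; rewrite /normal_fun scaler0 add0r !subr0.
  rewrite /GRing.scale/=; set e := expR _.
  by field.
have dG x : is_derive (x : R) 1 (f k.+1) (g x).
  have := dn x => dnx.
  have d1 : is_derive x 1 (fun x : R => (x - m) ^+ k.+1) (k.+1%:R * (x - m) ^+ k).
    have d0 : is_derive x 1 (fun x : R => x - m) 1.
      by apply: is_derive_eq; rewrite subr0.
    rewrite (_ : (fun x : R => _) = (fun x : R => x - m) ^+ k.+1); last first.
      by apply/funext => z; rewrite exprfctE.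
    by apply: (is_derive_eq (is_deriveX k.+1 d0)); rewrite /GRing.scale/= mulr1.
  apply: (is_derive_eq (is_deriveM d1 dnx)).
  rewrite /GRing.scale/= /g /f !exprS; set e := normal_fun _ _ _.
  by field.
have cf j : continuous (f j) by exact: continuous_monomial_normal.
have If j : mu.-integrable setT (EFin \o f j) by exact: integrable_monomial_normal.
have gE : EFin \o g = (fun x => k.+1%:R%:E * (f k x)%:E - (s ^+ 2)^-1%:E * (f k.+2 x)%:E)%E.
  by apply/funext => x /=; rewrite EFinB !EFinM.
have Ig : mu.-integrable setT (EFin \o g).
  by rewrite gE; apply: integrableB => //; apply: integrableZl => //; exact: If.
have := @integral_derivative_eq0 g (f k.+1) _ Ig dG.
have -> : (\int[mu]_x (g x)%:E = k.+1%:R%:E * \int[mu]_x (f k x)%:E - (s ^+ 2)^-1%:E * \int[mu]_x (f k.+2 x)%:E)%E.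
  rewrite [LHS](_ : _ = \int[mu]_x (EFin \o g) x)%E// gE integralB//=.
  - rewrite !integralZl//; exact: If.
  - apply: integrableZl => //; exact: If.
  - apply: integrableZl => //; exact: If.
have fk j : (\int[mu]_x (f j x)%:E \is a fin_num)%E by apply: integrable_fin_num => //; exact: If.
move=> h; have {h} : (k.+1%:R%:E * \int[mu]_x (f k x)%:E - (s ^+ 2)^-1%:E * \int[mu]_x (f k.+2 x)%:E = 0)%E.
  apply: h.
  - move=> x; apply: cvgB; apply: cvgMr; exact: cf.
  - by apply: cvg_monomial_normal => // n; rewrite ger0_norm.
  - by apply: cvg_monomial_normal => // n; rewrite normrN ger0_norm.
move: (fk k) (fk k.+2); rewrite /f.
case: (integral _ _ _) => //= a _; case: (integral _ _ _) => //= b _.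
rewrite -!EFinM -EFinB => -[]/eqP; rewrite subr_eq0 => /eqP h; congr EFin.
by rewrite -mulrA h mulrA mulfV ?mul1r.
Qed.

Lemma integral_normal_fun (m s : R) : s != 0 ->
  (\int[mu]_x (normal_fun m s x)%:E = (normal_peak s)^-1%:E)%E.
Proof.
move=> s0; have p0 : normal_peak s != 0 by rewrite gt_eqF// normal_peak_gt0.
have := integral_normal_pdf m s.
under eq_integral do rewrite normal_pdfE// EFinM.
rewrite integralZl//; last exact: integrable_normal_fun.
have : (\int[mu]_x (normal_fun m s x)%:E \is a fin_num)%E.
  by apply: integrable_fin_num => //; exact: integrable_normal_fun.
case: (integral _ _ _) => //= a _; rewrite -EFinM => -[] h; congr EFin.
by apply: (mulfI p0); rewrite h mulfV.
Qed.

Lemma integral_monomial_normal (m s : R) k : s != 0 ->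
  (\int[mu]_x ((x - m) ^+ k * normal_fun m s x)%:E =
   (s ^+ k * gmom k / normal_peak s)%:E)%E.
Proof.
move=> s0; elim/ltn_ind: k => -[|[|k]] ih.
- by under eq_integral do rewrite expr0 mul1r; rewrite integral_normal_fun// expr0 !mul1r.
- rewrite /= mulr0 mul0r.
  have dn x : is_derive (x : R) 1 (fun x => - s ^+ 2 * normal_fun m s x)
      ((x - m) ^+ 1 * normal_fun m s x).
    apply: is_derive_eq; rewrite /normal_fun !scaler0 !add0r !subr0.
    rewrite /GRing.scale/=; set e := expR _.
    by field.
  apply: (integral_derivative_eq0 _ _ dn).
  + exact: continuous_monomial_normal.
  + exact: integrable_monomial_normal.
  + rewrite -(mulr0 (- s ^+ 2)); apply: cvgMr.
    have := @cvg_monomial_normal m s 0 (fun n => n%:R) s0; under eq_cvg do rewrite expr0 mul1r.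
    by apply => n; rewrite ger0_norm.
  + rewrite -(mulr0 (- s ^+ 2)); apply: cvgMr.
    have := @cvg_monomial_normal m s 0 (fun n => - n%:R) s0; under eq_cvg do rewrite expr0 mul1r.
    by apply => n; rewrite normrN ger0_norm.
- rewrite integral_monomial_normal_step// ih// -EFinM; congr EFin.
  rewrite -[gmom k.+2]/(k.+1%:R * gmom k) !exprS; ring.
Qed.

(** Moments in the variable [y = (x - m)/c], of deviation [sig], computed in the original variable
    [x]; the Jacobian [|c|] sits in the factor [(normal_peak (c * sig))^-1]. *)
Lemma integral_affine_monomial_normal (m c sig : R) k : c != 0 -> sig != 0 ->
  (\int[mu]_x (((x - m) / c) ^+ k * normal_fun m (c * sig) x)%:E =
   (sig ^+ k * gmom k / normal_peak (c * sig))%:E)%E.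
Proof.
move=> c0 s0; have cs0 : c * sig != 0 by rewrite mulf_neq0.
under eq_integral do rewrite expr_div_n mulrAC mulrC EFinM.
rewrite integralZl//; last exact: integrable_monomial_normal.
rewrite integral_monomial_normal// -EFinM; congr EFin.
by rewrite exprMn !mulrA mulVf ?mul1r// expf_neq0.
Qed.

Lemma integrable_affine_monomial_normal (m c sig : R) k : c != 0 -> sig != 0 ->
  mu.-integrable setT
    (fun x => (((x - m) / c) ^+ k * normal_fun m (c * sig) x)%:E).
Proof.
move=> c0 s0; have cs0 : c * sig != 0 by rewrite mulf_neq0.
have := integrable_monomial_normal m k cs0.
move=> /(integrableZl measurableT (c ^- k)); apply: eq_integrable => // x _ /=.
by rewrite -EFinM expr_div_n; congr EFin; ring.
Qed.

(** Holds for all functions, measurable or not, since the integral of a non-negative function is a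
    supremum over the simple functions below it. It serves for volumes of sections of arbitrary
    sets. *)
Lemma integral_mono (f g : R -> \bar R) : (forall x, (0 <= f x)%E) ->
  (forall x, (f x <= g x)%E) -> (\int[mu]_x f x <= \int[mu]_x g x)%E.
Proof.
move=> f0 fg; have g0 x : (0 <= g x)%E by apply: le_trans (fg x).
rewrite !ge0_integralE// !patch_setT; apply: le_ereal_sup => _ [h hf <-].
by exists h => // x; apply: le_trans (fg x).
Qed.

End GaussMoments.

(** * Volume bounds by iterated one-dimensional Gaussian integrals *)

Section IteratedBounds.
Variable R : realType.
Local Notation mu := (@lebesgue_measure R).

Lemma lebesgue_tuple_ge0 p (E : set (p.-tuple R)) : (0 <= lebesgue_tuple E)%E.
Proof.
elim: p E => [|p ih] E /=; first exact: measure_ge0.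
by apply: integral_ge0 => x _; exact: ih.
Qed.

Lemma lebesgue_tupleS p (E : set (p.+1.-tuple R)) :
  (lebesgue_tuple E = \int[mu]_x lebesgue_tuple [set t : p.-tuple R | E [tuple of x :: t]])%E.
Proof.
rewrite /= /product_measure1; apply: eq_integral => x _ /=; congr lebesgue_tuple.
by apply/seteqP; split => t; rewrite /xsection /= ?inE.
Qed.

(** The indicator of [E] is dominated by a Gaussian weight whose [i]-th centre may depend on the
    previous coordinates. Fixing the first coordinate leaves the same situation, with its factor
    moved into [K]. *)
Lemma lebesgue_tuple_le p (E : set (p.-tuple R)) (K : R) (c : nat -> R)
    (h : nat -> seq R -> R) :
  0 <= K -> (forall i, c i != 0) ->
  (forall t : p.-tuple R, E t ->
     1 <= K * \prod_(i < p) normal_fun (h i (take i t)) (c i) (nth 0 t i)) ->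
  (lebesgue_tuple E <= (K * \prod_(i < p) (normal_peak (c i))^-1)%:E)%E.
Proof.
elim: p E K c h => [|p ih] E K c h K0 c0 hE.
  rewrite !big_ord0 mulr1 /= diracE; have [/set_mem/hE|_] := boolP (_ \in E).
    by rewrite big_ord0 mulr1 lee_fin.
  by rewrite lee_fin.
rewrite lebesgue_tupleS.
pose P := \prod_(i < p) (normal_peak (c i.+1))^-1.
have step x : (lebesgue_tuple [set t : p.-tuple R | E [tuple of x :: t]] <=
    ((K * P) * normal_fun (h 0 [::]) (c 0) x)%:E)%E.
  have -> : K * P * normal_fun (h 0 [::]) (c 0) x =
    (K * normal_fun (h 0 [::]) (c 0) x) * P by ring.
  apply: (ih _ _ (fun i => c i.+1) (fun i s => h i.+1 (x :: s))) => //.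
    by rewrite mulr_ge0// normal_fun_ge0.
  by move=> t /hE /=; rewrite big_ord_recl /= mulrA.
apply: (le_trans (integral_mono _ step)).
  by move=> x; exact: lebesgue_tuple_ge0.
under eq_integral do rewrite EFinM.
rewrite integralZl//; last exact: integrable_normal_fun.
by rewrite integral_normal_fun// -EFinM lee_fin big_ord_recl mulrA mulrAC -/P.
Qed.

(** Substitution from independent coordinates [g]: the [i]-th output is affine in [g_i] with a shift
    depending on the earlier coordinates. The recursion feeds the head [y] to [h], so that [h]
    always sees the whole prefix. *)
Fixpoint triangular (c : nat -> R) (h : nat -> seq R -> R) (g : seq R) : seq R :=
  if g is y :: g' then
    c 0 * y + h 0 [::] ::
      triangular (fun i => c i.+1) (fun i s => h i.+1 (y :: s)) g'
  else [::].

(** Polynomials are lists of coefficients with exponent functions, so that evaluating the first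
    variable merely rescales coefficients and shifts exponents. [mono_gauss] is the mean under
    independent centred normal variables of deviation [sig]. *)
Definition mono_val p (ms : seq (R * (nat -> nat))) (g : seq R) : R :=
  \sum_(m <- ms) m.1 * \prod_(i < p) nth 0 g i ^+ m.2 i.

Definition mono_gauss p (sig : R) (ms : seq (R * (nat -> nat))) : R :=
  \sum_(m <- ms) m.1 * \prod_(i < p) (sig ^+ m.2 i * gmom R (m.2 i)).

(** A polynomial minorant replaces the indicator of [E]: where it is positive it is at most 1 and
    the point lies in [E], and the unnormalized Gaussian weight is at most 1. Hence its Gaussian
    mean times the total Gaussian mass bounds the volume from below. *)
Lemma lebesgue_tuple_ge p (E : set (p.-tuple R)) (sig : R) (c : nat -> R)
    (h : nat -> seq R -> R) (ms : seq (R * (nat -> nat))) :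
  sig != 0 -> (forall i, c i != 0) ->
  (forall g t : p.-tuple R, t = triangular c h g :> seq R ->
    mono_val p ms g <= 1 /\ (0 < mono_val p ms g -> E t)) ->
  ((mono_gauss p sig ms * \prod_(i < p) (normal_peak (c i * sig))^-1)%:E
    <= lebesgue_tuple E)%E.
Proof.
move=> s0; elim: p E c h ms => [|p ih] E c h ms c0 hE.
  rewrite big_ord0 mulr1 /=.
  have -> : mono_gauss 0 sig ms = mono_val 0 ms [::].
    by apply: eq_bigr => m _; rewrite !big_ord0.
  have [h1 h2] := hE [tuple] [tuple] erefl.
  rewrite diracE; have [_|/negP hn] := boolP (_ \in E); first by rewrite lee_fin.
  by rewrite lee_fin leNgt; apply/negP => /h2 ?; apply: hn; rewrite inE.
rewrite lebesgue_tupleS.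
pose P := \prod_(i < p) (normal_peak (c i.+1 * sig))^-1.
have P0 : 0 <= P by apply: prodr_ge0 => i _; rewrite invr_ge0 normal_peak_ge0.
pose h0 := h 0 [::]; pose nf := normal_fun h0 (c 0 * sig).
pose a (m : R * (nat -> nat)) := m.1 * \prod_(i < p) (sig ^+ m.2 i.+1 * gmom R (m.2 i.+1)) * P.
pose f x := (\sum_(m <- ms) (a m * (((x - h0) / c 0) ^+ m.2 0%N * nf x))%:E)%E.
have fE x : f x = ((\sum_(m <- ms) a m * ((x - h0) / c 0) ^+ m.2 0%N) * nf x)%:E.
  by rewrite /f sumEFin mulr_suml; congr EFin; apply: eq_bigr => m _; rewrite mulrA.
have If : mu.-integrable setT f.
  apply: integrable_sum => // m _; under eq_fun do rewrite EFinM.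
  by apply: integrableZl => //; exact: integrable_affine_monomial_normal.
have -> : ((mono_gauss p.+1 sig ms * \prod_(i < p.+1) (normal_peak (c i * sig))^-1)%:E
    = \int[mu]_x f x)%E.
  rewrite /f integral_sum//; last first.
    move=> m; under eq_fun do rewrite EFinM.
    by apply: integrableZl => //; exact: integrable_affine_monomial_normal.
  rewrite /mono_gauss mulr_suml -sumEFin; apply: eq_bigr => m _.
  under eq_integral do rewrite EFinM.
  rewrite integralZl//; last exact: integrable_affine_monomial_normal.
  rewrite integral_affine_monomial_normal// -EFinM; congr EFin.
  by rewrite /a !big_ord_recl /= -/P; ring.
(* Where the partial mean of the polynomial is negative, non-negativity of the volume is enough;
   hence the positive part. *)
have pos x : (f^\+ x <= lebesgue_tuple [set t : p.-tuple R | E [tuple of x :: t]])%E.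
  pose y := (x - h0) / c 0.
  have xy : x = c 0 * y + h0 by rewrite /y mulrC divfK// subrK.
  have {}ih := ih [set t : p.-tuple R | E [tuple of x :: t]] (fun i => c i.+1)
    (fun i s => h i.+1 (y :: s))
    [seq (m.1 * y ^+ m.2 0%N, fun i => m.2 i.+1) | m <- ms] _ _.
  have vE (g : p.-tuple R) : mono_val p [seq (m.1 * y ^+ m.2 0%N, fun i => m.2 i.+1) | m <- ms] g
      = mono_val p.+1 ms [tuple of y :: g].
    rewrite /mono_val big_map; apply: eq_bigr => m _.
    by rewrite big_ord_recl /= mulrA.
  have {}ih : ((\sum_(m <- ms) a m * y ^+ m.2 0%N)%:E <= lebesgue_tuple [set t : p.-tuple R | E [tuple of x :: t]])%E.
    rewrite (_ : \sum_(m <- ms) _ = mono_gauss p sig [seq (m.1 * y ^+ m.2 0%N, fun i => m.2 i.+1) | m <- ms] * P).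
      apply: ih => // g t tE; rewrite vE; apply: hE.
      by rewrite /= -xy tE.
    rewrite /mono_gauss big_map mulr_suml; apply: eq_bigr => m _.
    by rewrite /a /=; ring.
  rewrite funeposE ge_max lebesgue_tuple_ge0 andbT fE -/y.
  have nf1 : nf x <= 1.
    by rewrite -expR0 ler_expR mulNr oppr_le0 divr_ge0 ?mulrn_wge0// sqr_ge0.
  case: (leP (\sum_(m <- ms) a m * y ^+ m.2 0%N) 0) => hy.
    apply: (@le_trans _ _ 0%E); last exact: lebesgue_tuple_ge0.
    by rewrite lee_fin mulr_le0_ge0// normal_fun_ge0.
  by apply: le_trans ih; rewrite lee_fin ler_piMr// ltW.
apply: (@le_trans _ _ (\int[mu]_x f^\+ x)%E).
  apply: le_integral => //.
  - exact: integrable_funepos.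
  - by move=> x _; rewrite funeposE le_max lexx.
by apply: integral_mono => // x; exact: funepos_ge0.
Qed.

End IteratedBounds.

(** * Loop equations *)

Section Splits.
Variable I : eqType.

(** Sum over the factorizations [w = u ++ j :: v]; the recursion moves the head into the prefix. *)
Fixpoint spl (V : nmodType) (f : seq I -> I -> seq I -> V) (w : seq I) : V :=
  if w is j :: w' then f [::] j w' + spl (fun u i v => f (j :: u) i v) w' else 0.

(** Sum over the ways to take one element [v] out of [W], leaving [W']. *)
Fixpoint pick1 (X : Type) (V : nmodType) (f : X -> seq X -> V) (W : seq X) : V :=
  if W is v :: W' then f v W' + pick1 (fun x W'' => f x (v :: W'')) W' else 0.

Lemma eq_spl (V : nmodType) (f g : seq I -> I -> seq I -> V) w :
  (forall u j v, w = u ++ j :: v -> f u j v = g u j v) -> spl f w = spl g w.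
Proof.
elim: w f g => //= j w ih f g h; congr (_ + _); first exact: h.
by apply: ih => u i v wE; apply: h; rewrite wE.
Qed.

Lemma eq_pick1 X (V : nmodType) (f g : X -> seq X -> V) W :
  (forall v W', f v W' = g v W') -> pick1 f W = pick1 g W.
Proof. by elim: W f g => //= v W ih f g h; rewrite h (ih _ (fun x W'' => g x (v :: W''))). Qed.

Lemma spl_morph (V V' : nmodType) (F : V -> V') (f : seq I -> I -> seq I -> V) w :
  F 0 = 0 -> {morph F : x y / x + y} -> F (spl f w) = spl (fun u j v => F (f u j v)) w.
Proof. by move=> F0 FD; elim: w f => //= j w ih f; rewrite FD ih. Qed.

Lemma pick1_morph X (V V' : nmodType) (F : V -> V') (f : X -> seq X -> V) W :
  F 0 = 0 -> {morph F : x y / x + y} -> F (pick1 f W) = pick1 (fun v W' => F (f v W')) W.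
Proof. by move=> F0 FD; elim: W f => //= v W ih f; rewrite FD ih. Qed.

Lemma spl_sum (V : nmodType) (J : Type) (r : seq J) (P : pred J)
    (f : J -> seq I -> I -> seq I -> V) w :
  \sum_(k <- r | P k) spl (f k) w = spl (fun u j v => \sum_(k <- r | P k) f k u j v) w.
Proof.
elim: w f => [|j w ih] f /=; first by rewrite big1.
by rewrite big_split /= ih.
Qed.

Lemma pick1_sum X (V : nmodType) (J : Type) (r : seq J) (P : pred J)
    (f : J -> X -> seq X -> V) W :
  \sum_(k <- r | P k) pick1 (f k) W = pick1 (fun v W' => \sum_(k <- r | P k) f k v W') W.
Proof.
elim: W f => [|v W ih] f /=; first by rewrite big1.
by rewrite big_split /= ih.
Qed.

Lemma splD (V : nmodType) (f g : seq I -> I -> seq I -> V) w :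
  spl f w + spl g w = spl (fun u j v => f u j v + g u j v) w.
Proof. by elim: w f g => [|j w ih] f g /=; rewrite ?addr0// addrACA ih. Qed.

(* Both sides enumerate the factorizations [w = u i a p b]. *)
Lemma spl_spl (V : nmodType) (g : seq I -> I -> seq I -> I -> seq I -> V) w :
  spl (fun u i v => spl (fun a p b => g u i a p b) v) w =
  spl (fun a' p b => spl (fun u i a => g u i a p b) a') w.
Proof.
elim: w g => //= j w ih g.
rewrite (ih (fun u i a p b => g (j :: u) i a p b)) splD add0r.
by apply: eq_spl.
Qed.

Lemma spl_size (V : nmodType) (f : nat -> nat -> V) w :
  spl (fun u _ v => f (size u) (size v)) w =
  \sum_(i < size w) f i (size w - i.+1)%N.
Proof.
elim: w f => [|j w ih] f /=; first by rewrite big_ord0.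
rewrite big_ord_recl /= subn1 /=; congr (_ + _).
by rewrite (ih (fun a b => f a.+1 b)).
Qed.

End Splits.

(** * Loop equations from Gaussian integration by parts in an abstract algebra *)

Section LoopEquation.
Variables (R : realType) (I : eqType) (C : I -> I -> R) (d : nat).
Variable (A : comAlgType R[i]) (E : {linear A -> R[i] | *%R}).
Variables (B : I -> 'M[A]_d) (D : I -> 'I_d -> 'I_d -> A -> A).
Hypothesis DD : forall k p q, {morph D k p q : x y / x + y}.
Hypothesis DM : forall k p q x y, D k p q (x * y) = D k p q x * y + x * D k p q y.
Hypothesis D1 : forall k p q, D k p q 1 = 0.
Hypothesis DB : forall k p q j r s,
  D k p q (B j r s) = (C k j)%:C *: ((r == q)%:R * (p == s)%:R).
Hypothesis E_by_parts : forall k p q f,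
  E (B k p q * f) = d%:R^-1 * E (D k p q f).

Fixpoint wordmx (w : seq I) : 'M[A]_d :=
  if w is k :: w' then B k *m wordmx w' else 1%:M.

Lemma wordmx_cat u v : wordmx (u ++ v) = wordmx u *m wordmx v.
Proof. by elim: u => [|k u ih] /=; rewrite ?mul1mx// ih mulmxA. Qed.

Let D0 k p q : D k p q 0 = 0.
Proof. by apply: (addrI (D k p q 0)); rewrite -DD !addr0. Qed.

Let Dsum k p q (J : Type) (r : seq J) (P : pred J) (F : J -> A) :
  D k p q (\sum_(i <- r | P i) F i) = \sum_(i <- r | P i) D k p q (F i).
Proof. exact: (big_morph (D k p q) (DD k p q) (D0 k p q)). Qed.

(** Leibniz rule: each letter [j] in turn is replaced by [C k j] times the matrix unit at [(q, p)],
    which cuts the word there. *)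
Lemma derive_wordmx k p q w r s : D k p q (wordmx w r s) =
  spl (fun u j v => (C k j)%:C *: (wordmx u r q * wordmx v p s)) w.
Proof.
elim: w r s => [|j w ih] r s /=.
  by rewrite mxE; case: (r == s); rewrite ?D1 ?D0.
rewrite mxE Dsum.
under eq_bigr do rewrite DM DB ih.
rewrite big_split /=; congr (_ + _).
  rewrite (bigD1 p)//= big1 => [|t tp].
    by rewrite addr0 eqxx mulr1 -scalerAl mxE.
  by rewrite [p == t]eq_sym (negbTE tp) mulr0 scaler0 mul0r.
rewrite (eq_bigr (fun t => spl (fun u j0 v => B j r t * ((C k j0)%:C *: (wordmx u t q * wordmx v p s))) w)); last first.
  by move=> t _; rewrite -(spl_morph (F := fun x => B j r t * x)) ?mulr0//; move=> ? ?; rewrite mulrDr.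
rewrite spl_sum; apply: eq_spl => u i v _.
rewrite [wordmx (j :: u) r q]mxE mulr_suml scaler_sumr.
by apply: eq_bigr => t _; rewrite -scalerAr mulrA.
Qed.

(** Removing a letter from a cyclic word opens it, so that [b] is followed by [a]. *)
Lemma derive_trace k p q w : D k p q (\tr (wordmx w)) =
  spl (fun a j b => (C k j)%:C *: wordmx (b ++ a) p q) w.
Proof.
rewrite /mxtrace Dsum.
under eq_bigr do rewrite derive_wordmx.
rewrite spl_sum; apply: eq_spl => a j b _; rewrite -scaler_sumr wordmx_cat mxE.
by congr (_ *: _); apply: eq_bigr => t _; rewrite mulrC.
Qed.

Lemma derive_traces k p q (W : seq (seq I)) :
  D k p q (\prod_(w <- W) \tr (wordmx w)) =
  pick1 (fun v W' => D k p q (\tr (wordmx v)) * \prod_(w <- W') \tr (wordmx w)) W.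
Proof.
elim: W => [|v W ih]; first by rewrite big_nil D1.
rewrite big_cons DM /= ih; congr (_ + _).
rewrite (pick1_morph (F := fun x => \tr (wordmx v) * x)) ?mulr0//; last by move=> ? ?; rewrite mulrDr.
by apply: eq_pick1 => x W'; rewrite big_cons mulrCA.
Qed.

Let Etr W := E (\prod_(w <- W) \tr (wordmx w)).

(** Integration by parts on the entries of the leading [B k]. If the derivative hits the same trace,
    that trace splits in two; if it hits another trace, the two merge. *)
Lemma loop_trace k w W :
  Etr ((k :: w) :: W) = d%:R^-1 *
    (spl (fun u j v => (C k j)%:C * Etr (u :: v :: W)) w +
     pick1 (fun v W' => spl (fun a j b => (C k j)%:C * Etr ((w ++ b ++ a) :: W')) v) W).
Proof.
set F := \prod_(w <- W) \tr (wordmx w).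
have -> : Etr ((k :: w) :: W) =
    \sum_p \sum_q E (B k p q * (wordmx w q p * F)).
  rewrite /Etr big_cons -/F /mxtrace mulr_suml linear_sum; apply: eq_bigr => p _.
  by rewrite mxE mulr_suml linear_sum; apply: eq_bigr => q _; rewrite mulrA.
under eq_bigr do under eq_bigr do rewrite E_by_parts DM linearD.
under eq_bigr do rewrite -mulr_sumr big_split /=.
rewrite -mulr_sumr big_split /=; congr (_ * (_ + _)).
- have h p q : E (D k p q (wordmx w q p) * F) =
      spl (fun u j v => (C k j)%:C * E (wordmx u q q * wordmx v p p * F)) w.
    rewrite derive_wordmx (spl_morph (F := fun x => E (x * F))) ?mul0r ?linear0//.
      by apply: eq_spl => u j v _; rewrite -scalerAl linearZ.
    by move=> ? ?; rewrite mulrDl linearD.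
  under eq_bigr do under eq_bigr do rewrite h.
  under eq_bigr do rewrite spl_sum.
  rewrite spl_sum; apply: eq_spl => u j v _.
  under eq_bigr do rewrite -mulr_sumr.
  rewrite -mulr_sumr; congr (_ * _).
  rewrite /Etr !big_cons -/F mulrA /mxtrace mulr_suml mulr_suml linear_sum exchange_big /=.
  apply: eq_bigr => q _; rewrite mulr_sumr mulr_suml linear_sum; exact: eq_bigr.
- have h p q : E (wordmx w q p * D k p q F) = pick1 (fun v W' => spl (fun a j b =>
      (C k j)%:C * E (wordmx w q p * wordmx (b ++ a) p q * \prod_(w <- W') \tr (wordmx w))) v) W.
    rewrite derive_traces (pick1_morph (F := fun x => E (wordmx w q p * x))).
    - apply: eq_pick1 => v W'; rewrite derive_trace.
      rewrite (spl_morph (F := fun x => E (wordmx w q p * (x * _)))).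
      + by apply: eq_spl => a j b _; rewrite -scalerAl -scalerAr linearZ /= mulrA.
      + by rewrite mul0r mulr0 linear0.
      + by move=> ? ?; rewrite mulrDl mulrDr linearD.
    - by rewrite mulr0 linear0.
    - by move=> ? ?; rewrite mulrDr linearD.
  under eq_bigr do under eq_bigr do rewrite h.
  under eq_bigr do rewrite pick1_sum.
  rewrite pick1_sum; apply: eq_pick1 => v W'.
  transitivity (\sum_p spl (fun a j b => \sum_q (C k j)%:C *
      E (wordmx w q p * wordmx (b ++ a) p q * \prod_(w <- W') \tr (wordmx w))) v).
    apply: eq_bigr => p _.
    exact: (spl_sum _ _ (fun q a j b => (C k j)%:C *
      E (wordmx w q p * wordmx (b ++ a) p q * \prod_(w <- W') \tr (wordmx w)))).
  rewrite spl_sum; apply: eq_spl => a j b _.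
  rewrite /Etr big_cons wordmx_cat /mxtrace mulr_suml linear_sum mulr_sumr exchange_big /=.
  apply: eq_bigr => q _; rewrite -wordmx_cat [wordmx (w ++ _)]wordmx_cat mxE.
  by rewrite mulr_suml linear_sum mulr_sumr.
Qed.

(* All the coefficients of the loop equation are real, so real parts satisfy
   it too. *)
Definition trace_moment (W : seq (seq I)) : R :=
  complex.Re (E (\prod_(w <- W) (d%:R^-1 *: \tr (wordmx w)))).

Let ReM_real (a : R) (z : R[i]) : complex.Re (a%:C * z) = a * complex.Re z.
Proof. by case: z => x y /=; rewrite mul0r subr0. Qed.

Let dV : (d%:R^-1 : R[i]) = (d%:R^-1 : R)%:C.
Proof. by rewrite (fmorphV (real_complex R)) rmorph_nat. Qed.

Let tmE W : trace_moment W = (d%:R ^- size W) * complex.Re (Etr W).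
Proof.
rewrite /trace_moment /Etr -ReM_real; congr complex.Re.
rewrite -exprVn (rmorphXn (real_complex R)) /= -dV.
have -> : \prod_(w <- W) (d%:R^-1 *: \tr (wordmx w)) =
    d%:R^-1 ^+ size W *: \prod_(w <- W) \tr (wordmx w).
  elim: W => [|w W ih]; first by rewrite !big_nil expr0 scale1r.
  by rewrite !big_cons ih -scalerAl -scalerAr scalerA exprS.
by rewrite linearZ.
Qed.

Hypothesis E1 : E 1 = 1.
Hypothesis d0 : (0 < d)%N.

Lemma trace_moment0 : trace_moment [::] = 1.
Proof. by rewrite /trace_moment big_nil E1. Qed.

Lemma trace_moment_nil W : trace_moment ([::] :: W) = trace_moment W.
Proof.
have dn0 : (d%:R : R[i]) != 0 by rewrite pnatr_eq0 -lt0n.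
by rewrite /trace_moment big_cons /= mxtrace1 -[(d%:R : A)](scaler_nat d) scalerA mulVf// scale1r mul1r.
Qed.

(** With normalized traces, a splitting term has one trace more than the left side, which absorbs
    the factor [1/d]; a merging term has one less, which leaves [d^-2]. *)
Lemma trace_moment_loop k w W :
  trace_moment ((k :: w) :: W) =
    spl (fun u j v => C k j * trace_moment (u :: v :: W)) w +
    d%:R ^- 2 *
      pick1 (fun v W' => spl (fun a j b => C k j * trace_moment ((w ++ b ++ a) :: W')) v) W.
Proof.
have ReD : {morph (@complex.Re R) : x y / x + y} by move=> [? ?] [? ?].
have dn0 : (d%:R : R) != 0 by rewrite pnatr_eq0 -lt0n.
rewrite tmE loop_trace dV ReM_real ReD /= exprSr invfM.
rewrite (spl_morph (F := @complex.Re R))// (pick1_morph (F := @complex.Re R))//.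
rewrite mulrA mulrDr; congr (_ + _).
  rewrite (spl_morph (F := fun x => d%:R ^- size W / d%:R / d%:R * x)) ?mulr0//; last by move=> ? ?; rewrite mulrDr.
  apply: eq_spl => u j v _; rewrite ReM_real tmE /= exprS exprS !invfM.
  by rewrite mulrCA; congr (_ * _); ring.
rewrite (pick1_morph (F := fun x => d%:R ^- size W / d%:R / d%:R * x)) ?mulr0//; last by move=> ? ?; rewrite mulrDr.
rewrite [RHS](pick1_morph (F := fun x => d%:R ^- 2 * x)) ?mulr0//; last by move=> ? ?; rewrite mulrDr.
(* Extensionality of [pick1] that remembers how many words remain, as needed to compare the powers
   of [d]. *)
have aux : forall (f g : seq I -> seq (seq I) -> R) W0,
    (forall v W', (size W').+1 = size W0 -> f v W' = g v W') -> pick1 f W0 = pick1 g W0.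
  move=> f g W0; elim: W0 f g => //= v W0 ih f g fg; rewrite fg//; congr (_ + _).
  by apply: ih => x W' sW'; rewrite fg//= sW'.
apply: aux => v W' sW'.
rewrite (spl_morph (F := @complex.Re R))// (spl_morph (F := fun x => d%:R ^- size W / d%:R / d%:R * x)) ?mulr0//; last by move=> ? ?; rewrite mulrDr.
rewrite [RHS](spl_morph (F := fun x => d%:R ^- 2 * x)) ?mulr0//; last by move=> ? ?; rewrite mulrDr.
apply: eq_spl => a j b _; rewrite ReM_real tmE /= sW' exprSr expr1 !invfM.
by ring.
Qed.

End LoopEquation.

Section LoopLimit.
Variables (R : realType) (I : eqType) (C : I -> I -> R).
Variables (T : nat -> seq (seq I) -> R) (m : seq I -> R).
Hypothesis T0 : forall d, (0 < d)%N -> T d [::] = 1.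
Hypothesis Tnil : forall d W, (0 < d)%N -> T d ([::] :: W) = T d W.
Hypothesis Tloop : forall d k w W, (0 < d)%N -> T d ((k :: w) :: W) =
    spl (fun u j v => C k j * T d (u :: v :: W)) w +
    d%:R ^- 2 *
      pick1 (fun v W' => spl (fun a j b => C k j * T d ((w ++ b ++ a) :: W')) v) W.
Hypothesis m0 : m [::] = 1.
Hypothesis m_loop : forall k w, m (k :: w) = spl (fun u j v => C k j * m u * m v) w.

(** Counting each word for one more than its length makes the measure drop in all three moves:
    deleting an empty word, splitting, merging. *)
Let wt (W : seq (seq I)) := (\sum_(w <- W) (size w).+1)%N.

Lemma cvg_spl (f : nat -> seq I -> I -> seq I -> R) g w :
  (forall u j v, w = u ++ j :: v -> f d u j v @[d --> \oo] --> g u j v) ->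
  spl (f d) w @[d --> \oo] --> spl g w.
Proof.
elim: w f g => [|j w ih] f g h /=; first exact: cvg_cst.
apply: cvgD; first exact: h.
by apply: (ih (fun d u => f d (j :: u))) => u i v wE; apply: h; rewrite wE.
Qed.

Lemma cvg_pick1 (f : nat -> seq I -> seq (seq I) -> R) g W :
  (forall W1 v W2, W = W1 ++ v :: W2 -> f d v (W1 ++ W2) @[d --> \oo] --> g v (W1 ++ W2)) ->
  pick1 (f d) W @[d --> \oo] --> pick1 g W.
Proof.
elim: W f g => [|v W ih] f g h /=; first exact: cvg_cst.
apply: cvgD; first exact: (h [::]).
by apply: (ih (fun d x W'' => f d x (v :: W''))) => W1 x W2 WE; apply: (h (v :: W1)); rewrite WE.
Qed.

Lemma loop_limit W : T d W @[d --> \oo] --> \prod_(w <- W) m w.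
Proof.
have [n] := ubnP (wt W); elim: n W => // n ih [|[|k w] W]; rewrite /wt ?big_cons => h.
- rewrite big_nil; apply: (@cvg_near_cst _ R^o).
  by exists 1%N => // d /= d0; rewrite T0.
- rewrite m0 mul1r.
  apply: (@cvg_trans _ (T d W @[d --> \oo])); last by apply: ih; rewrite /wt; lia.
  by apply: near_eq_cvg; exists 1%N => // d /= d0; rewrite Tnil.
- rewrite m_loop (spl_morph (F := fun x => x * _)) ?mul0r//; last by move=> ? ?; rewrite mulrDl.
  set a := spl _ w.
  set P : nat -> R := fun d => pick1 (fun v W' => spl (fun a j b => C k j * T d ((w ++ b ++ a) :: W')) v) W.
  (* The merging terms converge by induction, so the factor [d^-2] sends their contribution to 0
     whatever the limit [l] is. *)
  have [l cP] : exists l : R, P d @[d --> \oo] --> l.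
    pose g v W' := spl (fun a j b => C k j * \prod_(w <- (w ++ b ++ a) :: W') m w) v.
    exists (pick1 g W); apply: cvg_pick1 => W1 v W2 WE; apply: cvg_spl => x j y vE.
    apply: cvgMr; apply: ih; rewrite /wt big_cons big_cat /=.
    by move: h; rewrite WE big_cat big_cons vE /= !size_cat /=; lia.
  have c1 : spl (fun u j v => C k j * T d (u :: v :: W)) w @[d --> \oo] --> a.
    apply: cvg_spl => u j v wE; rewrite -2!mulrA; apply: cvgMr.
    have -> : m u * (m v * \prod_(j0 <- W) m j0) = \prod_(w <- [:: u, v & W]) m w.
      by rewrite !big_cons.
    apply: ih.
    by move: h; rewrite /wt !big_cons /= wE size_cat /=; lia.
  have c2 : d%:R ^- 2 * P d @[d --> \oo] --> (0 : R).
    rewrite -(mul0r l); apply: cvgM => //.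
    have h1 : harmonic d @[d --> \oo] --> (0 : R) by exact: cvg_harmonic.
    have h2 : (harmonic d * harmonic d : R) @[d --> \oo] --> (0 : R).
      by rewrite -(mulr0 0); exact: cvgM.
    rewrite -cvg_shiftS; apply: cvg_trans h2; apply: near_eq_cvg.
    by near=> d; rewrite /harmonic/= -invfM expr2.
  rewrite -[a]addr0; apply: (cvg_trans _ (cvgD c1 c2)).
  by apply: near_eq_cvg; exists 1%N => // d /= d0; rewrite Tloop.
Unshelve. all: by end_near. Qed.

End LoopLimit.

(** * Catalan type bound on trace moments of degree up to a power of the dimension *)

Section LoopBound.
Variables (R : realType) (I : eqType) (C : I -> I -> R) (d L : nat).
Variables (T : seq (seq I) -> R).
Hypothesis C2 : forall k j, `|C k j| <= 2.
Hypothesis T0 : T [::] = 1.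
Hypothesis Tnil : forall W, T ([::] :: W) = T W.
Hypothesis Tloop : forall k w W, T ((k :: w) :: W) =
    spl (fun u j v => C k j * T (u :: v :: W)) w +
    d%:R ^- 2 *
      pick1 (fun v W' => spl (fun a j b => C k j * T ((w ++ b ++ a) :: W')) v) W.
Hypothesis Ld : (L.+1 ^ 5 <= d ^ 2)%N.

(** Majorant of the Catalan recursion: the weights [1/(j+1)^2] are stable under convolution up to a
    constant, and the rate 12 is large enough to leave half of the bound to the merging terms. *)
Definition loop_weight (j : nat) : R := 12 ^+ j / j.+1%:R ^+ 2.
Local Notation kappa := loop_weight.

Lemma loop_weight_gt0 j : 0 < kappa j.
Proof. by rewrite divr_gt0// exprn_gt0// ltr0n. Qed.

Lemma sum_inv_sqr_le2 n : \sum_(i < n) (i.+1%:R ^+ 2)^-1 <= 2 :> R.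
Proof.
case: n => [|n]; first by rewrite big_ord0.
(* The sharper bound telescopes, because [1/(n+2)^2 <= 1/(n+1) - 1/(n+2)]. *)
suff : \sum_(i < n.+1) (i.+1%:R ^+ 2)^-1 <= 2 - n.+1%:R^-1 :> R.
  by move=> /le_trans; apply; rewrite gerBl invr_ge0.
elim: n => [|n ih]; first by rewrite big_ord_recl big_ord0 expr1n invr1; lra.
rewrite big_ord_recr /=; apply: (le_trans (lerD ih (lexx _))).
rewrite -subr_ge0 -[n.+2%:R]natr1.
have := ltr0Sn R n; move: (n.+1%:R) => x x0.
have -> : 2 - (x + 1)^-1 - (2 - x^-1 + (x + 1) ^- 2) = (x * (x + 1) ^+ 2)^-1 :> R.
  by field; rewrite !gt_eqF// addr_gt0.
by rewrite invr_ge0 mulr_ge0 ?sqr_ge0// ltW.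
Qed.

(** As [1/(xy) = (1/x + 1/y)/(x + y)], a product of two weights is at most the weight of the sum
    times [2 (1/x^2 + 1/y^2)], and the brackets add up to at most 4. The prefactor 2 on the left is
    the bound on [C k j]. *)
Lemma loop_weight_conv s :
  2 * \sum_(i < s) (kappa i * kappa (s - i.+1)) <= 2^-1 * kappa s.+1.
Proof.
have h i j : kappa i * kappa j <= 12 ^+ (i + j) / (i + j).+2%:R ^+ 2 *
    (2 * (i.+1%:R ^- 2 + j.+1%:R ^- 2)).
  rewrite /kappa mulrACA -exprD -mulrA; apply: ler_wpM2l; first exact: exprn_ge0.
  have -> : (i + j).+2%:R = i.+1%:R + j.+1%:R :> R by rewrite -natrD addSn addnS.
  move: (ltr0Sn R i) (ltr0Sn R j); move: (i.+1%:R) (j.+1%:R) => x y x0 y0.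
  rewrite -subr_ge0.
  have -> : (x + y) ^- 2 * (2 * (x ^- 2 + y ^- 2)) - x ^- 2 / y ^+ 2 =
     ((x^-1 - y^-1) / (x + y)) ^+ 2.
    by field; rewrite !gt_eqF// addr_gt0.
  exact: sqr_ge0.
case: s => [|s]; first by rewrite big_ord0 mulr0 mulr_ge0// ltW// loop_weight_gt0.
apply: (@le_trans _ _ (2 * \sum_(i < s.+1) (12 ^+ s / s.+2%:R ^+ 2 *
    (2 * (i.+1%:R ^- 2 + (rev_ord i).+1%:R ^- 2))))).
  rewrite ler_pM2l//; apply: ler_sum => i _; apply: (le_trans (h _ _)).
  have -> : (i + (s.+1 - i.+1) = s)%N by case: i => i /= hi; lia.
  by rewrite lexx.
rewrite -mulr_sumr -mulr_sumr big_split /=.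
have -> : \sum_(i < s.+1) (rev_ord i).+1%:R ^- 2 = \sum_(i < s.+1) i.+1%:R ^- 2 :> R.
  by rewrite (reindex_inj rev_ord_inj) /=; apply: eq_bigr => i _; congr (_%:R ^- 2); case: i => i /= hi; lia.
have := sum_inv_sqr_le2 s.+1; set X := \sum_(i < _) _ => hX.
rewrite /kappa !exprS; set p := 12 ^+ s.
have p0 : 0 < p by exact: exprn_gt0.
rewrite -[s.+3%:R]natr1.
have : 1 <= s.+2%:R :> R by rewrite ler1n.
move: (s.+2%:R) => x x1.
have -> : 2^-1 * (12 * (12 * p) / ((x + 1) * ((x + 1) * (x + 1) ^+ 0))) = (p / (x * (x * x ^+ 0))) * (72 * x ^+ 2 / (x + 1) ^+ 2).
  by field; rewrite !gt_eqF//; lra.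
rewrite mulrCA; apply: ler_wpM2l.
  by rewrite expr0 mulr1 divr_ge0 ?mulr_ge0 ?ltW//; lra.
rewrite ler_pdivlMr ?exprn_gt0//; last by lra.
apply: (@le_trans _ _ (16 * (x + 1) ^+ 2)).
  by rewrite ler_wpM2r ?sqr_ge0//; lra.
by nra.
Qed.

Lemma spl_le (f g : seq I -> I -> seq I -> R) w :
  (forall u j v, w = u ++ j :: v -> f u j v <= g u j v) -> spl f w <= spl g w.
Proof.
elim: w f g => //= j w ih f g h; apply: lerD; first exact: h.
by apply: ih => u i v wE; apply: h; rewrite wE.
Qed.

Lemma pick1_le (f g : seq I -> seq (seq I) -> R) W :
  (forall W1 v W2, W = W1 ++ v :: W2 -> f v (W1 ++ W2) <= g v (W1 ++ W2)) ->
  pick1 f W <= pick1 g W.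
Proof.
elim: W f g => //= v W ih f g h; apply: lerD; first exact: (h [::]).
by apply: ih => W1 x W2 WE; apply: (h (v :: W1)); rewrite WE.
Qed.

Lemma norm_spl_le (f : seq I -> I -> seq I -> R) w :
  `|spl f w| <= spl (fun u j v => `|f u j v|) w.
Proof.
elim: w f => [|j w ih] f /=; first by rewrite normr0.
by apply: (le_trans (ler_normD _ _)); apply: lerD.
Qed.

Lemma norm_pick1_le (f : seq I -> seq (seq I) -> R) W :
  `|pick1 f W| <= pick1 (fun v W' => `|f v W'|) W.
Proof.
elim: W f => [|v W ih] f /=; first by rewrite normr0.
by apply: (le_trans (ler_normD _ _)); apply: lerD.
Qed.

Lemma pick1_prod (F G : seq I -> R) W :
  pick1 (fun v W' => G v * (F v * \prod_(w <- W') F w)) W =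
  (\sum_(v <- W) G v) * \prod_(w <- W) F w.
Proof.
elim: W => [|v W ih] /=; first by rewrite big_nil mul0r.
rewrite !big_cons mulrDl; congr (_ + _).
rewrite mulrCA -ih (pick1_morph (F := fun x => F v * x)) ?mulr0//; last by move=> ? ?; rewrite mulrDr.
by apply: eq_pick1 => x W'; rewrite big_cons; ring.
Qed.

(** Merging loses two letters, whence [12^-2], and each of the two denominators costs at most
    [(L+1)^2]. *)
Lemma loop_weight_merge s v j : (s < L)%N -> (v <= L)%N -> (j < s + v)%N ->
  j.+1 = (s + v)%N ->
  kappa j <= 12 ^- 2 * L.+1%:R ^+ 4 * kappa s.+1 * kappa v.
Proof.
move=> sL vL _ jE.
apply: (@le_trans _ _ (12 ^+ j)).
  by rewrite ler_pdivrMr ?exprn_gt0 ?ltr0n// ler_peMr ?exprn_ge0// exprn_ege1// ler1n.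
rewrite /kappa.
have -> : 12 ^- 2 * L.+1%:R ^+ 4 * (12 ^+ s.+1 / s.+2%:R ^+ 2) * (12 ^+ v / v.+1%:R ^+ 2) =
   12 ^+ j * (L.+1%:R ^+ 4 / (s.+2%:R ^+ 2 * v.+1%:R ^+ 2)) :> R.
  have : 12 ^+ s * 12 ^+ v = 12 * 12 ^+ j :> R by rewrite -exprD -jE exprS.
  move: (ltr0Sn R s.+1) (ltr0Sn R v); move: (s.+2%:R) (v.+1%:R) => x y x0 y0 e.
  rewrite [12 ^+ s.+1]exprS; transitivity ((12 ^+ s * 12 ^+ v) / 12 * (L.+1%:R ^+ 4 / (x ^+ 2 * y ^+ 2)) : R).
    by field; rewrite !gt_eqF.
  by rewrite e; field; rewrite !gt_eqF.
rewrite ler_peMr ?exprn_ge0// ler_pdivlMr ?mulr_gt0 ?exprn_gt0 ?ltr0n// mul1r.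
rewrite -[4%N]/(2 + 2)%N exprD; apply: ler_pM; rewrite ?exprn_ge0//.
all: by rewrite lerXn2r ?nnegrE ?ler0n// ler_nat; lia.
Qed.

(** Splitting terms take half of the weight by [loop_weight_conv]. There are at most [L] merging
    terms, each costing a factor of order [(L+1)^4], so [(L+1)^5 <= d^2] lets the prefactor [d^-2]
    fit them into the other half. *)
Lemma loop_bound W : (\sum_(w <- W) size w <= L)%N ->
  `|T W| <= \prod_(w <- W) kappa (size w).
Proof.
have [n] := ubnP (\sum_(w <- W) (size w).+1)%N.
elim: n W => [W|n ih]; first by rewrite ltn0.
case=> [|[|k w] W]; rewrite ?big_cons ?big_nil.
- by rewrite T0 normr1.
- move=> h1 h2; rewrite Tnil /kappa expr0 expr1n divr1 mul1r.
  by apply: ih; lia.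
move=> h1 h2 /=; rewrite Tloop.
set P := \prod_(j <- W) kappa (size j).
have P0 : 0 <= P by apply: prodr_ge0 => i _; exact/ltW/loop_weight_gt0.
apply: (le_trans (ler_normD _ _)).
have -> : kappa (size w).+1 * P = 2^-1 * kappa (size w).+1 * P + 2^-1 * kappa (size w).+1 * P by lra.
apply: lerD.
  apply: (le_trans (norm_spl_le _ _)).
  apply: (@le_trans _ _ (spl (fun u _ v => 2 * (kappa (size u) * kappa (size v)) * P) w)).
    apply: spl_le => u j v wE; rewrite normrM -mulrA; apply: ler_pM => //.
    have := ih [:: u, v & W]; rewrite !big_cons -/P mulrA; apply.
      by move: h1; rewrite /= wE size_cat /=; lia.
    by move: h2; rewrite /= wE size_cat /=; lia.
  rewrite (spl_size (fun a b => 2 * (kappa a * kappa b) * P)) -mulr_suml -mulr_sumr.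
  by apply: ler_wpM2r => //; exact: loop_weight_conv.
rewrite normrM ger0_norm ?invr_ge0 ?exprn_ge0//.
set K := 2 * (12 ^- 2 * L.+1%:R ^+ 4 * kappa (size w).+1).
have K0 : 0 <= K by rewrite !mulr_ge0 ?invr_ge0 ?exprn_ge0// ltW// loop_weight_gt0.
have hp : `|pick1 (fun v W' => spl (fun a j b => C k j * T ((w ++ b ++ a) :: W')) v) W| <=
    K * (L%:R * P).
  apply: (le_trans (norm_pick1_le _ _)).
  apply: (@le_trans _ _ (pick1 (fun v W' => K * ((size v)%:R * (kappa (size v) * \prod_(w <- W') kappa (size w)))) W)).
    apply: pick1_le => W1 v W2 WE; apply: (le_trans (norm_spl_le _ _)).
    have bW : (\sum_(j <- W) size j = \sum_(j <- W1 ++ W2) size j + size v)%N.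
      by rewrite WE !big_cat big_cons /=; lia.
    have bW' : (\sum_(j <- W) (size j).+1 = \sum_(j <- W1 ++ W2) (size j).+1 + (size v).+1)%N.
      by rewrite WE !big_cat big_cons /=; lia.
    set Q := \prod_(w <- _) _.
    have Q0 : 0 <= Q by apply: prodr_ge0 => i _; exact/ltW/loop_weight_gt0.
    apply: (@le_trans _ _ (spl (fun _ _ _ => K * (kappa (size v) * Q)) v)).
      apply: spl_le => a j b vE; 
      have -> : K * (kappa (size v) * Q) =
          2 * ((12 ^- 2 * L.+1%:R ^+ 4 * kappa (size w).+1 * kappa (size v)) * Q).
        by rewrite /K; ring.
      rewrite normrM; apply: ler_pM => //.
      have hv : size v = (size a + (size b).+1)%N by rewrite vE size_cat.
      have := ih ((w ++ b ++ a) :: (W1 ++ W2)); rewrite !big_cons -/Q !size_cat => H.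
      apply: (le_trans (H _ _)).
      - by move: h1 => /=; rewrite bW' hv; lia.
      - by move: h2 => /=; rewrite bW hv; lia.
      apply: ler_wpM2r => //.
      by apply: loop_weight_merge; move: h2 => /=; rewrite bW hv; lia.
    rewrite (spl_size (fun _ _ => K * (kappa (size v) * Q))) sumr_const card_ord -mulr_natr.
    by rewrite le_eqVlt; apply/orP; left; apply/eqP; ring.
  rewrite -(pick1_morph (F := fun x => K * x)) ?mulr0//; last by move=> ? ?; rewrite mulrDr.
  rewrite (pick1_prod (fun v => kappa (size v)) (fun v => (size v)%:R)) -/P.
  apply: ler_wpM2l => //; apply: ler_wpM2r => //.
  by rewrite -natr_sum ler_nat; move: h2 => /=; lia.
have d0 : 0 < d%:R ^+ 2 :> R.
  rewrite exprn_gt0// ltr0n lt0n; apply/eqP => dz.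
  by move: Ld; rewrite dz leqNgt expn_gt0.
rewrite ler_pdivrMl//; apply: (le_trans hp); rewrite /K.
have Ld' : L.+1%:R ^+ 5 <= d%:R ^+ 2 :> R by rewrite -!natrX ler_nat.
have -> : 2 * (12 ^- 2 * L.+1%:R ^+ 4 * kappa (size w).+1) * (L%:R * P) =
   (kappa (size w).+1 * P) * (2 * (12 ^- 2) * (L.+1%:R ^+ 4 * L%:R)) by ring.
have -> : d%:R ^+ 2 * (2^-1 * kappa (size w).+1 * P) = (kappa (size w).+1 * P) * (2^-1 * d%:R ^+ 2) by ring.
apply: ler_wpM2l; first by rewrite mulr_ge0// ltW// loop_weight_gt0.
apply: ler_pM.
- by rewrite mulr_ge0// invr_ge0 exprn_ge0.
- by rewrite mulr_ge0 ?exprn_ge0.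
- by rewrite expr2; lra.
- apply: le_trans Ld'; rewrite (exprS _ 4) mulrC; apply: ler_wpM2r; first exact: exprn_ge0.
  by rewrite ler_nat.
Qed.

End LoopBound.

(** * Gaussian matrices *)

Section GaussExpectation.
Import -(notations) mpoly.
Variables (R : realType) (n : nat) (sig : R).
Local Notation A := (mpoly n R[i]).

Definition gauss_weight (m : multinom n) : R :=
  \prod_(i < n) (sig ^+ m i * gmom R (m i)).

(** The mean in independent normal variables, defined monomial by monomial, so that the matrix
    computations are pure algebra; [mono_gauss_monomials] ties it to integrals. *)
Definition gauss_E (p : A) : R[i] :=
  \sum_(m <- msupp p) mcoeff m p * (gauss_weight m)%:C.

(** A common finite set of monomials turns linearity into a termwise check. *)
Lemma gauss_Ew k p : (msize p <= k)%N ->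
  gauss_E p = \sum_(m : bmultinom n k) mcoeff m p * (gauss_weight m)%:C.
Proof.
move=> pk; rewrite /gauss_E (ssrcomplements.big_mksub (bmultinom n k)) /=; first last.
- by move=> x /msize_mdeg_lt /leq_trans; apply.
- exact: msupp_uniq.
by rewrite big_rmcond //= => i /memN_msupp_eq0 ->; rewrite mul0r.
Qed.

Lemma gauss_E_is_linear : linear_for *%R gauss_E.
Proof.
move=> a p q; pose k := maxn (msize (a *: p + q)) (maxn (msize p) (msize q)).
rewrite (@gauss_Ew k) ?leq_maxl// (@gauss_Ew k p) ?(@gauss_Ew k q); last first.
- by rewrite /k !leq_max leqnn !orbT.
- by rewrite /k !leq_max leqnn !orbT.
rewrite mulr_sumr -big_split /=; apply: eq_bigr => m _.
by rewrite mcoeffD mcoeffZ mulrDl mulrA.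
Qed.

HB.instance Definition _ := GRing.isLinear.Build R[i] A R[i] *%R gauss_E
  gauss_E_is_linear.

Lemma gauss_E_monomial m : gauss_E (mpolyX R[i] m) = (gauss_weight m)%:C.
Proof. by rewrite /gauss_E msuppX big_seq1 mcoeffX eqxx mul1r. Qed.

Lemma gauss_E1 : gauss_E 1 = 1.
Proof.
rewrite -mpolyX0 gauss_E_monomial /gauss_weight big1// => i _.
by rewrite mnm0E expr0 mul1r.
Qed.

(** On a monomial this is the recursion of [gmom] in the exponent of variable [i]; for exponent 0
    both sides vanish because [gmom 1 = 0]. *)
Lemma gauss_E_by_parts i (p : A) :
  gauss_E (mpolyX R[i] (mnm1 i) * p) = (sig ^+ 2)%:C * gauss_E (mderiv i p).
Proof.
elim/mpolyind: p => [|c m p _ _ ih]; first by rewrite mulr0 !linear0 mulr0.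
rewrite mulrDr linearD /= ih linearD /= linearD /= mulrDr; congr (_ + _).
rewrite -scalerAr.
have -> : mderiv i (c *: mpolyX R[i] m) = c *: mderiv i (mpolyX R[i] m) by rewrite linearZ.
rewrite [LHS]linearZ [in RHS]linearZ /= mulrCA; congr (_ * _).
rewrite -mpolyXD mderivX linearZ /= !gauss_E_monomial.
rewrite -(rmorph_nat (real_complex R)) -2!(rmorphM (real_complex R)); congr (real_complex R _).
rewrite /gauss_weight (bigD1 i)//= [in RHS](bigD1 i)//= mnmDE mnm1E eqxx mnmBE mnm1E eqxx.
rewrite (eq_bigr (fun j => sig ^+ m j * gmom R (m j))); last first.
  by move=> j ji; rewrite mnmDE mnm1E eq_sym (negbTE ji) add0n.
rewrite [X in _ = _ * (_ * (_ * X))](eq_bigr (fun j => sig ^+ m j * gmom R (m j))); last first.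
  by move=> j ji; rewrite mnmBE mnm1E eq_sym (negbTE ji) subn0.
set P := \prod_(_ < n | _) _.
case: (m i) => [|k]; first by rewrite /= mulr0 !mul0r mulr0.
rewrite -[gmom R (true + k.+1)]/(k.+1%:R * gmom R k) subn1 /= !exprS; ring.
Qed.

Definition monomials (p : A) : seq (R * (nat -> nat)) :=
  [seq (complex.Re (mcoeff m p), fun i => nth 0%N m i) | m <- msupp p].

Let ReD : {morph (@complex.Re R) : x y / x + y}.
Proof. by move=> [? ?] [? ?]. Qed.

Let ReMr (z : R[i]) (a : R) : complex.Re (z * a%:C) = complex.Re z * a.
Proof. by case: z => x y /=; rewrite mulr0 subr0. Qed.

Lemma mono_val_monomials (p : A) (g : n.-tuple R) :
  mono_val n (monomials p) g = complex.Re (meval (fun i => (tnth g i)%:C) p).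
Proof.
rewrite mevalE (big_morph _ ReD erefl) /mono_val /monomials big_map.
apply: eq_bigr => m _.
have -> : \prod_(i < n) (tnth g i)%:C ^+ m i = (\prod_(i < n) nth 0 g i ^+ nth 0%N m i)%:C.
  rewrite (rmorph_prod (real_complex R)); apply: eq_bigr => i _.
  by rewrite (rmorphXn (real_complex R)) /= (tnth_nth 0) /fun_of_multinom (tnth_nth 0%N).
by rewrite ReMr.
Qed.

Lemma mono_gauss_monomials (p : A) :
  mono_gauss n sig (monomials p) = complex.Re (gauss_E p).
Proof.
rewrite /gauss_E (big_morph _ ReD erefl) /mono_gauss /monomials big_map.
apply: eq_bigr => m _; rewrite ReMr; congr (_ * _).
by apply: eq_bigr => i _; rewrite /fun_of_multinom (tnth_nth 0%N).
Qed.

End GaussExpectation.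

Lemma index_allpairs (T1 T2 : eqType) (s : seq T1) (t : seq T2) x y :
  x \in s -> y \in t ->
  index (x, y) [seq (a, b) | a <- s, b <- t] = (index x s * size t + index y t)%N.
Proof.
move=> + yt; elim: s => //= a s ih; rewrite inE index_cat size_map.
have [->|xa] /= := eqVneq x a => xs.
  by rewrite map_f// (index_map (f := pair a)) ?eqxx// => b c [].
case: mapP => [[b _ [xa']]|_]; first by rewrite xa' eqxx in xa.
by rewrite ih// mulSn addnA.
Qed.

(** The pairing is row-major, so the coordinates of one matrix are consecutive. This links the
    matrix indexing with the order in which [lebesgue_tuple] integrates. *)
Lemma val_mxvec_index m n (i : 'I_m) (j : 'I_n) :
  mxvec_index i j = (i * n + j)%N :> nat.
Proof.
have -> : mxvec_index i j = index (i, j) (enum {: 'I_m * 'I_n}) :> nat.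
  rewrite -[in RHS](nth_enum_rank (i, j) (i, j)) index_uniq ?enum_uniq//.
  by rewrite -cardE; case: (enum_rank _).
rewrite enumT unlock /= /prod_enum index_allpairs ?mem_enum//.
by rewrite !index_enum_ord size_enum_ord.
Qed.

Lemma mxvec_index_eq m n (i i' : 'I_m) (j j' : 'I_n) :
  (mxvec_index i j == mxvec_index i' j') = (i == i') && (j == j').
Proof.
by rewrite /mxvec_index (inj_eq (@cast_ord_inj _ _ _)) (inj_eq enum_rank_inj).
Qed.

(** * Independent and correlated Gaussian self-adjoint matrices *)

Section GaussMatrix.
Import -(notations) mpoly.
Variables (R : realType) (N d : nat) (L : 'I_N -> 'I_N -> R).
Local Notation n := (N * (d * d))%N.
Local Notation A := (mpoly n R[i]).
Local Notation idx k i j := (mxvec_index k (mxvec_index i j)).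
Local Notation X k i j := (mpolyX R[i] (mnm1 (idx k i j)) : A).
Local Notation rt2 := ((Num.sqrt 2)^-1 : R).

Definition imag : R[i] := 0 +i* 1.

(* The (i, j) entry of the self-adjoint matrix with coordinates x is
   [sa_coef1 i j * x i j + sa_coef2 i j * x j i]. *)
Definition sa_coef1 (i j : 'I_d) : R[i] :=
  if i == j then 1 else if (i < j)%N then rt2%:C else - (rt2%:C * imag).
Definition sa_coef2 (i j : 'I_d) : R[i] :=
  if i == j then 0 else if (i < j)%N then rt2%:C * imag else rt2%:C.
Local Notation al := sa_coef1.
Local Notation be := sa_coef2.

Lemma sa_of_coordsE (x : 'I_d -> 'I_d -> R) i j :
  sa_of_coords x i j = al i j * (x i j)%:C + be i j * (x j i)%:C.
Proof.
rewrite mxE /sa_coef1 /sa_coef2 /imag.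
have [->|ij] := eqVneq i j; first by rewrite mul1r mul0r addr0.
case: ifP => _; simpc; congr (_ +i* _); ring.
Qed.

Let imag2 : imag * imag = -1.
Proof. by rewrite /imag; simpc. Qed.

Let rt2K : rt2%:C * rt2%:C * 2%:R = 1.
Proof.
rewrite -(rmorph_nat (real_complex R)) -2!(rmorphM (real_complex R)).
by rewrite -invfM -expr2 sqr_sqrtr// mulVf// pnatr_eq0.
Qed.

Let coef11 p q : p != q -> al p q * al p q + be p q * be p q = 0.
Proof.
move=> pq; rewrite /sa_coef1 /sa_coef2 (negbTE pq).
case: ifP => _.
  by transitivity (rt2%:C * rt2%:C * (1 + imag * imag)); [ring|rewrite imag2; ring].
by transitivity (rt2%:C * rt2%:C * (1 + imag * imag)); [ring|rewrite imag2; ring].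
Qed.

Let coef12 p q : p != q -> al p q * be q p + be p q * al q p = 1.
Proof.
move=> pq; rewrite /sa_coef1 /sa_coef2 [q == p]eq_sym (negbTE pq).
have [h|h|h] := ltngtP p q; last by rewrite (val_inj h) eqxx in pq.
- by transitivity (rt2%:C * rt2%:C * (1 - imag * imag)); [ring|rewrite imag2 opprK; exact: rt2K].
- by transitivity (rt2%:C * rt2%:C * (1 - imag * imag)); [ring|rewrite imag2 opprK; exact: rt2K].
Qed.

Definition gmx (k : 'I_N) : 'M[A]_d :=
  \matrix_(i, j) (al i j *: X k i j + be i j *: X k j i).

Definition gmx_derive (k : 'I_N) (i j : 'I_d) (f : A) : A :=
  al i j *: mderiv (idx k i j) f + be i j *: mderiv (idx k j i) f.

Definition corr_mx (k : 'I_N) : 'M[A]_d :=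
  \matrix_(i, j) \sum_l (L k l)%:C *: gmx l i j.

Definition corr_derive k i j f : A := \sum_l (L k l)%:C *: gmx_derive l i j f.

Let derX k i j k' i' j' :
  mderiv (idx k i j) (X k' i' j') = ((k == k') && (i == i') && (j == j'))%:R.
Proof.
rewrite mderivX mnm1E !mxvec_index_eq (eq_sym k') (eq_sym i') (eq_sym j') andbA.
case e: ((k == k') && (i == i') && (j == j')); last by rewrite scale0r.
move: e => /andP[/andP[/eqP<- /eqP<-] /eqP<-].
have -> : mnm_sub (mnm1 (idx k i j)) (mnm1 (idx k i j)) = (mnm0 : multinom n).
  by apply/mnmP => x; rewrite mnmBE mnm0E subnn.
by rewrite mpolyX0 scale1r.
Qed.

(** GUE covariance: an off-diagonal entry pairs to 0 with itself ([coef11]) and to 1 with its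
    transpose ([coef12]). The derivation [gmx_derive k p q] combines partial derivatives with the
    coefficients of the entry [(p, q)], as integration by parts dictates. *)
Lemma gmx_derive_gmx k p q j r s :
  gmx_derive k p q (gmx j r s) = ((k == j) && (r == q) && (p == s))%:R.
Proof.
rewrite /gmx_derive mxE !mderivD !mderivZ !derX.
have [_|_] /= := eqVneq k j; last by rewrite !scaler0 !addr0 !scaler0 addr0.
have [->|pq] := eqVneq p q.
  rewrite /sa_coef1 /sa_coef2 !eqxx !scale1r !scale0r addr0 ![_ == q]eq_sym andbC.
  have [<-|qr] /= := eqVneq q r; last by rewrite !andbF !scaler0 addr0.
  by have [_|_] /= := eqVneq q s; rewrite ?eqxx ?scale1r ?scale0r ?addr0 ?scaler0 ?addr0.
rewrite !scalerDr !scalerA.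
have [pr|pr] /= := eqVneq p r.
  subst r; rewrite (negbTE pq) /=.
  have [qs|qs] /= := eqVneq q s.
    subst s; rewrite (negbTE pq) [q == p]eq_sym (negbTE pq) /= !scaler0 addr0 add0r -scalerDl coef11// scale0r.
    by [].
  by rewrite [q == p]eq_sym (negbTE pq) /= ?andbF !scaler0 !addr0.
have [ps|ps] /= := eqVneq p s; last by rewrite !andbF !scaler0 !addr0.
subst s; rewrite !andbT [r == q]eq_sym.
rewrite [q == p]eq_sym (negbTE pq) /= !scaler0 add0r addr0.
have [<-|qr] /= := eqVneq q r; last by rewrite !scaler0 !addr0.
by rewrite -scalerDl coef12// scale1r.
Qed.

Variable sig : R.
Hypothesis sigE : sig ^+ 2 = d%:R^-1.
Let E := gauss_E sig : A -> R[i].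
Local Notation C k j := (\sum_l L k l * L j l).

Lemma gmx_deriveD k p q x y :
  gmx_derive k p q (x + y) = gmx_derive k p q x + gmx_derive k p q y.
Proof.
rewrite /gmx_derive (mderivD (idx k p q) x y) (mderivD (idx k q p) x y).
by rewrite [al p q *: _]scalerDr [be p q *: _]scalerDr addrACA.
Qed.

Lemma gmx_deriveZ k p q a x : gmx_derive k p q (a *: x) = a *: gmx_derive k p q x.
Proof.
rewrite /gmx_derive (mderivZ (idx k p q) a x) (mderivZ (idx k q p) a x).
by rewrite [RHS]scalerDr !scalerA (mulrC a) (mulrC a).
Qed.

Lemma corr_deriveD k p q : {morph corr_derive k p q : x y / x + y}.
Proof.
move=> x y; rewrite /corr_derive -big_split /=; apply: eq_bigr => l _.
by rewrite gmx_deriveD scalerDr.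
Qed.

Lemma corr_deriveM k p q x y :
  corr_derive k p q (x * y) = corr_derive k p q x * y + x * corr_derive k p q y.
Proof.
rewrite /corr_derive mulr_suml mulr_sumr -big_split /=; apply: eq_bigr => l _.
rewrite -scalerAl -scalerAr -scalerDr; congr (_ *: _).
rewrite /gmx_derive (mderivM (idx l p q) x y) (mderivM (idx l q p) x y).
rewrite [al p q *: _]scalerDr [be p q *: _]scalerDr mulrDl mulrDr.
by rewrite -2![in RHS]scalerAl -2![in RHS]scalerAr addrACA.
Qed.

Lemma corr_derive1 k p q : corr_derive k p q 1 = 0.
Proof.
rewrite /corr_derive big1// => l _.
by rewrite /gmx_derive -mpolyC1 !mderivC !scaler0 addr0 scaler0.
Qed.

Lemma corr_derive_mx k p q j r s : corr_derive k p q (corr_mx j r s) =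
  (C k j)%:C *: ((r == q)%:R * (p == s)%:R).
Proof.
have corrZ a f : corr_derive k p q (a *: f) = a *: corr_derive k p q f.
  rewrite /corr_derive scaler_sumr; apply: eq_bigr => l _.
  by rewrite gmx_deriveZ !scalerA mulrC.
have corr0 : corr_derive k p q 0 = 0 by have := corrZ 0 0; rewrite !scale0r.
rewrite mxE (big_morph _ (@corr_deriveD k p q) corr0).
rewrite (rmorph_sum (real_complex R)) /= scaler_suml.
apply: eq_bigr => l _; rewrite corrZ /corr_derive (bigD1 l)//= big1 => [|l' ll'].
  by rewrite addr0 gmx_derive_gmx eqxx /= scalerA -(rmorphM (real_complex R)) /= mulrC -natrM mulnb.
by rewrite gmx_derive_gmx (negbTE ll') /= scaler0.
Qed.

Lemma corr_by_parts k p q f :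
  E (corr_mx k p q * f) = d%:R^-1 * E (corr_derive k p q f).
Proof.
rewrite mxE mulr_suml /E !linear_sum mulr_sumr; apply: eq_bigr => l _.
rewrite -scalerAl !linearZ /= mulrCA; congr (_ * _).
rewrite mxE /gmx_derive mulrDl -!scalerAl !linearD /= mulrDr.
have dE : (d%:R^-1 : R[i]) = (sig ^+ 2)%:C by rewrite sigE (fmorphV (real_complex R)) rmorph_nat.
by congr (_ + _); rewrite !linearZ /= gauss_E_by_parts mulrCA dE.
Qed.

Definition corr_moment (W : seq (seq 'I_N)) : R :=
  trace_moment (gauss_E sig : {linear A -> R[i] | *%R}) corr_mx W.

Lemma gauss_E_1 : gauss_E sig (1 : A) = 1.
Proof. exact: gauss_E1. Qed.

Lemma corr_moment0 : corr_moment [::] = 1.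
Proof. exact/trace_moment0/gauss_E_1. Qed.

Lemma corr_moment_nil W : (0 < d)%N -> corr_moment ([::] :: W) = corr_moment W.
Proof. by move=> d0; apply: trace_moment_nil. Qed.

Lemma corr_moment_loop k w W : (0 < d)%N -> corr_moment ((k :: w) :: W) =
    spl (fun u j v => C k j * corr_moment (u :: v :: W)) w +
    d%:R ^- 2 *
      pick1 (fun v W' => spl (fun a j b => C k j * corr_moment ((w ++ b ++ a) :: W')) v) W.
Proof.
move=> d0.
exact: (@trace_moment_loop R 'I_N (fun k j => C k j) d A
  (gauss_E sig : {linear A -> R[i] | *%R}) corr_mx corr_derive corr_deriveD
  corr_deriveM corr_derive1 corr_derive_mx corr_by_parts d0).
Qed.

Lemma meval_corr_mx (g : n.-tuple R) k :
  map_mx (meval (fun i => (tnth g i)%:C)) (corr_mx k) =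
  sa_of_coords (fun i j => \sum_l L k l * tnth g (idx l i j)).
Proof.
apply/matrixP => i j; rewrite sa_of_coordsE mxE mxE linear_sum.
rewrite !(rmorph_sum (real_complex R)) !mulr_sumr -big_split /=.
apply: eq_bigr => l _; rewrite mevalZ mxE mevalD !mevalZ !mevalXU.
by rewrite !(rmorphM (real_complex R)) /=; ring.
Qed.

End GaussMatrix.

(** * The Cholesky mixing as a triangular substitution *)

Section Triangular.
Variables (R : realType) (N d : nat) (L : nat -> nat -> R).
Local Notation D := (d * d)%N.
Local Notation n := (N * D)%N.

(** Coordinate [i] is entry [i %% D] of the matrix number [i %/ D]; [low_coef] collects the matrices
    of smaller index, whose entries precede [i] in the tuple. *)
Definition diag_coef (i : nat) : R := L (i %/ D) (i %/ D).
Definition low_coef (i : nat) (s : seq R) : R :=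
  \sum_(l < i %/ D) L (i %/ D) l * nth 0 s (l * D + i %% D).

Lemma nth_triangular c h (g : seq R) i : (i < size g)%N ->
  nth 0 (triangular c h g) i = c i * nth 0 g i + h i (take i g).
Proof.
elim: g c h i => //= y g ih c h [|i] //= hi.
by rewrite ih.
Qed.

Lemma triangular_corr (g t : n.-tuple R) (k : 'I_N) (i j : 'I_d) :
  (forall k l : nat, (k < l)%N -> L k l = 0) ->
  t = triangular diag_coef low_coef g :> seq R ->
  tnth t (mxvec_index k (mxvec_index i j)) =
  \sum_(l < N) L k l * tnth g (mxvec_index l (mxvec_index i j)).
Proof.
move=> Llow tE; set a := mxvec_index i j.
have aD : (a < D)%N := ltn_ord a.
have D0 : (0 < D)%N by apply: leq_trans aD.
have q l : ((l * D + a) %/ D)%N = l by rewrite divnMDl// divn_small// addn0.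
have r l : ((l * D + a) %% D)%N = a by rewrite modnMDl modn_small.
rewrite (tnth_nth 0) tE nth_triangular; last by rewrite size_tuple.
rewrite val_mxvec_index /diag_coef /low_coef q r addrC.
rewrite (eq_bigr (fun l : 'I_N => L k l * nth 0 g (l * D + a))); last first.
  by move=> l _; rewrite (tnth_nth 0) val_mxvec_index.
rewrite -(big_mkord xpredT (fun l => L k l * nth 0 g (l * D + a))).
rewrite (big_cat_nat _ (n := k.+1))//= [X in _ = _ + X]big_nat_cond [X in _ = _ + X]big1; last first.
  by move=> l /andP[/andP[kl _] _]; rewrite Llow// mul0r.
rewrite addr0 big_nat_recr//= big_mkord; congr (_ + _).
apply: eq_bigr => l _; congr (_ * _); rewrite nth_take//.
by rewrite ltn_add2r ltn_pmul2r.
Qed.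

Lemma lebesgue_sa_ge (sig : R) (F : mpoly.mpoly n R[i])
    (G : set ('I_N -> 'M[R[i]]_d)) :
  sig != 0 -> (forall k l : nat, (k < l)%N -> L k l = 0) -> (forall k, L k k != 0) ->
  (forall g : n.-tuple R, let ev := mpoly.meval (fun i => (tnth g i)%:C) in
     complex.Re (ev F) <= 1 /\
     (0 < complex.Re (ev F) -> G (fun k => map_mx ev (corr_mx d (fun k l : 'I_N => L k l) k)))) ->
  ((complex.Re (gauss_E sig F) *
     \prod_(i < n) (normal_peak (diag_coef i * sig))^-1)%:E <= lebesgue_sa G)%E.
Proof.
move=> s0 Llow Ldiag hF; rewrite -mono_gauss_monomials.
apply: (lebesgue_tuple_ge (h := low_coef)) => //; first by move=> i; exact: Ldiag.
move=> g t tE; rewrite mono_val_monomials; have [h1 h2] := hF g; split=> // /h2.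
rewrite /preimage /=; congr (G _); apply/funext => k; rewrite meval_corr_mx.
rewrite /sa_family_of_coords; congr sa_of_coords.
by apply/funext => i; apply/funext => j; rewrite (triangular_corr _ _ _ Llow tE).
Qed.

End Triangular.

(** * Volume of the set of microstates *)

Section OperatorNorm.
Variable R : realType.
Implicit Types d : nat.

(** Lagrange's identity: twice the difference of the two sides is the double sum of
    [(a_i b_j - a_j b_i)^2]. *)
Lemma sqr_sum_le_mul (I : finType) (a b : I -> R) :
  (\sum_i a i * b i) ^+ 2 <= (\sum_i a i ^+ 2) * (\sum_i b i ^+ 2).
Proof.
have : 0 <= \sum_i \sum_j (a i * b j - a j * b i) ^+ 2.
  by apply: sumr_ge0 => i _; apply: sumr_ge0 => j _; exact: sqr_ge0.
have -> : \sum_i \sum_j (a i * b j - a j * b i) ^+ 2 =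
    ((\sum_i a i ^+ 2) * (\sum_i b i ^+ 2) - (\sum_i a i * b i) ^+ 2) *+ 2.
  transitivity (\sum_i \sum_j (a i ^+ 2 * b j ^+ 2) +
     \sum_i \sum_j (b i ^+ 2 * a j ^+ 2) - (\sum_i \sum_j (a i * b i) * (a j * b j)) *+ 2).
    rewrite -sumrMnl -big_split /= -sumrB; apply: eq_bigr => i _.
    rewrite -sumrMnl -big_split /= -sumrB; apply: eq_bigr => j _; ring.
  have prd (x y : I -> R) : \sum_i \sum_j x i * y j = (\sum_i x i) * (\sum_j y j).
    by rewrite mulr_suml; apply: eq_bigr => i _; rewrite mulr_sumr.
  by rewrite !prd expr2; ring.
by rewrite pmulrn_lge0// subr_ge0.
Qed.

Definition mxadj d (B : 'M[R[i]]_d) : 'M[R[i]]_d := map_mx (@conjc R) B^T.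

Definition sqnorm d (v : 'cV[R[i]]_d) : R := \sum_i normc (v i 0) ^+ 2.

Definition frob d (B : 'M[R[i]]_d) : R := \sum_i \sum_j normc (B i j) ^+ 2.

Lemma normc_ge0 (x : R[i]) : 0 <= normc x.
Proof. by case: x => a b; exact: sqrtr_ge0. Qed.

Lemma normc_sqr (x : R[i]) : (normc x ^+ 2)%:C = x * x^*.
Proof.
case: x => a b; rewrite /ComplexField.Normc.normc sqr_sqrtr ?addr_ge0 ?sqr_ge0//.
by simpc; congr (_ +i* _); ring.
Qed.

Lemma normc_leD (x y : R[i]) : normc (x + y) <= normc x + normc y.
Proof. by have := ler_normD x y; rewrite -lecR rmorphD. Qed.

Lemma normc_real (a : R) : 0 <= a -> normc a%:C = a.
Proof. by move=> a0 /=; rewrite expr0n addr0 sqrtr_sqr ger0_norm. Qed.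

Lemma normc_conj (x : R[i]) : normc x^* = normc x.
Proof. by case: x => a b /=; rewrite sqrrN. Qed.

Lemma normc_sum (I : Type) (s : seq I) (P : pred I) (f : I -> R[i]) :
  normc (\sum_(i <- s | P i) f i) <= \sum_(i <- s | P i) normc (f i).
Proof.
elim/big_rec2: _ => [|i x y _ h]; first by rewrite ComplexField.Normc.normc0.
by apply: (le_trans (normc_leD _ _)); rewrite lerD2l.
Qed.

Lemma sqnorm_ge0 d (v : 'cV[R[i]]_d) : 0 <= sqnorm v.
Proof. by apply: sumr_ge0 => i _; rewrite exprn_ge0// normc_ge0. Qed.

Lemma sqnorm_mulmx_frob d (B : 'M[R[i]]_d) v :
  sqnorm (B *m v) <= frob B * sqnorm v.
Proof.
rewrite /frob mulr_suml; apply: ler_sum => i _; rewrite mxE.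
apply: le_trans (sqr_sum_le_mul _ _).
rewrite lerXn2r ?nnegrE ?normc_ge0//; last first.
  by apply: (le_trans (normc_sum _ _ _)); apply: ler_sum => j _; rewrite ComplexField.Normc.normcM.
by apply: sumr_ge0 => j _; rewrite mulr_ge0// normc_ge0.
Qed.

Lemma mxadjM d (B1 B2 : 'M[R[i]]_d) : mxadj (B1 * B2) = mxadj B2 * mxadj B1.
Proof. by rewrite /mxadj trmx_mul map_mxM. Qed.

Lemma mxadj1 d : mxadj (1 : 'M[R[i]]_d) = 1.
Proof. by rewrite /mxadj trmx1 map_mx1. Qed.

Lemma frob_self_adjoint d (B : 'M[R[i]]_d) : mxadj B = B ->
  frob B = complex.Re (\tr (B * B)).
Proof.
move=> hB; suff -> : \tr (B * B) = (frob B)%:C by [].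
rewrite /frob (rmorph_sum (real_complex R)); apply: eq_bigr => i _.
rewrite mxE (rmorph_sum (real_complex R)); apply: eq_bigr => j _.
by rewrite /= normc_sqr -{2}hB !mxE.
Qed.

(** Cauchy-Schwarz applied to [|Bv|^2 = <B(Bv), v>]. *)
Lemma sqnorm_self_adjoint d (B : 'M[R[i]]_d) v : mxadj B = B ->
  sqnorm (B *m v) ^+ 2 <= sqnorm (B *m (B *m v)) * sqnorm v.
Proof.
move=> hB; set w := B *m v.
have e : (sqnorm w)%:C = \sum_i (B *m w) i 0 * (v i 0)^*.
  rewrite /sqnorm (rmorph_sum (real_complex R)).
  under eq_bigr do rewrite /= normc_sqr.
  rewrite [X in _ = X](eq_bigr (fun i => \sum_j (w j 0 * ((B j i) * (v i 0))^*))); last first.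
    move=> i _; rewrite mxE mulr_suml; apply: eq_bigr => j _.
    rewrite -{1}hB !mxE rmorphM /=; ring.
  rewrite exchange_big /=; apply: eq_bigr => j _; rewrite -mulr_sumr; congr (_ * _).
  by rewrite {1}/w mxE rmorph_sum.
have : sqnorm w <= \sum_i normc ((B *m w) i 0) * normc (v i 0).
  have := normc_sum (index_enum _) xpredT (fun i => (B *m w) i 0 * (v i 0)^*).
  rewrite -e; under eq_bigr do rewrite ComplexField.Normc.normcM normc_conj.
  by rewrite normc_real// sqnorm_ge0.
move=> h; apply: (le_trans _ (sqr_sum_le_mul _ _)).
by rewrite lerXn2r ?nnegrE//; [|apply: (le_trans _ h)]; apply: sumr_ge0 => i _; rewrite exprn_ge0// normc_ge0.
Qed.

Lemma mxadjX d (B : 'M[R[i]]_d) k : mxadj B = B -> mxadj (B ^+ k) = B ^+ k.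
Proof.
by move=> hB; elim: k => [|k ih]; rewrite ?expr0 ?mxadj1// [in LHS]exprS mxadjM ih hB [in RHS]exprSr.
Qed.

Lemma sqnorm_pow d (B : 'M[R[i]]_d) v j : mxadj B = B -> sqnorm v <= 1 ->
  sqnorm (B *m v) ^+ (2 ^ j) <= sqnorm ((B ^+ (2 ^ j)) *m v).
Proof.
move=> hB v1; elim: j => [|j ih]; first by rewrite expr1 lexx.
rewrite expnSr exprM; apply: (@le_trans _ _ (sqnorm ((B ^+ (2 ^ j)) *m v) ^+ 2)).
  by rewrite lerXn2r ?nnegrE// ?exprn_ge0// sqnorm_ge0.
apply: (le_trans (sqnorm_self_adjoint _ (mxadjX _ hB))).
have -> : B ^+ (2 ^ j * 2) = B ^+ (2 ^ j) *m B ^+ (2 ^ j).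
  by rewrite muln2 -addnn exprD.
by rewrite mulmxA ler_piMr// sqnorm_ge0.
Qed.

(** By repeated doubling of the exponent, [|Bv|^(2^(j+1))] is at most [|B^(2^j) v|^2], hence at most
    the squared Frobenius norm of [B^(2^j)], which is the trace of [B^(2^(j+1))]. This takes the
    place of a diagonalization. *)
Lemma opnorm_le_trace d (B : 'M[R[i]]_d) (r : R) j : mxadj B = B -> 0 <= r ->
  complex.Re (\tr (B ^+ (2 ^ j.+1))) <= r ^+ (2 ^ j.+1) -> opnorm B <= r.
Proof.
move=> hB r0 h; apply: ge_sup.
  exists (l2norm (B *m 0)), 0 => //=.
  rewrite /l2norm big1 ?sqrtr0// => i _.
  by rewrite mxE ComplexField.Normc.normc0 expr0n.
move=> _ [v /= v1 <-].
have {}v1 : sqnorm v <= 1.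
  by move: v1; rewrite /l2norm -{1}[1]sqrtr1 ler_sqrt.
have : sqnorm (B *m v) ^+ (2 ^ j) <= r ^+ (2 ^ j.+1).
  apply: (le_trans (sqnorm_pow j hB v1)); apply: (le_trans (sqnorm_mulmx_frob _ _)).
  rewrite frob_self_adjoint ?mxadjX// -expr2 -exprM -expnSr.
  apply: le_trans h; rewrite ler_piMr//.
  rewrite expnSr exprM expr2 -frob_self_adjoint ?mxadjX//.
  by apply: sumr_ge0 => i _; apply: sumr_ge0 => k _; rewrite exprn_ge0// normc_ge0.
rewrite expnS exprM ler_pXn2r ?nnegrE ?sqnorm_ge0 ?exprn_ge0 ?expn_gt0// => hv.
by rewrite /l2norm -(ger0_norm r0) -sqrtr_sqr ler_sqrt ?sqr_ge0.
Qed.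

End OperatorNorm.

Section WordEvaluation.
Variables (R : realType) (d : nat) (I : eqType).
Variables (A : comAlgType R[i]) (ev : {rmorphism A -> R[i]}) (B : I -> 'M[A]_d).
Hypothesis evZ : forall a x, ev (a *: x) = a * ev x.
Let b k := map_mx ev (B k).
Hypothesis b_adj : forall k, mxadj (b k) = b k.

Lemma map_wordmx w : map_mx ev (wordmx B w) = \prod_(k <- w) b k.
Proof.
elim: w => [|k w ih] /=; first by rewrite big_nil map_mx1.
by rewrite big_cons map_mxM ih.
Qed.

Lemma ev_tr_wordmx w : ev (\tr (wordmx B w)) = \tr (\prod_(k <- w) b k).
Proof. by rewrite -map_wordmx trace_map_mx. Qed.

Lemma mxadj_prod w : mxadj (\prod_(k <- w) b k) = \prod_(k <- rev w) b k.
Proof.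
elim: w => [|k w ih]; first by rewrite !big_nil mxadj1.
by rewrite big_cons mxadjM ih b_adj rev_cons -cats1 big_cat big_seq1.
Qed.

Lemma tr_mxadj (M : 'M[R[i]]_d) : \tr (mxadj M) = (\tr M)^*.
Proof. by rewrite /mxadj trace_map_mx mxtrace_tr. Qed.

Lemma ntrace_rev w : ntrace (\prod_(k <- rev w) b k) = (ntrace (\prod_(k <- w) b k))^*.
Proof.
rewrite /ntrace -mxadj_prod tr_mxadj rmorphM; congr (_ * _).
by rewrite /= conjc_inv conjc_nat.
Qed.

End WordEvaluation.

Lemma mxadj_sa_of_coords (R : realType) d (x : 'I_d -> 'I_d -> R) :
  mxadj (sa_of_coords x) = sa_of_coords x.
Proof.
apply/matrixP => i j; rewrite !mxE [j == i]eq_sym.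
have [->|ij] := eqVneq i j; first by rewrite conjc_real.
have [h|h|h] := ltngtP i j; last by rewrite (val_inj h) eqxx in ij.
- by rewrite /= opprK.
- by simpc.
Qed.

(** * Lower bound on the volume of microstates *)

Section LowerBound.
Import -(notations) mpoly.
Variables (R : realType) (n m : nat).
Local Notation N := (n + m)%N.
Variables (L : nat -> nat -> R) (mo : seq 'I_N -> R).
Local Notation C k j := (\sum_(l < N) L k l * L j l).
Hypothesis Llow : forall k l : nat, (k < l)%N -> L k l = 0.
Hypothesis Ldiag : forall k, L k k != 0.
Hypothesis C2 : forall k j : 'I_N, `|C k j| <= 2.
Hypothesis mo0 : mo [::] = 1.
Hypothesis mo_loop : forall k w, mo (k :: w) = spl (fun (u : seq 'I_N) (j : 'I_N) v => C k j * mo u * mo v) w.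
Variables (A : cstarAlgebra R) (phi : {scalar A}) (Z : 'I_N -> A).
Hypothesis phiZ : forall (s : seq 'I_n) (t : seq 'I_m),
  phi ((\prod_(i <- s) Z (lshift m i)) * (\prod_(j <- t) Z (rshift n j))) =
  (mo (map (@lshift n m) s ++ map (@rshift n m) (rev t)))%:C.

(** Left variables followed by reversed right variables form an ordinary word in the matrices, so
    control of all words of length at most [M] covers the two-faced conditions. *)
Lemma microstates_sufficient M d (eps r : R) (B : 'I_N -> 'M[R[i]]_d) :
  (forall k, mxadj (B k) = B k) -> (forall k, opnorm (B k) <= r) ->
  (forall w, (size w <= M)%N ->
    normc (ntrace (\prod_(k <- w) B k) - (mo w)%:C) < eps) ->
  microstates phi Z r M eps B.
Proof.
move=> Badj Bnorm Bmo; split=> // s t /andP[_ st].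
rewrite phiZ distrC.
have -> : \prod_(i <- s) B (lshift m i) * \prod_(j <- rev t) B (rshift n j) =
   \prod_(k <- map (@lshift n m) s ++ map (@rshift n m) (rev t)) B k.
  by rewrite big_cat !big_map.
have := Bmo (map (@lshift n m) s ++ map (@rshift n m) (rev t)).
rewrite size_cat !size_map size_rev => /(_ st).
by case: (_ - _) => a b /= h; rewrite normc_def ltcR.
Qed.

Section Dimension.
Variables (M d J : nat) (eps r : R).
Local Notation D := (N * (d * d))%N.
Local Notation AA := (mpoly D R[i]).
Local Notation B := (corr_mx d (fun k l : 'I_N => L k l)).
Local Notation tau w := (d%:R^-1 *: \tr (wordmx B w) : AA).

Definition words_upto : seq (seq 'I_N) :=
  flatten [seq [seq tval t | t <- enum {: l.-tuple 'I_N}] | l <- iota 0 M.+1].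

Lemma mem_words_upto w : (size w <= M)%N -> w \in words_upto.
Proof.
move=> wM; apply/flattenP; exists [seq tval t | t <- enum {: (size w).-tuple 'I_N}].
  by apply/mapP; exists (size w) => //; rewrite mem_iota.
by apply/mapP; exists (in_tuple w) => //; rewrite mem_enum.
Qed.

(** Chebyshev minorant of the indicator: the subtracted terms are non-negative, and positivity of
    the whole forces each of them below 1. For self-adjoint matrices the trace of [rev w] is the
    conjugate of that of [w], so the products are squared moduli. The last traces are not normalized
    because they have to bound operator norms. *)
Definition test_poly : AA :=
  1 - \sum_(w <- words_upto)
        (eps ^- 2)%:C *: ((tau w - (mo w)%:C%:A) * (tau (rev w) - (mo w)%:C%:A))
    - \sum_(k < N) (r ^- (2 ^ J.+1))%:C *: \tr (wordmx B (nseq (2 ^ J.+1) k)).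

Hypothesis eps0 : 0 < eps.
Hypothesis r0 : 0 < r.

Lemma test_poly_microstates (g : D.-tuple R) :
  let ev := meval (fun i => (tnth g i)%:C) : AA -> R[i] in
  complex.Re (ev test_poly) <= 1 /\
  (0 < complex.Re (ev test_poly) ->
    microstates phi Z r M eps (fun k => map_mx ev (B k))).
Proof.
move=> ev.
pose evr : {rmorphism AA -> R[i]} := ev.
have evZ a x : evr (a *: x) = a * evr x by exact: mevalZ.
set b := fun k => map_mx evr (B k).
have badj k : mxadj (b k) = b k by rewrite /b [map_mx _ _]meval_corr_mx mxadj_sa_of_coords.
have ReD : {morph (@complex.Re R) : x y / x + y} by move=> [? ?] [? ?].
have ReN : {morph (@complex.Re R) : x / - x} by move=> [? ?].
pose X w : R := eps ^- 2 * normc (ntrace (\prod_(k <- w) b k) - (mo w)%:C) ^+ 2.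
pose Y k : R := r ^- (2 ^ J.+1) * complex.Re (\tr (b k ^+ (2 ^ J.+1))).
have X0 w : 0 <= X w by rewrite mulr_ge0 ?invr_ge0 ?sqr_ge0.
have Y0 k : 0 <= Y k.
  rewrite mulr_ge0 ?invr_ge0 ?exprn_ge0 ?(ltW r0)// expnSr exprM expr2.
  rewrite -frob_self_adjoint ?mxadjX//.
  by apply: sumr_ge0 => i _; apply: sumr_ge0 => j _; rewrite exprn_ge0// normc_ge0.
have evE : complex.Re (ev test_poly) = 1 - \sum_(w <- words_upto) X w - \sum_k Y k.
  rewrite -[ev _]/(evr _) /test_poly !rmorphB rmorph1 !rmorph_sum !ReD !ReN; congr (_ - _ - _).
    rewrite (big_morph _ ReD erefl); apply: eq_bigr => w _.
    rewrite evZ rmorphM !rmorphB !evZ rmorph1 !mulr1 !ev_tr_wordmx -/b.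
    rewrite -2![d%:R^-1 * \tr _]/(ntrace _) ntrace_rev//.
    set z := ntrace _ - _.
    have -> : (ntrace (\prod_(k <- w) b k))^* - (mo w)%:C = z^*.
      by rewrite /z rmorphB /= oppr0.
    by rewrite -normc_sqr -(rmorphM (real_complex R)).
  rewrite (big_morph _ ReD erefl); apply: eq_bigr => k _.
  rewrite evZ; have -> : evr (\tr (wordmx B (nseq (2 ^ J.+1) k))) = \tr (b k ^+ (2 ^ J.+1)).
    rewrite ev_tr_wordmx -/b; congr (\tr _).
    by elim: (2 ^ J.+1)%N => [|a ih]; rewrite ?big_nil ?expr0//= big_cons ih exprS.
  by rewrite /Y; case: (\tr _) => x y /=; rewrite mul0r subr0.
have sX0 : 0 <= \sum_(w <- words_upto) X w by apply: sumr_ge0.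
have sY0 : 0 <= \sum_k Y k by apply: sumr_ge0.
split; first by rewrite evE; lra.
rewrite evE => h; apply: microstates_sufficient => //.
- move=> k; apply: (@opnorm_le_trace _ _ _ _ J) => //; first exact: ltW.
  have : Y k <= 1.
    have : Y k <= \sum_k Y k by rewrite (bigD1 k)//= lerDl sumr_ge0.
    by lra.
  by rewrite /Y ler_pdivrMl ?exprn_gt0// mulr1.
- move=> w wM; have : X w < 1.
    have : X w <= \sum_(w <- words_upto) X w.
      rewrite (big_rem w) ?mem_words_upto//= lerDl.
      by apply: sumr_ge0.
    by lra.
  rewrite /X ltr_pdivrMl ?exprn_gt0// mulr1 ltr_pXn2r ?nnegrE ?normc_ge0//.
  exact: ltW.
Qed.

Variable sig : R.
Hypothesis sigE : sig ^+ 2 = d%:R^-1.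
Hypothesis d0 : (0 < d)%N.
Local Notation T := (@corr_moment R N d (fun k l : 'I_N => L k l) sig).

Lemma gauss_E_test_poly : complex.Re (gauss_E sig test_poly) =
  1 - \sum_(w <- words_upto) eps ^- 2 *
        (T [:: w; rev w] - mo w * T [:: w] - mo w * T [:: rev w] + mo w ^+ 2)
    - \sum_(k < N) r ^- (2 ^ J.+1) * (d%:R * T [:: nseq (2 ^ J.+1) k]).
Proof.
have ReD : {morph (@complex.Re R) : x y / x + y} by move=> [? ?] [? ?].
pose ER (x : AA) := complex.Re (gauss_E sig x).
have ERD : {morph ER : x y / x + y} by move=> x y; rewrite /ER linearD ReD.
have ERZ a (x : AA) : ER (a%:C *: x) = a * ER x.
  by rewrite /ER linearZ /=; case: (gauss_E _ x) => u v /=; rewrite mul0r subr0.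
have ERN (x : AA) : ER (- x) = - ER x.
  by rewrite -scaleN1r -[-1 : R[i]](rmorphN1 (real_complex R)) ERZ mulN1r.
have ER0 : ER 0 = 0 by rewrite -[X in ER X](scale0r (1 : AA)) -(rmorph0 (real_complex R)) ERZ mul0r.
have ER1 : ER 1 = 1 by rewrite /ER gauss_E1.
rewrite -[LHS]/(ER _) /test_poly !ERD !ERN !(big_morph ER ERD ER0) ER1.
congr (_ - _ - _).
  apply: eq_bigr => w _; rewrite ERZ; congr (_ * _).
  rewrite /corr_moment /trace_moment !big_cons !big_nil !mulr1 /= -!/(ER _).
  move: (tau w) (tau (rev w)) => x y.
  have -> : (x - (mo w)%:C%:A) * (y - (mo w)%:C%:A) =
      x * y + - ((mo w)%:C *: x) + - ((mo w)%:C *: y) + (mo w)%:C *: ((mo w)%:C *: 1).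
    by rewrite mulrBl !mulrBr mulr_algr !mulr_algl; ring.
  by rewrite !ERD !ERN !ERZ ER1; ring.
apply: eq_bigr => k _; rewrite ERZ; congr (_ * _).
rewrite /corr_moment /trace_moment big_seq1 -[complex.Re _]/(ER _).
have -> : (d%:R^-1 : R[i]) = (d%:R^-1 : R)%:C by rewrite (fmorphV (real_complex R)) rmorph_nat.
by rewrite ERZ mulrA mulfV ?mul1r// pnatr_eq0 -lt0n.
Qed.

End Dimension.

Local Notation B := (fun d => corr_mx d (fun k l : 'I_N => L k l)).
Local Notation T d := (@corr_moment R N d (fun k l : 'I_N => L k l) (Num.sqrt d%:R)^-1).

Let sigE d : ((Num.sqrt d%:R)^-1 : R) ^+ 2 = d%:R^-1.
Proof. by rewrite exprVn sqr_sqrtr. Qed.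

Lemma corr_moment_limit W : T d W @[d --> \oo] --> \prod_(w <- W) mo w.
Proof.
apply: (@loop_limit R 'I_N (fun k j => C k j) (fun d => T d) mo _ _ _ mo0 mo_loop W).
- move=> d d0; exact: corr_moment0.
- move=> d W' d0; exact: corr_moment_nil.
- move=> d k w W' d0; exact: corr_moment_loop.
Qed.

Lemma corr_moment_norm_bound d l (k : 'I_N) : (0 < d)%N -> (l.+1 ^ 5 <= d ^ 2)%N ->
  T d [:: nseq l k] <= 12 ^+ l.
Proof.
move=> d0 ld.
have := @loop_bound R 'I_N (fun k j => C k j) d l (T d) C2 _ _ _ ld [:: nseq l k].
rewrite !big_seq1 size_nseq => h; apply: (le_trans (ler_norm _)).
apply: (le_trans (h _ _ _ (leqnn l))).
- exact: corr_moment0.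
- by move=> W; exact: corr_moment_nil.
- by move=> k' w W; exact: corr_moment_loop.
- rewrite /loop_weight ler_pdivrMr ?exprn_gt0 ?ltr0n//.
  by rewrite ler_peMr ?exprn_ge0// exprn_ege1// ler1n.
Qed.

Lemma test_error_limit M (eps : R) :
  \sum_(w <- words_upto M) eps ^- 2 *
     (T d [:: w; rev w] - mo w * T d [:: w] - mo w * T d [:: rev w] + mo w ^+ 2)
  @[d --> \oo] --> (0 : R).
Proof.
pose f d w := eps ^- 2 *
     (T d [:: w; rev w] - mo w * T d [:: w] - mo w * T d [:: rev w] + mo w ^+ 2).
have cf w : f d w @[d --> \oo] --> (0 : R).
  rewrite -(mulr0 (eps ^- 2)); apply: cvgMr.
  (* The limits of the four terms cancel identically in [mo w] and [mo (rev w)]. *)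
  have -> : 0 = mo w * mo (rev w) - mo w * mo w - mo w * mo (rev w) + mo w ^+ 2 by ring.
  have := @corr_moment_limit [:: w; rev w]; rewrite !big_cons big_nil mulr1 => h1.
  have := @corr_moment_limit [:: w]; rewrite !big_cons big_nil mulr1 => h2.
  have := @corr_moment_limit [:: rev w]; rewrite !big_cons big_nil mulr1 => h3.
  apply: cvgD; last exact: cvg_cst.
  apply: cvgB; last exact: cvgMr.
  by apply: cvgB => //; exact: cvgMr.
elim: words_upto => [|w s ih].
  by under eq_cvg do rewrite big_nil; exact: cvg_cst.
rewrite (_ : (fun d => _) = (fun d => f d w + \sum_(w <- s) f d w)); last first.
  by apply/funext => d; rewrite big_cons.
by have h := cvgD (cf w) ih; rewrite addr0 in h; exact: h.
Qed.

(** For words of length [2^a] and [d = 8^a] the condition of [loop_bound] follows from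
    [5(a+1) <= 6a]; hence the powers of 8. *)
Let pow_bound a : (5 <= a)%N -> ((2 ^ a).+1 ^ 5 <= (8 ^ a) ^ 2)%N.
Proof.
move=> a5; apply: (@leq_trans ((2 ^ a.+1) ^ 5)).
  rewrite leq_exp2r// expnS mul2n -addnn -addn1 leq_add2l expn_gt0//.
rewrite -!expnM -[8%N]/(2 ^ 3)%N -expnM leq_exp2l//; lia.
Qed.

Let pow_bound2 K a : (5 <= a)%N -> (K + 2 <= a)%N -> (K * 4 * 8 ^ a <= 2 ^ (2 ^ a))%N.
Proof.
move=> a5 aN; have h4 : (4 * a <= 2 ^ a)%N.
  elim: a a5 {aN} => // a ih; rewrite leq_eqVlt => /orP[/eqP<-//|a5].
  by rewrite expnS; move: (ih a5); lia.
apply: (@leq_trans (2 ^ (K + 2 + 3 * a))); last by rewrite leq_exp2l//; lia.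
have -> : (2 ^ (K + 2 + 3 * a) = 2 ^ K * 4 * 8 ^ a)%N.
  by rewrite expnD expnD [(2 ^ (3 * a))%N]expnM.
by rewrite !leq_mul// ltnW// ltn_expl.
Qed.

(** The moment bound [12^l] against the radius 24 leaves [2^(-l)] with [l = 2^(j+1)], which beats
    [N d] for [d = 8^(j+1)]. Both error sums are eventually at most 1/4, so the mean of the test
    polynomial is at least 1/2. *)
Lemma microstates_volume_ge M (eps : R) : 0 < eps -> exists j0, forall j, (j0 <= j)%N ->
  let d := (8 ^ j.+1)%N in
  ((2^-1 * \prod_(i < N * (d * d))
     (normal_peak (diag_coef d L i * (Num.sqrt d%:R)^-1))^-1)%:E <=
   lebesgue_sa (microstates phi Z 24 M (d := d) eps))%E.
Proof.
move=> eps0; have /cvgrPdist_le /(_ 4^-1) := test_error_limit M eps.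
rewrite invr_gt0 ltr0n => /(_ isT) [d0 _ hd0].
exists (maxn d0 (N + 5))%N => j jj0; cbv zeta; set d := (8 ^ j.+1)%N.
have d_gt0 : (0 < d)%N by rewrite expn_gt0.
have dd0 : (d0 <= d)%N.
  apply: (leq_trans (_ : d0 <= j.+1)%N); first by lia.
  by rewrite ltnW// ltn_expl.
have r0 : (0 : R) < 24 by [].
have sq0 : (Num.sqrt d%:R)^-1 != 0 :> R by rewrite invr_neq0// gt_eqF// sqrtr_gt0 ltr0n.
have H := (lebesgue_sa_ge sq0 Llow Ldiag (@test_poly_microstates M d j eps 24 eps0 r0)).
apply: le_trans H.
rewrite lee_fin ler_wpM2r//.
  by apply: prodr_ge0 => i _; rewrite invr_ge0 normal_peak_ge0.
rewrite gauss_E_test_poly//.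
have := hd0 d dd0; rewrite /= sub0r normrN ler_norml => /andP[_].
set X := \sum_(w <- _) _ => hX.
suff : \sum_(k < N) 24 ^- (2 ^ j.+1) * (d%:R * T d [:: nseq (2 ^ j.+1) k]) <= 4^-1.
  by move: hX; set Y := \sum_(k < N) _; lra.
have hT k : 24 ^- (2 ^ j.+1) * (d%:R * T d [:: nseq (2 ^ j.+1) k]) <=
    d%:R / 2 ^+ (2 ^ j.+1).
  apply: (@le_trans _ _ (24 ^- (2 ^ j.+1) * (d%:R * 12 ^+ (2 ^ j.+1)))).
    rewrite ler_wpM2l ?invr_ge0 ?exprn_ge0// ler_wpM2l// corr_moment_norm_bound//.
    by apply: pow_bound; lia.
  have -> : 24 = 12 * 2 :> R by rewrite -natrM.
  rewrite exprMn invfM mulrCA -!mulrA ler_wpM2l//.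
  by rewrite mulrCA mulVf ?mulr1// expf_neq0.
apply: (le_trans (ler_sum _ (fun k _ => hT k))).
rewrite sumr_const card_ord -[X in X <= _]mulr_natl mulrA ler_pdivrMr ?exprn_gt0//.
rewrite ler_pdivlMl// mulrA mulrAC -!natrM -natrX ler_nat.
by have := @pow_bound2 N j.+1; rewrite -/d; lia.
Qed.

End LowerBound.

(** * Determinant asymptotics and the upper bound *)

Section LinearAlgebra.
Variable R : realType.

(** Block elimination of the first row and column; the Schur complement [S] is again positive. A
    zero pivot forces its row to vanish, and then the convention [0^-1 = 0] keeps the same formulas
    valid. *)
Lemma psd_cholesky N (A : 'M[R]_N) : positive_mx A ->
  exists L : 'M[R]_N, [/\ is_trig_mx L, forall i, 0 <= L i i & L *m L^T = A].
Proof.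
elim: N A => [|N ih] A [symA psdA].
  by exists 0; split=> [||]; [exact: mx0_is_trig|case|apply/matrixP => -[]].
rewrite -[N.+1]/(1 + N)%N in A symA psdA *.
set a := A 0 0; set b := ursubmx A : 'rV_N; set D := drsubmx A.
have dlE : dlsubmx A = b^T by rewrite /b trmx_ursub symA.
have ulE : ulsubmx A = a%:M.
  by apply/matrixP => i j; rewrite !ord1 !mxE eqxx mulr1n /a; congr (A _ _); apply/val_inj.
have AE : A = block_mx a%:M b b^T D by rewrite -{1}[A]submxK ulE dlE.
have qE (s : R) (v : 'rV_N) : (row_mx s%:M v *m A *m (row_mx s%:M v)^T) 0 0 =
    a * s ^+ 2 + (b *m v^T) 0 0 * s *+ 2 + (v *m D *m v^T) 0 0.
  rewrite AE mul_row_block tr_row_mx mul_row_col !mulmxDl tr_scalar_mx.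
  rewrite -!scalar_mxM !mul_scalar_mx !mul_mx_scalar -!scalemxAl.
  have -> : v *m b^T = (b *m v^T)^T by rewrite trmx_mul trmxK.
  by rewrite !mxE eqxx !mulr1n; ring.
have a0 : 0 <= a.
  have := psdA (row_mx 1%:M 0); rewrite qE trmx0 !mulmx0 mxE.
  by lra.
have b0 : a = 0 -> b = 0.
  move=> az; apply/rowP => j; rewrite [RHS]mxE.
  pose v : 'rV[R]_N := delta_mx 0 j; pose q := (v *m D *m v^T) 0 0.
  have bv : (b *m v^T) 0 0 = b 0 j by rewrite trmx_delta -colE mxE.
  apply/eqP/negP => /negP bj.
  (* For [a = 0] the form is affine in the first coordinate, and at this vector it equals -1. *)
  have := psdA (row_mx (- (q + 1) / (b 0 j *+ 2))%:M v).
  rewrite qE bv az mul0r add0r -/q.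
  have -> : b 0 j * (- (q + 1) / (b 0 j *+ 2)) *+ 2 = - (q + 1) by field.
  by lra.
pose S := D - a^-1 *: (b^T *m b).
have symS : S^T = S.
  rewrite /S linearB /= linearZ /= trmx_mul trmxK; congr (_ - _).
  by rewrite /D trmx_drsub symA.
have psdS : forall v : 'rV[R]_N, 0 <= (v *m S *m v^T) 0 0.
  move=> v; set c := (b *m v^T) 0 0.
  (* For a non-zero pivot this first coordinate minimizes the form, and the minimum is the Schur
     complement at [v]. *)
  have := psdA (row_mx (- (a^-1 * c))%:M v); rewrite qE -/c.
  have -> : (v *m S *m v^T) 0 0 = (v *m D *m v^T) 0 0 - a^-1 * c ^+ 2.
    rewrite /S mulmxBr mulmxBl -scalemxAr -scalemxAl mulmxA.
    have -> : v *m b^T *m b *m v^T = (c ^+ 2)%:M.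
      have -> : v *m b^T = (b *m v^T)^T by rewrite trmx_mul trmxK.
      rewrite -mulmxA [b *m v^T]mx11_scalar -/c tr_scalar_mx -scalar_mxM -expr2.
      by [].
    by rewrite !mxE eqxx mulr1n.
  have [az|az] := eqVneq a 0.
    by rewrite az invr0; nra.
  have -> : a * (- (a^-1 * c)) ^+ 2 + c * - (a^-1 * c) *+ 2 = - (a^-1 * c ^+ 2) by field.
  by lra.
have [L [trigL diagL LE]] := ih S (conj symS psdS).
exists (block_mx (Num.sqrt a)%:M 0 ((Num.sqrt a)^-1 *: b^T) L); split.
- by rewrite is_trig_block_mx// eqxx mx11_is_trig.
- move=> i; case: (split_ordP i) => j ->.
    by rewrite block_mxEul mxE !ord1 eqxx mulr1n sqrtr_ge0.
  by rewrite block_mxEdr.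
rewrite tr_block_mx mulmx_block trmx0 !mulmx0 !mul0mx !addr0 !tr_scalar_mx.
rewrite -scalar_mxM -expr2 sqr_sqrtr// linearZ /= trmxK mul_scalar_mx mul_mx_scalar !scalerA.
rewrite -scalemxAl -scalemxAr scalerA -invfM -expr2 sqr_sqrtr// LE /S addrC subrK AE.
have [az|az] := eqVneq a 0.
  by rewrite (b0 az) trmx0 !scaler0.
by rewrite mulfV ?sqrtr_eq0 -?ltNge ?lt_neqAle 1?eq_sym ?az// !scale1r.
Qed.

(** Descending induction on the column: in the entry [(i, j)] of [X L] the terms beyond [j] vanish
    by induction and those before [j] by triangularity of [L], leaving [X i j * L j j]. *)
Lemma trig_inv N (L X : 'M[R]_N) : is_trig_mx L -> (forall i, L i i != 0) ->
  X *m L = 1%:M -> is_trig_mx X.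
Proof.
move=> /is_trig_mxP trigL diagL XL; apply/is_trig_mxP => i j ij.
have [k] := ubnP (N - j)%N; elim: k j ij => // k ih j ij jk.
have := congr1 (fun M : 'M[R]_N => M i j) XL.
rewrite !mxE (bigD1 j)//= big1 ?addr0 => [|l lj].
  have -> : (i == j) = false by apply/negbTE/eqP => e; rewrite e ltnn in ij.
  by move=> /eqP; rewrite mulf_eq0 (negbTE (diagL j)) orbF => /eqP.
have [lj'|jl|e] := ltngtP l j; last by rewrite (val_inj e) eqxx in lj.
  by rewrite trigL// mulr0.
by rewrite ih ?mul0r//; have := ltn_ord l; lia.
Qed.

Lemma mxrank_diag (F : fieldType) N (d : 'rV[F]_N) :
  \rank (diag_mx d) = #|[pred i | d 0 i != 0]|.
Proof.
rewrite -sum1_card big_mkcond /=.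
elim: N d => [|N ih] d; first by rewrite big_ord0; apply/eqP; rewrite -leqn0 rank_leq_row.
rewrite -[N.+1]/(1 + N)%N in d *.
have -> : diag_mx d = block_mx (d 0 0)%:M 0 0 (diag_mx (rsubmx d)).
  apply/matrixP => i j; case: (split_ordP i) => i' ->; case: (split_ordP j) => j' ->.
  - by rewrite block_mxEul !mxE !ord1 !eqxx; congr (d _ _ *+ _); apply/val_inj.
  - by rewrite block_mxEur !mxE -val_eqE /= ord1.
  - by rewrite block_mxEdl !mxE -val_eqE /= ord1.
  - by rewrite block_mxEdr !mxE -!val_eqE /= eqSS.
rewrite rank_diag_block_mx ih big_ord_recl; congr (_ + _)%N.
  have o : d 0 ord0 = d 0 0 by congr (d _ _); apply/val_inj.
  rewrite inE o; have [->|d0] := eqVneq (d 0 0) 0; first by rewrite raddf0 mxrank0.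
  apply/eqP; rewrite eqn_leq rank_leq_row lt0n mxrank_eq0.
  by apply: contraNneq d0 => /matrixP/(_ 0 0); rewrite !mxE eqxx mulr1n => <-.
by apply: eq_bigr => i _; rewrite inE !mxE; congr (if d _ _ != 0 then _ else _); apply/val_inj.
Qed.

(** The spectral theorem over the complex numbers gives [det (A + eps) = prod_i (mu_i + eps)]. Zero
    eigenvalues contribute [eps^(N - rank A)]; the other factors lie between [mu_i] and
    [mu_i + 1]. *)
Lemma det_shift_bounds N (A : 'M[R]_N) : positive_mx A -> exists p0 p1 : R,
  [/\ 0 < p0, 0 < p1 & forall eps, 0 < eps -> eps <= 1 ->
    p0 * eps ^+ (N - \rank A) <= \det (A + eps%:M) <= p1 * eps ^+ (N - \rank A)].
Proof.
move=> [symA psdA]; pose Ac := map_mx (real_complex R) A.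
have hermA : Ac \is hermsymmx.
  apply: spectral.realsym_hermsym.
    apply/is_hermitianmxP; rewrite expr0 scale1r.
    by apply/matrixP => i j; rewrite !mxE -{1}symA mxE.
  by apply/mxOverP => i j; rewrite mxE; apply/complex_realP; exists (A i j).
set P := spectral.spectralmx Ac; set sp := spectral.spectral_diag Ac.
have Pu : P \in unitmx by exact: spectral.spectral_unit.
have AE : Ac = invmx P *m diag_mx sp *m P.
  exact/spectral.orthomx_spectralP/spectral.hermitian_normalmx.
have sp_ge0 i : 0 <= sp 0 i.
  have Preal : sp 0 i \is Num.real.
    by have /mxOverP := spectral.hermitian_spectral_diag_real hermA; apply.
  have spi : sp 0 i = \sum_l (\sum_k P i k * Ac k l) * (P i l)^*.
    have : P *m Ac *m (map_mx (@Num.conj R[i]) P^T) = diag_mx sp.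
      rewrite AE -spectral.invmx_unitary ?spectral.spectral_unitarymx//.
      by rewrite !mulmxA mulmxV// mul1mx mulmxK.
    move=> /(congr1 (fun M : 'M[R[i]]_N => M i i)); rewrite !mxE eqxx mulr1n => <-.
    by apply: eq_bigr => l _; rewrite !mxE.
  have ReD : {morph (@complex.Re R) : x y / x + y} by move=> [? ?] [? ?].
  have : 0 <= complex.Re (sp 0 i).
    (* The Hermitian form of a real symmetric matrix is the sum of its values on real and imaginary
       parts. *)
    pose u : 'rV[R]_N := \row_k complex.Re (P i k); pose v : 'rV[R]_N := \row_k complex.Im (P i k).
    have -> : complex.Re (sp 0 i) = (u *m A *m u^T) 0 0 + (v *m A *m v^T) 0 0.
      rewrite spi (big_morph _ ReD erefl) !mxE -big_split /=; apply: eq_bigr => l _.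
      rewrite !mxE !mulr_suml (big_morph _ ReD erefl) -big_split /=; apply: eq_bigr => k _.
      by rewrite !mxE; case: (P i k) (P i l) => x y [z t] /=; ring.
    by rewrite addr_ge0.
  move: Preal; rewrite realE !lecE /=; case: (sp 0 i) => x y /=.
  by case/orP => /andP[/eqP -> _] -> ; rewrite eqxx.
pose mu i : R := complex.Re (sp 0 i).
have spE i : sp 0 i = (mu i)%:C.
  by have := sp_ge0 i; rewrite /mu; case: (sp 0 i) => x y; rewrite lecE /= => /andP[/eqP-> _].
have mu0 i : 0 <= mu i by have := sp_ge0 i; rewrite spE lecR.
have detE eps : \det (A + eps%:M) = \prod_i (mu i + eps).
  apply: (@complexI R); rewrite -det_map_mx map_mxD -/Ac map_scalar_mx AE.
  have -> : invmx P *m diag_mx sp *m P + (eps%:C)%:M = invmx P *m diag_mx (sp + const_mx eps%:C) *m P.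
    rewrite linearD /= mulmxDr mulmxDl diag_const_mx; congr (_ + _).
    by rewrite mul_mx_scalar -scalemxAl mulVmx// scalemx1.
  rewrite !det_mulmx mulrAC -det_mulmx mulVmx// det1 mul1r det_diag rmorph_prod.
  by apply: eq_bigr => i _; rewrite !mxE spE rmorphD.
have rankE : \rank A = #|[pred i | mu i != 0]|.
  rewrite -(mxrank_map (real_complex R)) -/Ac AE mxrankMfree ?row_free_unit//.
  rewrite eqmxMfull ?row_full_unit ?unitmx_inv// mxrank_diag.
  by apply: eq_card => i; rewrite !inE spE (inj_eq (@complexI R)).
pose p0 := \prod_(i | mu i != 0) mu i; pose p1 := \prod_(i | mu i != 0) (mu i + 1).
exists p0, p1; split.
- by apply: prodr_gt0 => i hi; rewrite lt_neqAle eq_sym hi mu0.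
- by apply: prodr_gt0 => i hi; rewrite ltr_wpDl.
move=> eps e0 e1; rewrite detE (bigID [pred i | mu i != 0]) /=.
have -> : \prod_(i | ~~ (mu i != 0)) (mu i + eps) = eps ^+ (N - \rank A).
  rewrite (eq_bigr (fun _ => eps)) => [|i]; last by rewrite negbK => /eqP->; rewrite add0r.
  rewrite prodr_const rankE; congr (_ ^+ _).
  have e := cardC [pred i | mu i != 0].
  by rewrite -[X in (X - _)%N](card_ord N) -e addKn; apply: eq_card.
rewrite !ler_wpM2r ?exprn_ge0 ?(ltW e0)//=.
  by apply: ler_prod => i _; rewrite addr_ge0 ?mu0 ?(ltW e0)//= lerD2l.
by apply: ler_prod => i _; rewrite mu0 lerDl ltW.
Qed.

(** Extended by the identity beyond [N], so that triangularity and a non-zero diagonal hold for all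
    natural indices, as the volume bounds ask. *)
Definition natmx N (L : 'M[R]_N) (k l : nat) : R :=
  if insub k is Some i then if insub l is Some j then L i j else 0 else (k == l)%:R.

Lemma natmxE N (L : 'M[R]_N) (i j : 'I_N) : natmx L i j = L i j.
Proof. by rewrite /natmx !valK. Qed.

Lemma natmx_trig N (L : 'M[R]_N) k l : is_trig_mx L -> (k < l)%N -> natmx L k l = 0.
Proof.
move=> /is_trig_mxP tL kl; rewrite /natmx; case: insubP => [i _ ik|_].
  by case: insubP => // j _ jl; rewrite tL// ik jl.
by case: ltngtP kl.
Qed.

Lemma pd_cholesky N (C : 'M[R]_N) : positive_mx C -> \det C != 0 ->
  exists L X : 'M[R]_N, [/\ is_trig_mx L, is_trig_mx X, forall i, 0 < L i i,
    L *m L^T = C /\ X *m L = 1%:M & (\prod_i L i i) ^+ 2 = \det C].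
Proof.
move=> psdC detC; have [L [trigL diagL LE]] := psd_cholesky psdC.
have detL : (\prod_i L i i) ^+ 2 = \det C by rewrite -LE det_mulmx det_tr det_trig.
have pL : \prod_i L i i != 0 by apply: contraNneq detC => h; rewrite -detL h expr0n.
have dL i : 0 < L i i.
  rewrite lt_neqAle diagL andbT eq_sym; apply: contraNneq pL => h.
  by rewrite (bigD1 i)//= h mul0r.
have uL : L \in unitmx by rewrite unitmxE det_trig// unitfE.
exists L, (invmx L); split => //; last by split => //; rewrite mulVmx.
apply: (trig_inv trigL) => [i|]; first by rewrite gt_eqF.
by rewrite mulVmx.
Qed.

End LinearAlgebra.

(** * Upper bound on the volume of microstates *)

Section UpperBound.
Variables (R : realType) (n m : nat).
Local Notation N := (n + m)%N.
Variables (X : nat -> nat -> R) (C : 'I_N -> 'I_N -> R).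
Hypothesis Xlow : forall k l : nat, (k < l)%N -> X k l = 0.
Hypothesis Xdiag : forall k, 0 < X k k.
Hypothesis XC : forall k : 'I_N, \sum_(i < N) \sum_(j < N) X k i * X k j * C i j <= 1.
Variables (A : cstarAlgebra R) (phi : {scalar A}) (Z : 'I_N -> A).
Hypothesis phiC_ll : forall i j, phi (Z (lshift m i) * Z (lshift m j)) = (C (lshift m i) (lshift m j))%:C.
Hypothesis phiC_lr : forall i j, phi (Z (lshift m i) * Z (rshift n j)) = (C (lshift m i) (rshift n j))%:C.
Hypothesis phiC_rr : forall i j, phi (Z (rshift n i) * Z (rshift n j)) = (C (rshift n i) (rshift n j))%:C.
Hypothesis Csym : forall i j, C i j = C j i.

(** A tolerance so small that passing from the covariance to the second moments of a microstate
    changes the total of the [N] quadratic forms by at most 1. *)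
Let eta : R := (1 + \sum_(k < N) (\sum_(i < N) `|X k i|) ^+ 2)^-1.

(** Two right variables give their matrices in reverse order; a right-left pair is reduced to a
    left-right one by symmetry of [C] and of the trace. *)
Lemma microstates_second_moment r d (B : 'I_N -> 'M[R[i]]_d) :
  microstates phi Z r 2 eta B ->
  forall i j, normc ((C i j)%:C - ntrace (B i * B j)) <= eta.
Proof.
move=> [_ _ H].
have key i j s t : (1 <= size s + size t <= 2)%N ->
    phi (\prod_(i <- s) Z (lshift m i) * \prod_(j <- t) Z (rshift n j)) = (C i j)%:C ->
    ntrace (\prod_(i <- s) B (lshift m i) * \prod_(j <- rev t) B (rshift n j)) = ntrace (B i * B j) ->
    normc ((C i j)%:C - ntrace (B i * B j)) <= eta.
  move=> st e1 e2; have := H s t st; rewrite e1 e2.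
  by case: (_ - _) => a b /= h; move: h; rewrite normc_def ltcR; exact: ltW.
have nC i j : ntrace (B i * B j) = ntrace (B j * B i) by rewrite /ntrace mxtrace_mulC.
move=> i j; case: (split_ordP i) => i' ->; case: (split_ordP j) => j' ->.
- apply: (key _ _ [:: i'; j'] [::]) => //; rewrite !big_cons !big_nil ?mulr1//; exact: phiC_ll.
- by apply: (key _ _ [:: i'] [:: j']) => //; rewrite !big_cons !big_nil ?mulr1//; exact: phiC_lr.
- rewrite Csym nC.
  by apply: (key _ _ [:: j'] [:: i']) => //; rewrite !big_cons !big_nil ?mulr1//; exact: phiC_lr.
- by apply: (key _ _ [::] [:: j'; i']) => //; rewrite !big_cons !big_nil ?mulr1 ?mul1r//; rewrite Csym; exact: phiC_rr.
Qed.

Variable d : nat.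
Hypothesis d0 : (0 < d)%N.
Local Notation D := (d * d)%N.
Let sig : R := (Num.sqrt d%:R)^-1.

Let X_entry (t : seq R) (k : nat) (a : nat) : R := \sum_(l < N) X k l * nth 0 t (l * D + a).

Lemma sum_mxvec_index (F : nat -> R) p q :
  \sum_(a < p * q) F a = \sum_(i < p) \sum_(j < q) F (i * q + j)%N.
Proof.
rewrite (reindex _ (curry_mxvec_bij p q)) pair_bigA /=.
by apply: eq_bigr => -[i j] _ /=; rewrite -(val_mxvec_index i j).
Qed.

Lemma frob_sa_of_coords (x : 'I_d -> 'I_d -> R) :
  frob (sa_of_coords x) = \sum_i \sum_j x i j ^+ 2.
Proof.
have sym (f : 'I_d -> 'I_d -> R) : \sum_i \sum_j f i j = 2^-1 * \sum_i \sum_j (f i j + f j i).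
  under [in RHS]eq_bigr do rewrite big_split /=.
  by rewrite big_split /= [X in _ + X]exchange_big /=; set S := \sum_i _; lra.
rewrite /frob sym [RHS]sym; congr (_ * _).
apply: eq_bigr => i _; apply: eq_bigr => j _.
have nE (a b : R) : normc (a +i* b) ^+ 2 = a ^+ 2 + b ^+ 2.
  by rewrite /= sqr_sqrtr// addr_ge0 ?sqr_ge0.
have h2 : Num.sqrt 2 ^+ 2 = 2 :> R by rewrite sqr_sqrtr.
rewrite !mxE [j == i]eq_sym; have [->|ij] := eqVneq i j.
  by rewrite !nE expr0n addr0.
have [h|h|h] := ltngtP i j; last by rewrite (val_inj h) eqxx in ij.
- by rewrite !nE ?sqrrN !exprMn exprVn h2; field.
- by rewrite !nE ?sqrrN !exprMn exprVn h2; field.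
Qed.

(** For fixed [k] the sum over entries is [Tr ((X B)_k^2)], which is [d] times the quadratic form of
    row [k] of [X] at the second moments of [B]; at [C] itself this form is at most 1. *)
Lemma microstates_quadratic r (t : (N * D).-tuple R) :
  microstates phi Z r 2 eta (sa_family_of_coords t) ->
  \sum_(k < N) \sum_(a < D) X_entry t k a ^+ 2 <= d%:R * (N%:R + 1).
Proof.
move=> mt; have cC := microstates_second_moment mt.
set B := sa_family_of_coords t in mt cC.
pose rt i j : R := complex.Re (ntrace (B i * B j)).
have ReD : {morph (@complex.Re R) : x y / x + y} by move=> [? ?] [? ?].
have dn0 : d%:R != 0 :> R by rewrite pnatr_eq0 -lt0n.
have dV : (d%:R^-1 : R[i]) = (d%:R^-1 : R)%:C by rewrite (fmorphV (real_complex R)) rmorph_nat.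
have rtE i j : complex.Re (\tr (B i * B j)) = d%:R * rt i j.
  rewrite /rt /ntrace dV; case: (\tr _) => x y /=; rewrite mul0r subr0.
  by rewrite mulrA mulfV ?mul1r.
have rtC i j : `|C i j - rt i j| <= eta.
  apply: le_trans (cC i j); rewrite /rt; case: (ntrace _) => x y /=.
  by rewrite -[X in X <= _]sqrtr_sqr ler_sqrt ?addr_ge0 ?sqr_ge0// lerDl sqr_ge0.
have quad (k : 'I_N) : \sum_(a < D) X_entry t k a ^+ 2 =
    d%:R * \sum_(i < N) \sum_(j < N) X k i * X k j * rt i j.
  rewrite (sum_mxvec_index (fun a => X_entry t k a ^+ 2)).
  have -> : \sum_(i < d) \sum_(j < d) X_entry t k (i * d + j) ^+ 2 =
      frob (sa_of_coords (fun i j : 'I_d => X_entry t k (i * d + j))).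
    by rewrite frob_sa_of_coords.
  set Y := sa_of_coords _.
  have YE : Y = \sum_(l < N) (X k l)%:C *: B l.
    apply/matrixP => i j; rewrite sa_of_coordsE summxE.
    rewrite !(rmorph_sum (real_complex R)) !mulr_sumr -big_split /=.
    apply: eq_bigr => l _; rewrite mxE sa_of_coordsE !(tnth_nth 0) !val_mxvec_index.
    by rewrite !(rmorphM (real_complex R)) /=; ring.
  pose Rt (M : 'M[R[i]]_d) := complex.Re (\tr M).
  have RtD : {morph Rt : x y / x + y} by move=> x y; rewrite /Rt mxtraceD ReD.
  have Rt0 : Rt 0 = 0 by rewrite /Rt mxtrace0.
  rewrite frob_self_adjoint ?mxadj_sa_of_coords// -[LHS]/(Rt _) YE mulr_suml (big_morph Rt RtD Rt0).
  rewrite mulr_sumr; apply: eq_bigr => i _.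
  rewrite mulr_sumr (big_morph Rt RtD Rt0) mulr_sumr; apply: eq_bigr => j _.
  have -> : (X k i)%:C *: B i * ((X k j)%:C *: B j) = (X k i * X k j)%:C *: (B i * B j).
    rewrite (rmorphM (real_complex R)) /= -[LHS]/((X k i)%:C *: B i *m ((X k j)%:C *: B j)).
    by rewrite -scalemxAl -scalemxAr scalerA.
  rewrite /Rt mxtraceZ.
  transitivity (X k i * X k j * complex.Re (\tr (B i * B j))); last by rewrite rtE; ring.
  by case: (\tr _) => x y /=; rewrite mul0r subr0.
under eq_bigr do rewrite quad.
rewrite -mulr_sumr ler_wpM2l//.
apply: (@le_trans _ _ (\sum_(k < N) (1 + eta * (\sum_(i < N) `|X k i|) ^+ 2))).
  apply: ler_sum => k _; rewrite -lerBlDl; apply: (le_trans (lerB (lexx _) (XC k))).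
  rewrite -sumrB expr2 mulr_suml mulr_sumr; apply: ler_sum => i _.
  rewrite -sumrB mulr_sumr mulr_sumr; apply: ler_sum => j _.
  rewrite -mulrBr; apply: (le_trans (ler_norm _)); rewrite !normrM mulrC.
  by rewrite distrC ler_wpM2r ?mulr_ge0.
rewrite big_split /= sumr_const card_ord -mulr_sumr lerD2l.
set Q := \sum_(k < N) _; have Q0 : 0 <= Q by rewrite sumr_ge0// => k _; exact: sqr_ge0.
by rewrite /eta -/Q ler_pdivrMl ?mulr1 ?lerDr// ltr_pwDl.
Qed.

(** On microstates the quadratic form [Q] is at most [d (N + 1)], so
    [1 <= exp(d^2 (N + 1)/2) exp(-d Q/2)]. Completing squares along the triangular [X] gives the
    second factor the product form of [lebesgue_tuple_le]. *)
Lemma lebesgue_sa_le r :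
  (lebesgue_sa (microstates phi Z r 2 (d := d) eta) <=
   (expR (d%:R ^+ 2 * (N%:R + 1) / 2) *
     \prod_(i < N * D) (normal_peak (sig / diag_coef d X i))^-1)%:E)%E.
Proof.
have sig0 : 0 < sig by rewrite invr_gt0 sqrtr_gt0 ltr0n.
have sig2 : sig ^+ 2 = d%:R^-1 by rewrite /sig exprVn sqr_sqrtr.
pose h i (s : seq R) := - low_coef d X i s / diag_coef d X i.
apply: (lebesgue_tuple_le (c := fun i => sig / diag_coef d X i) (h := h)).
- exact: expR_ge0.
- by move=> i; rewrite gt_eqF// divr_gt0// Xdiag.
move=> t Et; have := microstates_quadratic Et => q.
have rowE i : (i < N * D)%N -> X_entry t (i %/ D) (i %% D) =
    diag_coef d X i * nth 0 t i + low_coef d X i (take i t).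
  move=> iND; have D0 : (0 < D)%N by rewrite muln_gt0 d0.
  have kN : (i %/ D < N)%N by rewrite ltn_divLR.
  rewrite /X_entry /diag_coef /low_coef addrC.
  rewrite -(big_mkord xpredT (fun l => X (i %/ D)%N l * nth 0 t (l * D + i %% D))).
  rewrite (big_cat_nat _ (n := (i %/ D).+1))//= [X in _ + X = _]big_nat_cond [X in _ + X = _]big1; last first.
    by move=> l /andP[/andP[kl _] _]; rewrite Xlow// mul0r.
  rewrite addr0 big_nat_recr//= big_mkord -divn_eq; congr (_ + _).
  apply: eq_bigr => l _; rewrite nth_take// [X in (_ < X)%N](divn_eq i D).
  by rewrite ltn_add2r ltn_pmul2r.
have -> : \prod_(i < N * D) normal_fun (h i (take i t)) (sig / diag_coef d X i) (nth 0 t i) =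
    expR (- (d%:R / 2) * \sum_(k < N) \sum_(a < D) X_entry t k a ^+ 2).
  have -> : \sum_(k < N) \sum_(a < D) X_entry t k a ^+ 2 =
      \sum_(i < N * D) X_entry t (i %/ D) (i %% D) ^+ 2.
    rewrite (sum_mxvec_index (fun i => X_entry t (i %/ D) (i %% D) ^+ 2)).
    apply: eq_bigr => k _; apply: eq_bigr => a _.
    have D0 : (0 < D)%N by rewrite muln_gt0 d0.
    by rewrite divnMDl// divn_small// addn0 modnMDl modn_small.
  rewrite mulr_sumr (big_morph expR (@expRD R) (@expR0 R)); apply: eq_bigr => i _.
  rewrite rowE// /normal_fun /h; congr expR.
  have x0 : diag_coef d X i != 0 by rewrite gt_eqF// Xdiag.
  rewrite expr_div_n sig2; move: (diag_coef d X i) (low_coef _ _ _ _) (nth 0 t i) x0 => x y z x0.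
  have dn0 : d%:R != 0 :> R by rewrite pnatr_eq0 -lt0n.
  by field; rewrite x0 dn0.
rewrite -expRD -[leLHS]expR0 ler_expR.
have d1 : 0 < d%:R :> R by rewrite ltr0n.
move: q; set Q := \sum_(k < N) _ => q.
have : d%:R / 2 * Q <= d%:R / 2 * (d%:R * (N%:R + 1)) by rewrite ler_wpM2l// divr_ge0// ltW.
by rewrite expr2; lra.
Qed.

End UpperBound.

(** * Entropy of a bi-free central limit distribution *)

Section Entropy.
Variables (R : realType).

Lemma normal_peakV (s : R) : 0 < s -> (normal_peak s)^-1 = s * Num.sqrt (pi *+ 2).
Proof.
move=> s0; rewrite /normal_peak invrK -mulrnAr sqrtrM ?sqr_ge0//.
by rewrite sqrtr_sqr ger0_norm// ltW.
Qed.

(** The product is a [d^2]-th power, so dividing its logarithm by [d^2] extracts the base, in which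
    [d^(-N/2)] from the deviations cancels the normalization of the entropy. *)
Lemma prod_normal_peak N d (f : nat -> R) : (0 < d)%N -> (forall k, 0 < f k) ->
  let V := \prod_(i < N * (d * d)) (normal_peak (f (i %/ (d * d))%N * (Num.sqrt d%:R)^-1))^-1 in
  0 < V /\
  d%:R ^- 2 * ln V + N%:R / 2 * ln d%:R =
    ln (\prod_(k < N) f k) + N%:R * ln (Num.sqrt (pi *+ 2)).
Proof.
move=> d0 f0 V; pose q := Num.sqrt (pi *+ 2) : R.
have q0 : 0 < q by rewrite sqrtr_gt0 pmulrn_lgt0// pi_gt0.
have sig0 : 0 < (Num.sqrt d%:R)^-1 :> R by rewrite invr_gt0 sqrtr_gt0 ltr0n.
have D0 : (0 < d * d)%N by rewrite muln_gt0 d0.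
have P0 : 0 < \prod_(k < N) f k by apply: prodr_gt0.
have VE : V = (\prod_(k < N) f k * ((Num.sqrt d%:R)^-1 * q) ^+ N) ^+ (d * d).
  have -> : V = \prod_(i < N * (d * d)) (f (i %/ (d * d))%N * ((Num.sqrt d%:R)^-1 * q)).
    by apply: eq_bigr => i _; rewrite normal_peakV ?mulr_gt0// -mulrA.
  have re (F : nat -> R) : \prod_(a < N * (d * d)) F a = \prod_(i < N) \prod_(j < d * d) F (i * (d * d) + j)%N.
    rewrite (reindex _ (curry_mxvec_bij N (d * d))) pair_bigA /=.
    by apply: eq_bigr => -[i j] _ /=; rewrite -(val_mxvec_index i j).
  rewrite (re (fun i => f (i %/ (d * d))%N * _)).
  rewrite (eq_bigr (fun k : 'I_N => (f k * ((Num.sqrt d%:R)^-1 * q)) ^+ (d * d))); last first.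
    move=> k _; rewrite (eq_bigr (fun _ => f k * ((Num.sqrt d%:R)^-1 * q))) ?prodr_const ?card_ord//.
    by move=> j _; rewrite divnMDl// divn_small// addn0.
  by rewrite prodrXl big_split /= prodr_const card_ord.
have W0 : 0 < \prod_(k < N) f k * ((Num.sqrt d%:R)^-1 * q) ^+ N.
  by rewrite mulr_gt0// exprn_gt0// mulr_gt0.
split; first by rewrite VE exprn_gt0.
have dr : 0 < d%:R :> R by rewrite ltr0n.
rewrite VE lnXn// lnM ?posrE ?exprn_gt0 ?mulr_gt0// lnXn ?mulr_gt0// lnM ?posrE//.
rewrite lnV ?posrE ?sqrtr_gt0//.
have lnd : ln d%:R = ln (Num.sqrt d%:R) *+ 2 :> R.
  by rewrite -lnXn ?sqrtr_gt0// sqr_sqrtr// ltW.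
rewrite lnd -[_ *+ (d * d)]mulr_natr natrM -[_ *+ N]mulr_natr -/q.
by field; rewrite gt_eqF.
Qed.

Lemma limn_esup_le (u : nat -> \bar R) (l : \bar R) :
  (forall d, (0 < d)%N -> (u d <= l)%E) -> (limn_esup u <= l)%E.
Proof.
move=> h; apply: (@le_trans _ _ (ereal_sup (u @` [set d | (0 < d)%N]))).
  by apply: ereal_inf_lbound; exists [set d | (0 < d)%N] => //; exists 1%N.
by apply: ge_ereal_sup => _ [d d0 <-]; exact: h.
Qed.

Lemma limn_esup_ge (u : nat -> \bar R) (l : \bar R) :
  (forall d0, exists2 d, (d0 <= d)%N & (l <= u d)%E) -> (l <= limn_esup u)%E.
Proof.
move=> h; apply: le_ereal_inf_tmp => _ [V [d0 _ hV] <-].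
have [d dd0 ld] := h d0; apply: (le_trans ld).
by apply: ereal_sup_ubound; exists d => //; exact: hV.
Qed.

Lemma lne_le (x y : \bar R) : (0 <= x)%E -> (x <= y)%E -> (lne x <= lne y)%E.
Proof.
move=> x0 xy; rewrite lee_lne// in_itv/= ?x0 ?leey//.
by rewrite (le_trans x0 xy).
Qed.

Lemma scaled_lne_ge (s V a : R) (x : \bar R) : 0 <= s -> 0 < V -> (V%:E <= x)%E ->
  ((s * ln V + a)%:E <= s%:E * lne x + a%:E)%E.
Proof.
move=> s0 V0 Vx; rewrite EFinD leeD2r// EFinM lee_wpmul2l ?lee_fin//.
by rewrite -lne_EFin// lne_le// lee_fin ltW.
Qed.

Lemma scaled_lne_le (s V a : R) (x : \bar R) : 0 <= s -> 0 < V -> (0 <= x)%E -> (x <= V%:E)%E ->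
  (s%:E * lne x + a%:E <= (s * ln V + a)%:E)%E.
Proof.
move=> s0 V0 x0 xV; rewrite EFinD leeD2r// EFinM lee_wpmul2l ?lee_fin//.
by rewrite -lne_EFin// lne_le.
Qed.

(** The determinant enters through the diagonal of the Cholesky factor. The lower bound is taken at
    radius 24 for every [M] and [eps], the upper one at [M = 2] and tolerance [eta] for every
    radius. *)
Lemma chi_bounds n m (C : 'M[R]_(n + m)) (mo : seq 'I_(n + m) -> R)
    (A : cstarAlgebra R) (phi : {scalar A}) (Z : 'I_(n + m) -> A) :
  positive_mx C -> \det C != 0 -> (forall k j, `|C k j| <= 2) ->
  mo [::] = 1 ->
  (forall k w, mo (k :: w) = spl (fun (u : seq 'I_(n + m)) (j : 'I_(n + m)) v => C k j * mo u * mo v) w) ->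
  (forall (s : seq 'I_n) (t : seq 'I_m),
    phi ((\prod_(i <- s) Z (lshift m i)) * (\prod_(j <- t) Z (rshift n j))) =
    (mo (map (@lshift n m) s ++ map (@rshift n m) (rev t)))%:C) ->
  let c := ln (\det C) / 2 + (n + m)%:R * ln (Num.sqrt (pi *+ 2)) in
  ((c - ln 2)%:E <= chi phi Z)%E /\
  (chi phi Z <= (c + ((n + m)%:R + 1) / 2)%:E)%E.
Proof.
move=> psdC detC C2 mo0 mo_loop phiZ c.
have [L [X [trigL trigX diagL [LE XL] detL]]] := pd_cholesky psdC detC.
have uL : L \in unitmx by case: (mulmx1_unit XL).
have Llow k l : (k < l)%N -> natmx L k l = 0 by exact: natmx_trig.
have Xlow k l : (k < l)%N -> natmx X k l = 0 by exact: natmx_trig.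
have Ldiag k : 0 < natmx L k k.
  by rewrite /natmx; case: insubP => [i _ _|_]; rewrite ?eqxx ?ltr01.
have XLdiag k : natmx X k k = (natmx L k k)^-1.
  rewrite /natmx; case: insubP => [i _ _|_]; last by rewrite eqxx invr1.
  have := congr1 (fun M : 'M[R]_(n + m) => M i i) XL; rewrite !mxE eqxx (bigD1 i)//= big1 ?addr0.
    by move=> h; apply: (mulIf (lt0r_neq0 (diagL i))); rewrite h mulVf// lt0r_neq0.
  move=> l li; have [il|il] := ltnP i l; first by rewrite (is_trig_mxP trigX)// mul0r.
  by rewrite (is_trig_mxP trigL l i) ?mulr0// ltn_neqAle il andbT.
have Xdiag k : 0 < natmx X k k by rewrite XLdiag invr_gt0.
have PL : ln (\prod_(k < n + m) natmx L k k) = ln (\det C) / 2.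
  under eq_bigr do rewrite natmxE.
  have P0 : 0 < \prod_i L i i by apply: prodr_gt0.
  by rewrite -detL lnXn// mulr2n; lra.
have CE (k j : 'I_(n + m)) : \sum_(l < n + m) natmx L k l * natmx L j l = C k j.
  by rewrite -LE mxE; apply: eq_bigr => l _; rewrite !natmxE mxE.
have mo2 i j : mo [:: i; j] = C i j by rewrite mo_loop /= mo0 !mulr1 addr0.
have Cs i j : C i j = C j i by rewrite -[in LHS]psdC.1 mxE.
have XC (k : 'I_(n + m)) : \sum_(i < n + m) \sum_(j < n + m) natmx X k i * natmx X k j * C i j <= 1.
  have : (X *m C *m X^T) k k = 1.
    by rewrite -LE mulmxA XL mul1mx -trmx_mul XL trmx1 mxE eqxx.
  rewrite mxE => <-; rewrite exchange_big /=; apply: ler_sum => j _.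
  rewrite !mxE mulr_suml; apply: ler_sum => i _.
  by rewrite !natmxE mulrAC.
split.
- apply: (@le_trans _ _ (chi_R phi Z 24)); last first.
    by apply: ereal_sup_ubound; exists 24; split.
  apply: le_ereal_inf_tmp => _ [M [eps [eps0 ->]]].
  apply: limn_esup_ge => d0.
  have Ldiag' k : natmx L k k != 0 by rewrite gt_eqF.
  have C2' (k j : 'I_(n + m)) : `|\sum_(l < n + m) natmx L k l * natmx L j l| <= 2 by rewrite CE.
  have mo_loop' k w : mo (k :: w) = spl (fun (u : seq 'I_(n + m)) (j : 'I_(n + m)) v =>
      (\sum_(l < n + m) natmx L k l * natmx L j l) * mo u * mo v) w.
    by rewrite mo_loop; apply: eq_spl => u j v; rewrite CE.
  have [j0 hj0] := microstates_volume_ge Llow Ldiag' C2' mo0 mo_loop' phiZ M eps0.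
  have := hj0 (maxn d0 j0) (leq_maxr _ _); cbv zeta.
  set d := (8 ^ _)%N => hV; exists d.
    by rewrite (leq_trans (leq_maxl d0 j0))// /d (leq_trans (leqnSn _))// ltnW// ltn_expl.
  have d_gt0 : (0 < d)%N by rewrite expn_gt0.
  set V := \prod_(i < _) _ in hV.
  have [V0 VE] : 0 < V /\ d%:R ^- 2 * ln V + (n + m)%:R / 2 * ln d%:R =
      ln (\prod_(k < n + m) natmx L k k) + (n + m)%:R * ln (Num.sqrt (pi *+ 2)) :=
    prod_normal_peak (n + m) d_gt0 (Ldiag).
  have V2 : 0 < 2^-1 * V by rewrite mulr_gt0// invr_gt0.
  have dm : 0 <= d%:R ^- 2 :> R by rewrite invr_ge0 exprn_ge0.
  apply: le_trans (scaled_lne_ge _ dm V2 hV); rewrite lee_fin.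
  rewrite lnM ?posrE ?invr_gt0// mulrDr -[leRHS]addrA VE lnV ?posrE// PL addrC lerD// mulrN lerN2.
  rewrite ler_piMl ?ln_ge0 ?ler1n// invf_le1 ?exprn_gt0 ?ltr0n// exprn_ege1// ler1n//.
- apply: ge_ereal_sup => _ [r [r0 ->]].
  pose eta : R := (1 + \sum_(k < n + m) (\sum_(i < n + m) `|natmx X k i|) ^+ 2)^-1.
  have eta0 : 0 < eta.
    by rewrite invr_gt0 ltr_pwDl// sumr_ge0// => k _; exact: sqr_ge0.
  apply: (@le_trans _ _ (chi_RMe phi Z r 2 eta)).
    by apply: ereal_inf_lbound; exists 2%N, eta.
  apply: limn_esup_le => d d_gt0.
  have invX k : (natmx X k k)^-1 = natmx L k k by rewrite XLdiag invrK.
  have [V0 VE] := prod_normal_peak (n + m) d_gt0 (Ldiag).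
  have H : (lebesgue_sa (microstates phi Z r 2 (d := d) eta) <= (expR (d%:R ^+ 2 * ((n + m)%:R + 1) / 2) *
     \prod_(i < (n + m) * (d * d)) (normal_peak (natmx L (i %/ (d * d))%N (i %/ (d * d))%N * (Num.sqrt d%:R)^-1))^-1)%:E)%E.
    have pz2 i j : phi (Z (lshift m i) * Z (lshift m j)) = (C (lshift m i) (lshift m j))%:C.
      by have := phiZ [:: i; j] [::]; rewrite !big_cons !big_nil !mulr1 /= mo2.
    have pz1 i j : phi (Z (lshift m i) * Z (rshift n j)) = (C (lshift m i) (rshift n j))%:C.
      by have := phiZ [:: i] [:: j]; rewrite !big_cons !big_nil !mulr1 /= mo2.
    have pz0 i j : phi (Z (rshift n i) * Z (rshift n j)) = (C (rshift n i) (rshift n j))%:C.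
      by have := phiZ [::] [:: i; j]; rewrite !big_cons !big_nil mul1r mulr1 /= mo2 Cs.
    have := lebesgue_sa_le Xlow Xdiag XC pz2 pz1 pz0 Cs d_gt0 r.
    rewrite (eq_bigr (fun i : 'I_((n + m) * (d * d)) => (normal_peak (natmx L (i %/ (d * d))%N (i %/ (d * d))%N * (Num.sqrt d%:R)^-1))^-1))// => i _.
    by rewrite [diag_coef d _ _]XLdiag invrK mulrC.
  have dr : 0 < d%:R :> R by rewrite ltr0n.
  have dm : 0 <= d%:R ^- 2 :> R by rewrite invr_ge0 exprn_ge0.
  apply: (le_trans (scaled_lne_le _ dm (mulr_gt0 (expR_gt0 _) V0) (lebesgue_tuple_ge0 _) H)).
  rewrite lee_fin lnM ?posrE ?expR_gt0// expRK mulrDr -[leLHS]addrA VE PL addrC lerD// mulrA mulrA mulVf ?mul1r//.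
  by rewrite expf_neq0// gt_eqF.
Qed.

Lemma limf_esup_eq (F : set_system R) (f : R -> \bar R) (b : R) : ProperFilter F ->
  (forall e : R, 0 < e -> \forall x \near F, ((b - e)%:E <= f x)%E /\ (f x <= (b + e)%:E)%E) ->
  limf_esup f F = b%:E.
Proof.
move=> FF h; apply/eqP; rewrite eq_le; apply/andP; split.
- apply/lee_addgt0Pr => e e0; apply: (@le_trans _ _ (ereal_sup (f @` [set x | (f x <= (b + e)%:E)%E]))).
    apply: ereal_inf_lbound; exists [set x | (f x <= (b + e)%:E)%E] => //.
    by apply: filterS (h e e0) => x [].
  by apply: ge_ereal_sup => _ [x fx <-].
- apply: le_ereal_inf_tmp => _ [V FV <-].
  apply/lee_subgt0Pr => e e0.
  have [x [Vx [fx _]]] := filter_ex (filterI FV (h e e0)).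
  by apply: (le_trans fx); apply: ereal_sup_ubound; exists x.
Qed.

(** Division by [|ln (sqrt eps)|], which tends to infinity, removes [K]; the logarithm being
    negative, the main term becomes [r - N]. *)
Lemma log_growth_limit (N r K : R) (g : R -> \bar R) :
  (forall eps : R, 0 < eps -> eps <= 1 ->
     (((N - r) * ln (Num.sqrt eps) - K)%:E <= g eps)%E /\
     (g eps <= ((N - r) * ln (Num.sqrt eps) + K)%:E)%E) ->
  (N%:E + limf_esup (fun eps : R => g eps * (`|ln (Num.sqrt eps)|^-1)%:E) 0^'+)%E = r%:E.
Proof.
move=> gb; rewrite (@limf_esup_eq _ _ (r - N)) ?EFinB ?[(r%:E - _)%E]addeC ?addeA ?subee ?add0e//.
move=> e e0; pose s : R := `|K| / e + 1.
have s0 : 0 < s by rewrite ltr_pwDr// divr_ge0// ltW.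
near=> x.
have x0 : 0 < x by near: x; exact: nbhs_right_gt.
have xs : x < expR (- s) ^+ 2 by near: x; apply: nbhs_right_lt; rewrite exprn_gt0 ?expR_gt0.
have sq0 : 0 < Num.sqrt x by rewrite sqrtr_gt0.
have lx : ln (Num.sqrt x) < - s.
  rewrite -[- s]expRK ltr_ln ?posrE ?expR_gt0//.
  by rewrite -(@ltr_pXn2r _ 2)// ?nnegrE ?expR_ge0// ?ltW// sqr_sqrtr// ltW.
have x1 : x <= 1.
  rewrite (le_trans (ltW xs))// exprn_ile1 ?expR_ge0// -expR0 ler_expR oppr_le0 ltW//.
have [] := gb x x0 x1; set t := ln _ in lx *.
have t0 : t < 0 by rewrite (lt_trans lx)// oppr_lt0.
rewrite (ltr0_norm t0) => h1 h2.
have it : 0 < (- t)^-1 by rewrite invr_gt0 oppr_gt0.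
have Kt : `|K| / (- t) <= e.
  rewrite ler_pdivrMr ?oppr_gt0// mulrC -ler_pdivrMr// (le_trans (_ : _ <= s)) ?lerDl//.
  by rewrite lerNr ltW.
have Kle : `|K / (- t)| <= e by rewrite normrM (gtr0_norm it).
have E : t / (- t) = -1 by rewrite invrN mulrN divff// lt_eqF.
split.
- apply: (@le_trans _ _ (((N - r) * t - K)%:E * (- t)^-1%:E)%E); last by rewrite lee_wpmul2r// lee_fin ltW.
  rewrite -EFinM lee_fin mulrBl -mulrA E mulrN1 opprB lerD2l lerN2.
  exact: le_trans (ler_norm _) Kle.
- apply: (@le_trans _ _ (((N - r) * t + K)%:E * (- t)^-1%:E)%E); first by rewrite lee_wpmul2r// lee_fin ltW.
  rewrite -EFinM lee_fin mulrDl -mulrA E mulrN1 opprB lerD2l.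
  exact: le_trans (ler_norm _) Kle.
Unshelve. all: by end_near. Qed.

End Entropy.

(** * Operators on the Fock space *)

Section HilbertFromForm.
Variables (K : numFieldType) (theta : {rmorphism K -> K}).

(** Real and complex spaces are treated together. The norm is a datum because [K] need not have
    square roots, and completeness is stated with filters to match the uniform structure built from
    it. *)
Record prehilbert := Prehilbert {
  ph_car :> lmodType K ;
  ip : ph_car -> ph_car -> K ;
  ph_norm : ph_car -> K ;
  ipPl : forall a x y z, ip (a *: x + y) z = a * ip x z + ip y z ;
  ip_herm : forall x y, ip x y = theta (ip y x) ;
  ph_norm_ge0 : forall x, 0 <= ph_norm x ;
  ph_norm_sqr : forall x, ph_norm x ^+ 2 = ip x x ;
  ph_norm_eq0 : forall x, ph_norm x = 0 -> x = 0 ;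
  ph_complete : forall F : set_system ph_car, ProperFilter F ->
    (forall e : K, 0 < e -> exists2 A, F A & forall x y, A x -> A y -> ph_norm (x - y) < e) ->
    exists l, forall e : K, 0 < e -> F [set x | ph_norm (l - x) < e] }.

Hypothesis theta_norm : forall a, a * theta a = `|a| ^+ 2.
Hypothesis theta_abs : forall a, `|theta a| = `|a|.

Variable P : prehilbert.
Implicit Types x y z : P.

Lemma ip0l y : ip 0 y = 0.
Proof. by have := ipPl (-1) (0 : P) 0 y; rewrite scaler0 addr0 mulN1r addNr. Qed.

Lemma ipDl x y z : ip (x + y) z = ip x z + ip y z.
Proof. by rewrite -{1}[x]scale1r ipPl mul1r. Qed.

Lemma ipZl a x z : ip (a *: x) z = a * ip x z.
Proof. by rewrite -[a *: x]addr0 ipPl ip0l addr0. Qed.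

Lemma ipDr x y z : ip z (x + y) = ip z x + ip z y.
Proof. by rewrite ip_herm ipDl rmorphD -!ip_herm. Qed.

Lemma ipZr a x z : ip z (a *: x) = theta a * ip z x.
Proof. by rewrite ip_herm ipZl rmorphM -ip_herm. Qed.

Lemma ip_ge0 x : 0 <= ip x x.
Proof. by rewrite -ph_norm_sqr exprn_ge0// ph_norm_ge0. Qed.

Lemma ip_Cauchy_Schwarz x y : `|ip x y| <= ph_norm x * ph_norm y.
Proof.
have [y0|y0] := eqVneq (ip y y) 0.
  have /ph_norm_eq0 -> : ph_norm y = 0 by apply/eqP; rewrite -sqrf_eq0 ph_norm_sqr y0.
  by rewrite ip_herm ip0l rmorph0 normr0 mulr_ge0// ph_norm_ge0.
have ypos : 0 < ip y y by rewrite lt_def y0 ip_ge0.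
rewrite -(@ler_pXn2r _ 2)// ?nnegrE ?mulr_ge0 ?ph_norm_ge0// exprMn !ph_norm_sqr -theta_norm.
have := ip_ge0 (x + (- (ip x y / ip y y)) *: y).
have ryy : theta (ip y y) = ip y y by rewrite -ip_herm.
rewrite ipDl !ipDr !ipZl !ipZr [ip y x]ip_herm rmorphN rmorphM fmorphV ryy.
set a := ip x y; set b := theta a; set c := ip x x; set d := ip y y.
have -> : c + - (b / d) * a + (- (a / d) * b + - (a / d) * (- (b / d) * d)) = (c * d - a * b) / d.
  by field.
by rewrite pmulr_lge0 ?invr_gt0// subr_ge0.
Qed.

Lemma ph_normD x y : ph_norm (x + y) <= ph_norm x + ph_norm y.
Proof.
rewrite -(@ler_pXn2r _ 2)// ?nnegrE ?addr_ge0 ?ph_norm_ge0// sqrrD !ph_norm_sqr ipDl !ipDr.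
have real_cross : ip x y + ip y x \is Num.real.
  have -> : ip x y + ip y x = ip (x + y) (x + y) - ip x x - ip y y by rewrite ipDl !ipDr; ring.
  by rewrite !realB// ger0_real// ip_ge0.
rewrite addrA -[X in X + ip y y]addrA lerD2r lerD2l.
apply: (le_trans (real_ler_norm real_cross)); apply: (le_trans (ler_normD _ _)).
rewrite [ip y x]ip_herm theta_abs -mulr2n lerMn2r /=; exact: ip_Cauchy_Schwarz.
Qed.

Lemma ph_normZ a x : ph_norm (a *: x) = `|a| * ph_norm x.
Proof.
apply/eqP; rewrite -(@eqrXn2 _ 2)// ?mulr_ge0 ?ph_norm_ge0//.
by rewrite exprMn !ph_norm_sqr ipZl ipZr mulrA theta_norm.
Qed.

Definition hspace : Type := P.
HB.instance Definition _ := GRing.Lmodule.on hspace.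
HB.instance Definition _ := @Lmodule_isNormed.Build K hspace (@ph_norm P)
  ph_normD ph_normZ (@ph_norm_eq0 P).

Lemma hspace_complete (F : set_system hspace) : ProperFilter F -> cauchy F -> cvg F.
Proof.
move=> FF /cauchy_ballP cF.
have [e e0|l hl] := @ph_complete P F FF.
  have [[A B] /= [FA FB] AB] := cF e e0.
  exists (A `&` B); first exact: filterI.
  by move=> x y [Ax _] [_ By]; have := AB (x, y) (conj Ax By); rewrite -ball_normE.
by apply/cvg_ex; exists l; apply/cvgrPdist_lt => e e0; exact: hl.
Qed.

HB.instance Definition _ := Uniform_isComplete.Build hspace hspace_complete.

Definition hip (x y : hspace) : K := @ip P x y.

Lemma hip_bilinear : bilinear_for *%R (theta \; *%R) hip.
Proof. by split=> u a x y; [exact: ipPl|rewrite /hip ipDr ipZr]. Qed.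

HB.instance Definition _ := @bilinear_isBilinear.Build K hspace hspace K *%R (theta \; *%R) hip hip_bilinear.

Lemma hip_herm x y : hip x y = (-1) ^+ false * theta (hip y x).
Proof. by rewrite expr0 mul1r; exact: ip_herm. Qed.
HB.instance Definition _ := @isHermitianSesquilinear.Build K hspace false theta hip hip_herm.

Lemma hip_pos x : x != 0 -> 0 < hip x x.
Proof.
move=> x0; rewrite lt_def ip_ge0 andbT; apply: contra x0 => /eqP h.
by apply/eqP/ph_norm_eq0/eqP; rewrite -sqrf_eq0 ph_norm_sqr; apply/eqP.
Qed.
HB.instance Definition _ := @isDotProduct.Build K hspace hip hip_pos.

Lemma hip_norm (x : hspace) : `|x| ^+ 2 = hip x x.
Proof. exact: ph_norm_sqr. Qed.

Definition hilbert_of : hilbert theta :=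
  @Hilbert K theta hspace hip hip_norm.

End HilbertFromForm.

(** * Finite-dimensional real Hilbert spaces *)

Section RealHilbert.
Variables (R : realType) (T : finType).

Definition euclid_ip (x y : {ffun T -> R^o}) : R := \sum_t x t * y t.
Definition euclid_norm (x : {ffun T -> R^o}) : R := Num.sqrt (euclid_ip x x).

Lemma euclid_ip_ge0 x : 0 <= euclid_ip x x.
Proof. by apply: sumr_ge0 => t _; rewrite -expr2 sqr_ge0. Qed.

Lemma euclid_norm_sqr x : euclid_norm x ^+ 2 = euclid_ip x x.
Proof. by rewrite sqr_sqrtr// euclid_ip_ge0. Qed.

Lemma le_euclid_norm (x : {ffun T -> R^o}) t : `|x t| <= euclid_norm x.
Proof.
rewrite -(@ler_pXn2r _ 2)// ?nnegrE ?sqrtr_ge0// euclid_norm_sqr real_normK ?num_real//.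
by rewrite /euclid_ip (bigD1 t)//= -expr2 lerDl sumr_ge0// => s _; rewrite -expr2 sqr_ge0.
Qed.

Lemma euclid_norm_eq0 x : euclid_norm x = 0 -> x = 0.
Proof.
move=> x0; apply/ffunP => t; rewrite ffunE.
by apply/eqP; rewrite -normr_le0 -x0; exact: le_euclid_norm.
Qed.

Lemma euclid_ipPl (a : R) x y z : euclid_ip (a *: x + y) z = a * euclid_ip x z + euclid_ip y z.
Proof.
rewrite /euclid_ip mulr_sumr -big_split; apply: eq_bigr => t _.
by rewrite !ffunE mulrDl mulrA.
Qed.

Lemma euclid_ipC x y : euclid_ip x y = idfun (euclid_ip y x).
Proof. by apply: eq_bigr => t _; rewrite mulrC. Qed.

Lemma euclid_complete (F : set_system {ffun T -> R^o}) : ProperFilter F ->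
  (forall e : R, 0 < e -> exists2 A, F A & forall x y, A x -> A y -> euclid_norm (x - y) < e) ->
  exists l, forall e : R, 0 < e -> F [set x | euclid_norm (l - x) < e].
Proof.
move=> FF cF.
have cvt t : cvg ((fun x : {ffun T -> R^o} => x t : R^o) @ F).
  apply: cauchy_cvg; apply/cauchy_ballP => e e0; have [A FA hA] := cF e e0.
  exists ((fun x : {ffun T -> R^o} => x t) @` A, (fun x : {ffun T -> R^o} => x t) @` A).
    by split=> /=; apply: (@filterS _ F _ A) => // x Ax; exists x.
  move=> [_ _] [/= [x Ax <-] [y Ay <-]]; rewrite -ball_normE /=.
  by apply: le_lt_trans (hA _ _ Ax Ay); have := le_euclid_norm (x - y) t; rewrite !ffunE.
pose l : {ffun T -> R^o} := [ffun t => lim ((fun x : {ffun T -> R^o} => x t : R^o) @ F)].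
exists l => e e0.
have e1 : 0 < e ^+ 2 by rewrite exprn_gt0.
have cv : (fun x => euclid_ip (l - x) (l - x)) @ F --> (0 : R^o).
  have -> : (0 : R^o) = \sum_(t : T) ((0 : R^o) * 0) by rewrite big1// => t _; rewrite mulr0.
  apply: (@cvg_big _ _ +%R 0 xpredT add_continuous) => t _.
  have c1 : (fun x : {ffun T -> R^o} => (l - x) t : R^o) @ F --> (0 : R^o).
    rewrite -[X in _ --> X](subrr (l t)).
    have -> : (fun x : {ffun T -> R^o} => (l - x) t) = (fun x => l t - x t).
      by apply/funext => x; rewrite [LHS]ffunE; congr (_ + _); rewrite ffunE.
    apply: cvgB; first exact: cvg_cst.
    by rewrite ffunE; exact: cvt.
  exact: cvgM.
move/cvgrPdist_lt : cv => /(_ _ e1); apply: filterS => x /=.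
rewrite sub0r normrN ger0_norm ?euclid_ip_ge0// => h.
by rewrite -(@ltr_pXn2r _ 2)// ?nnegrE ?sqrtr_ge0 ?ltW// euclid_norm_sqr.
Qed.

Definition euclid_prehilbert : @prehilbert R (idfun : {rmorphism R -> R}) :=
  @Prehilbert R idfun {ffun T -> R^o} euclid_ip euclid_norm euclid_ipPl euclid_ipC
    (fun x => sqrtr_ge0 _) euclid_norm_sqr euclid_norm_eq0 euclid_complete.

Lemma mulr_idfun (a : R) : a * idfun a = `|a| ^+ 2.
Proof. by rewrite real_normK ?num_real. Qed.

Definition euclid_hilbert : real_hilbert R :=
  hilbert_of mulr_idfun (fun a => erefl) euclid_prehilbert.

End RealHilbert.

(** * Finite sums and series over words *)

Section WordSums.
Variable T : finType.

Section Nmod.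
Variable V : nmodType.
Implicit Types f g : seq T -> V.

(** Sum over all words of length less than [n], organized by first letter. *)
Fixpoint psum n f : V :=
  if n is n'.+1 then f [::] + \sum_t psum n' (fun w => f (t :: w)) else 0.

Lemma eq_psum n f g : f =1 g -> psum n f = psum n g.
Proof. by move=> /funext ->. Qed.

Lemma psum0 n : psum n (fun _ => 0) = 0.
Proof. by elim: n => //= n ->; rewrite big1 ?addr0. Qed.

Lemma psum_eq0 n f : (forall w, f w = 0) -> psum n f = 0.
Proof. by move=> /eq_psum ->; rewrite psum0. Qed.

Lemma psumD n f g : psum n (fun w => f w + g w) = psum n f + psum n g.
Proof.
elim: n f g => [|n ih] f g /=; first by rewrite addr0.
by rewrite addrACA -big_split; congr (_ + _); apply: eq_bigr => t _; rewrite ih.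
Qed.

Lemma psum_rcons n f :
  psum n.+1 f = f [::] + \sum_t psum n (fun w => f (rcons w t)).
Proof.
elim: n f => [|n ih] f //.
have -> : psum n.+2 f = f [::] + \sum_t psum n.+1 (fun w => f (t :: w)) by [].
congr (_ + _); rewrite (eq_bigr _ (fun t _ => ih _)) /= !big_split /=; congr (_ + _).
by rewrite exchange_big.
Qed.

Lemma psum_rev n f : psum n (fun w => f (rev w)) = psum n f.
Proof.
elim: n f => [|n ih] f //; rewrite [RHS]psum_rcons /=; congr (_ + _).
apply: eq_bigr => t _; rewrite -(ih (fun w => f (rcons w t))).
by apply: eq_psum => w; rewrite rev_cons.
Qed.

Lemma psum_stable n m f : (forall w, (n <= size w)%N -> f w = 0) -> (n <= m)%N ->
  psum m f = psum n f.
Proof.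
elim: n m f => [|n ih] m f f0 nm.
  by rewrite psum_eq0// => w; rewrite f0.
case: m nm => //= m nm; congr (_ + _); apply: eq_bigr => t _.
by apply: ih => // w nw; rewrite f0.
Qed.

Lemma psum_pick n v f : (forall w, w != v -> f w = 0) -> (size v < n)%N -> psum n f = f v.
Proof.
elim: v n f => [|t v ih] [|n] f //= fv vn.
  rewrite big1 ?addr0// => t _.
  by rewrite psum_eq0// => w; rewrite fv.
rewrite fv// add0r (bigD1 t)//= ih ?big1 ?addr0//.
  move=> s st; rewrite psum_eq0// => w; rewrite fv//.
  by apply: contra st => /eqP[->].
by move=> w wv; rewrite fv// eqseq_cons eqxx.
Qed.

End Nmod.

Lemma psum_morph (V W : nmodType) (h : V -> W) n f : h 0 = 0 -> {morph h : x y / x + y} ->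
  h (psum n f) = psum n (fun w => h (f w)).
Proof.
move=> h0 hD; elim: n f => [|n ih] f //=; rewrite hD (big_morph h hD h0).
by congr (_ + _); apply: eq_bigr => t _; rewrite ih.
Qed.

Lemma psumZ (K : pzRingType) (V : lmodType K) (a : K) n (f : seq T -> V) :
  psum n (fun w => a *: f w) = a *: psum n f.
Proof. by rewrite (psum_morph _ _ (scaler0 V a) (scalerDr a)). Qed.

Section Real.
Variable R : realType.
Implicit Types f g : seq T -> R.

Lemma ler_psum n f g : (forall w, f w <= g w) -> psum n f <= psum n g.
Proof.
elim: n f g => [|n ih] f g fg //=; rewrite lerD// ler_sum// => t _; exact: ih.
Qed.

Lemma psum_ge0 n f : (forall w, 0 <= f w) -> 0 <= psum n f.
Proof. by move=> f0; rewrite -(psum0 R n) ler_psum. Qed.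

Lemma psum_nondecreasing n m f : (forall w, 0 <= f w) -> (n <= m)%N -> psum n f <= psum m f.
Proof.
elim: n m f => [|n ih] m f f0 nm; first exact: psum_ge0.
case: m nm => //= m nm; rewrite lerD2l ler_sum// => t _; exact: ih.
Qed.

Lemma le_psum v f : (forall w, 0 <= f w) -> f v <= psum (size v).+1 f.
Proof.
move=> f0; pose g w := if w == v then f w else 0.
have <- : psum (size v).+1 g = f v.
  by rewrite (psum_pick (v := v))// /g ?eqxx// => w /negbTE ->.
by apply: ler_psum => w; rewrite /g; case: eqP.
Qed.

End Real.

End WordSums.

Section WordSeries.
Variables (T : finType) (R : realType).
Implicit Types f g : seq T -> R.

Definition summable_words f := exists M, forall n, psum n (fun w => `|f w|) <= M.

Definition tot f : R := limn (fun n => psum n f).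

Lemma is_cvg_psum_ge0 f M : (forall w, 0 <= f w) -> (forall n, psum n f <= M) ->
  cvgn (fun n => psum n f).
Proof.
move=> f0 fM; apply: nondecreasing_is_cvgn.
  by move=> n m nm; exact: psum_nondecreasing.
by exists M => _ [n _ <-].
Qed.

(** Write [f = (f + |f|) - |f|], a difference of non-negative functions, whose partial sums
    increase. *)
Lemma cvg_psum f : summable_words f -> psum n f @[n --> \oo] --> tot f.
Proof.
move=> [M fM].
have -> : (fun n => psum n f) = (fun n => psum n (fun w => f w + `|f w|)) - (fun n => psum n (fun w => `|f w|)).
  by apply/funext => n; rewrite /GRing.add /GRing.opp /= psumD addrK.
have c1 : cvgn (fun n => psum n (fun w => f w + `|f w|)).
  apply: (@is_cvg_psum_ge0 _ (M + M)).
    by move=> w; rewrite -lerBlDl sub0r -normrN ler_norm.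
  move=> n; rewrite psumD lerD// (le_trans _ (fM n))// ler_psum// => w; exact: ler_norm.
have c2 : cvgn (fun n => psum n (fun w => `|f w|)) by exact: is_cvg_psum_ge0 fM.
rewrite /tot -/(psum _ f).
have -> : (fun n => psum n f) = (fun n => psum n (fun w => f w + `|f w|)) - (fun n => psum n (fun w => `|f w|)).
  by apply/funext => n; rewrite /GRing.add /GRing.opp /= psumD addrK.
exact: is_cvgB.
Qed.

Lemma psum_le_tot f n : summable_words f -> (forall w, 0 <= f w) -> psum n f <= tot f.
Proof.
move=> sf f0; apply: nondecreasing_cvgn_le; last by apply/cvg_ex; exists (tot f); exact: cvg_psum.
by move=> k l kl; exact: psum_nondecreasing.
Qed.

Lemma tot_le f M : summable_words f -> (forall n, psum n f <= M) -> tot f <= M.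
Proof.
move=> sf fM; apply: limr_le; first by apply/cvg_ex; exists (tot f); exact: cvg_psum.
by apply: nearW.
Qed.

Lemma le_tot f w : summable_words f -> (forall w, 0 <= f w) -> f w <= tot f.
Proof. by move=> sf f0; rewrite (le_trans (le_psum w f0))// psum_le_tot. Qed.

Lemma summableP a f g : summable_words f -> summable_words g ->
  summable_words (fun w => a * f w + g w).
Proof.
move=> [M fM] [L gL]; exists (`|a| * M + L) => n.
apply: (@le_trans _ _ (psum n (fun w => `|a| *: (`|f w| : R^o) + `|g w|))).
  by apply: ler_psum => w; rewrite (le_trans (ler_normD _ _))// normrM.
by rewrite psumD lerD// psumZ ler_wpM2l.
Qed.

Lemma totP a f g : summable_words f -> summable_words g ->
  tot (fun w => a * f w + g w) = a * tot f + tot g.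
Proof.
move=> sf sg; apply/cvg_lim => //.
under eq_cvg do rewrite psumD (psumZ (V := R^o) a).
by apply: cvgD; [apply: cvgMr; exact: cvg_psum|exact: cvg_psum].
Qed.

Lemma summable_shift t f : summable_words f -> summable_words (fun w => f (t :: w)).
Proof.
move=> [M fM]; exists M => n; apply: le_trans (fM n.+1) => /=.
rewrite (bigD1 t)//= addrCA lerDl addr_ge0// sumr_ge0// => s _; exact: psum_ge0.
Qed.

Lemma tot_shift f : summable_words f -> tot f = f [::] + \sum_t tot (fun w => f (t :: w)).
Proof.
move=> sf; apply/cvg_lim => //; rewrite -(cvg_shiftS (fun n => psum n f)) /=.
apply: cvgD; first exact: cvg_cst.
by apply: (@cvg_big _ _ +%R 0 xpredT add_continuous) => t _; apply: cvg_psum; exact: summable_shift.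
Qed.

Lemma totN f : summable_words f -> tot (fun w => - f w) = - tot f.
Proof.
move=> sf; apply/cvg_lim => //.
under eq_cvg do rewrite -(psum_morph _ _ (oppr0 R) (@opprD R)).
by apply: cvgN; exact: cvg_psum.
Qed.

Lemma tot_rev f : tot (fun w => f (rev w)) = tot f.
Proof. by congr (limn _); apply/funext => n; rewrite psum_rev. Qed.

Lemma summable_le f g : summable_words g -> (forall w, `|f w| <= g w) -> summable_words f.
Proof.
move=> [M gM] fg; exists M => n; rewrite (le_trans _ (gM n))// ler_psum// => w.
by rewrite (le_trans (fg w))// ler_norm.
Qed.

End WordSeries.

Section ComplexWordSeries.
Variables (T : finType) (R : realType).
Implicit Types f g : seq T -> R[i].

Definition csummable f := summable_words (fun w => normc (f w)).
Definition ctot f : R[i] := tot (fun w => complex.Re (f w)) +i* tot (fun w => complex.Im (f w)).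

Lemma ler_Re_normc (x : R[i]) : `|complex.Re x| <= normc x.
Proof.
case: x => a b /=; by rewrite -sqrtr_sqr ler_wsqrtr// lerDl sqr_ge0.
Qed.

Lemma ler_Im_normc (x : R[i]) : `|complex.Im x| <= normc x.
Proof.
case: x => a b /=; by rewrite -sqrtr_sqr ler_wsqrtr// lerDr sqr_ge0.
Qed.

Lemma csummable_Re f : csummable f -> summable_words (fun w => complex.Re (f w)).
Proof. by move=> sf; apply: summable_le sf _ => w; exact: ler_Re_normc. Qed.

Lemma csummable_Im f : csummable f -> summable_words (fun w => complex.Im (f w)).
Proof. by move=> sf; apply: summable_le sf _ => w; exact: ler_Im_normc. Qed.

Lemma ctotP a f g : csummable f -> csummable g ->
  ctot (fun w => a * f w + g w) = a * ctot f + ctot g.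
Proof.
move=> sf sg; have := (csummable_Re sf, csummable_Im sf, csummable_Re sg, csummable_Im sg).
case=> [[[rf mf] rg] mg]; case: a => x y.
rewrite /ctot.
have -> : (fun w => complex.Re ((x +i* y) * f w + g w)) =
    (fun w => x * complex.Re (f w) + ((- y) * complex.Im (f w) + complex.Re (g w))).
  by apply/funext => w; case: (f w) (g w) => [a b] [c d] /=; ring.
have -> : (fun w => complex.Im ((x +i* y) * f w + g w)) =
    (fun w => x * complex.Im (f w) + (y * complex.Re (f w) + complex.Im (g w))).
  by apply/funext => w; case: (f w) (g w) => [a b] [c d] /=; ring.
rewrite !totP//; try exact: summableP.
by apply/eqP; rewrite eq_complex /=; apply/andP; split; apply/eqP; ring.
Qed.

Lemma ctot_shift f : csummable f -> ctot f = f [::] + \sum_t ctot (fun w => f (t :: w)).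
Proof.
move=> sf; rewrite /ctot (tot_shift (csummable_Re sf)) (tot_shift (csummable_Im sf)).
have -> : \sum_t (tot (fun w => complex.Re (f (t :: w))) +i* tot (fun w => complex.Im (f (t :: w)))) =
  (\sum_t tot (fun w => complex.Re (f (t :: w)))) +i* (\sum_t tot (fun w => complex.Im (f (t :: w)))).
  by elim/big_rec3 : _ => [|t x y z _ ->]//; case: x.
by case: (f [::]).
Qed.

Lemma ctot_rev f : ctot (fun w => f (rev w)) = ctot f.
Proof.
by rewrite /ctot (tot_rev (fun w => complex.Re (f w))) (tot_rev (fun w => complex.Im (f w))).
Qed.

Lemma ctot_conj f : csummable f -> ctot (fun w => (f w)^*) = (ctot f)^*.
Proof.
move=> sf; rewrite /ctot /=; congr (_ +i* _).
  by congr (tot _); apply/funext => w; case: (f w).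
rewrite -totN; last exact: csummable_Im.
by congr (tot _); apply/funext => w; case: (f w).
Qed.

End ComplexWordSeries.

Lemma cvg_psum_pointwise (T : finType) (R : realType) (X : Type) (F : set_system X) n
    (u : X -> seq T -> R) (v : seq T -> R) : Filter F ->
  (forall w, u x w @[x --> F] --> v w) -> psum n (u x) @[x --> F] --> psum n v.
Proof.
move=> FF; elim: n u v => [|n ih] u v huv /=; first exact: cvg_cst.
apply: cvgD => //; apply: (@cvg_big _ _ +%R 0 xpredT add_continuous) => t _.
by apply: (ih (fun x w => u x (t :: w)) (fun w => v (t :: w))) => w; exact: huv.
Qed.

Lemma normcN (R : realType) (x : R[i]) : normc (- x) = normc x.
Proof. by case: x => a b /=; rewrite !sqrrN. Qed.

(** * The Hilbert space of square summable functions on words *)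

Section SquareSummable.
Variables (T : finType) (R : realType).
Implicit Types f g : seq T -> R[i]^o.

Definition square_summable f := exists M, forall n, psum n (fun w => normc (f w) ^+ 2) <= M.

Lemma square_summable_conj f g : square_summable f -> square_summable g ->
  csummable (fun w => f w * (g w)^*).
Proof.
move=> [M fM] [L gL]; exists (M + L) => n; rewrite (le_trans _ (lerD (fM n) (gL n)))//.
rewrite -psumD ler_psum// => w; rewrite ger0_norm ?normc_ge0// ComplexField.Normc.normcM normc_conj.
have := normc_ge0 (f w); have := normc_ge0 (g w); set a := normc _; set b := normc _ => a0 b0.
have := sqr_ge0 (b - a); nra.
Qed.

Lemma square_summable_summable f : square_summable f -> summable_words (fun w => normc (f w) ^+ 2).
Proof.
by move=> [M fM]; exists M => n; under eq_psum do rewrite ger0_norm ?sqr_ge0//; exact: fM.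
Qed.

Lemma normc_sqr_le (a x y : R[i]) :
  normc (a * x + y) ^+ 2 <= 2 * normc a ^+ 2 * normc x ^+ 2 + 2 * normc y ^+ 2.
Proof.
have := normc_leD (a * x) y; rewrite ComplexField.Normc.normcM.
have := normc_ge0 (a * x + y); have := normc_ge0 a; have := normc_ge0 x; have := normc_ge0 y.
set p := normc a; set q := normc x; set r := normc y; set s := normc _ => r0 q0 p0 s0 h.
apply: (@le_trans _ _ ((p * q + r) ^+ 2)); first by rewrite ler_pXn2r// ?nnegrE// addr_ge0// mulr_ge0.
have := sqr_ge0 (p * q - r); nra.
Qed.

Definition l2_pred : {pred seq T -> R[i]^o} := fun f => `[<square_summable f>].

Lemma l2_submod : GRing.submod_closed l2_pred.
Proof.
split=> [|a f g /asboolP [M fM] /asboolP [L gL]]; apply/asboolP.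
  exists 0 => n; rewrite psum_eq0// => w; rewrite [_ w]/(0 : R[i]).
  by rewrite ComplexField.Normc.normc0 expr0n.
exists (2 * normc a ^+ 2 * M + 2 * L) => n.
apply: (@le_trans _ _ (psum n (fun w => (2 * normc a ^+ 2) *: (normc (f w) ^+ 2 : R^o) + (2 : R) *: (normc (g w) ^+ 2 : R^o)))).
  by apply: ler_psum => w; exact: normc_sqr_le.
rewrite psumD !psumZ lerD// ler_wpM2l//; first by rewrite mulr_ge0// sqr_ge0.
Qed.

HB.instance Definition _ := GRing.isSubmodClosed.Build R[i] (seq T -> R[i]^o) l2_pred l2_submod.

(** Coordinates of a vector of the full Fock space in the tensor basis indexed by words over [T]. *)
Record l2seq := L2seq { l2val :> seq T -> R[i]^o ; l2valP : l2val \in l2_pred }.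
HB.instance Definition _ := [isSub for l2val].
HB.instance Definition _ := [Choice of l2seq by <:].
HB.instance Definition _ := [SubChoice_isSubLmodule of l2seq by <:].

Implicit Types x y z : l2seq.

Lemma l2P x : square_summable x.
Proof. exact/asboolP/l2valP. Qed.

Lemma l2PE a x y w : (a *: x + y) w = a * x w + y w.
Proof. by []. Qed.

Lemma l2eqP x y : (forall w, x w = y w) -> x = y.
Proof. by move=> xy; apply/val_inj/funext. Qed.

Definition l2ip x y : R[i] := ctot (fun w => x w * (y w)^*).
Definition l2norm_sqr x : R := tot (fun w => normc (x w) ^+ 2).
Definition l2nm x : R := Num.sqrt (l2norm_sqr x).

Lemma l2norm_sqr_ge0 x : 0 <= l2norm_sqr x.
Proof.
rewrite /l2norm_sqr; apply: (le_trans _ (le_tot [::] (square_summable_summable (l2P x)) _)) => [|w]; exact: sqr_ge0.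
Qed.

Lemma l2ipPl a x y z : l2ip (a *: x + y) z = a * l2ip x z + l2ip y z.
Proof.
rewrite -ctotP; try exact: square_summable_conj (l2P _) (l2P _).
by congr (ctot _); apply/funext => w; rewrite l2PE mulrDl mulrA.
Qed.

Lemma l2ip_herm x y : l2ip x y = (l2ip y x)^*.
Proof.
rewrite -ctot_conj; last exact: square_summable_conj (l2P _) (l2P _).
by congr (ctot _); apply/funext => w; rewrite rmorphM /= conjcK mulrC.
Qed.

Lemma l2ip_norm x : l2ip x x = (l2norm_sqr x)%:C.
Proof.
rewrite /l2ip; under [X in ctot X]eq_fun do rewrite -normc_sqr.
rewrite /ctot /=; congr (_ +i* _).
by apply/cvg_lim => //; under eq_cvg do rewrite psum0; exact: cvg_cst.
Qed.

Lemma le_l2nm x w : normc (x w) <= l2nm x.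
Proof.
rewrite -(@ler_pXn2r _ 2)// ?nnegrE ?normc_ge0 ?sqrtr_ge0// sqr_sqrtr ?l2norm_sqr_ge0//.
by apply: (le_tot w (square_summable_summable (l2P x))) => v; exact: sqr_ge0.
Qed.

Lemma l2nm_eq0 x : l2nm x = 0 -> x = 0.
Proof.
move=> x0; apply: l2eqP => w; apply: ComplexField.Normc.eq0_normc.
by apply/eqP; rewrite eq_le normc_ge0 andbT -x0; exact: le_l2nm.
Qed.

(** Coordinates converge. The Cauchy estimate bounds finite partial sums, passes to the limit in
    them, and so bounds the full sum; this shows both that the limit is square summable and that the
    convergence is in norm. *)
Lemma l2_complete (F : set_system l2seq) : ProperFilter F ->
  (forall e : R, 0 < e -> exists2 A, F A & forall x y, A x -> A y -> l2nm (x - y) < e) ->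
  exists l, forall e : R, 0 < e -> F [set x | l2nm (l - x) < e].
Proof.
move=> FF cF.
have cvw (p : R[i] -> R) w : (forall a b, p (a - b) = p a - p b) -> (forall a, `|p a| <= normc a) ->
    cvg ((fun x : l2seq => p (x w) : R^o) @ F).
  move=> pB ple; apply: cauchy_cvg; apply/cauchy_ballP => e e0; have [A FA hA] := cF e e0.
  exists ((fun x : l2seq => p (x w)) @` A, (fun x : l2seq => p (x w)) @` A).
    by split=> /=; apply: (@filterS _ F _ A) => // x Ax; exists x.
  move=> [_ _] [/= [x Ax <-] [y Ay <-]]; rewrite -ball_normE /= -pB.
  by apply: le_lt_trans (hA _ _ Ax Ay); rewrite (le_trans (ple _))//; exact: (le_l2nm (x - y) w).
have cRe w : cvg ((fun x : l2seq => complex.Re (x w) : R^o) @ F).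
  by apply: cvw => [[a b] [c d]//|a]; exact: ler_Re_normc.
have cIm w : cvg ((fun x : l2seq => complex.Im (x w) : R^o) @ F).
  by apply: cvw => [[a b] [c d]//|a]; exact: ler_Im_normc.
pose g w : R[i] := lim ((fun x : l2seq => complex.Re (x w) : R^o) @ F) +i*
                   lim ((fun x : l2seq => complex.Im (x w) : R^o) @ F).
have cvd (x : l2seq) w : (fun y : l2seq => normc (x w - y w) ^+ 2 : R^o) @ F --> (normc (x w - g w) ^+ 2 : R^o).
  have nE (a b : R[i]) : normc (a - b) ^+ 2 = (complex.Re a - complex.Re b) * (complex.Re a - complex.Re b) + (complex.Im a - complex.Im b) * (complex.Im a - complex.Im b).
    by case: a b => [a b] [c d] /=; rewrite sqr_sqrtr ?addr_ge0 ?sqr_ge0// !expr2.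
  rewrite nE; under eq_cvg do rewrite nE.
  by apply: cvgD; apply: cvgM; apply: cvgB; (try exact: cvg_cst); [exact: cRe|exact: cRe|exact: cIm|exact: cIm].
have cvp (x : l2seq) n : (fun y : l2seq => psum n (fun w => normc (x w - y w) ^+ 2) : R^o) @ F -->
    (psum n (fun w => normc (x w - g w) ^+ 2) : R^o).
  by apply: (@cvg_psum_pointwise _ _ _ F _ (fun y w => normc (x w - y w) ^+ 2)) => w; exact: cvd.
have near_g e : 0 < e -> exists2 A, F A & forall (x : l2seq), A x -> forall n,
    psum n (fun w => normc (x w - g w) ^+ 2) <= e ^+ 2.
  move=> e0; have [A FA hA] := cF e e0; exists A => // x Ax n.
  apply: (cvgr_to_le (cvp x n)); apply: filterS FA => y Ay /=.
  have : l2nm (x - y) ^+ 2 <= e ^+ 2.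
    by rewrite ler_pXn2r// ?nnegrE ?sqrtr_ge0 ?(ltW e0)// ltW// hA.
  rewrite sqr_sqrtr ?l2norm_sqr_ge0//; apply: le_trans.
  by apply: (psum_le_tot n (square_summable_summable (l2P (x - y)))) => w; exact: sqr_ge0.
have sg : square_summable g.
  have [A FA hA] := near_g 1 ltr01; have [x Ax] := filter_ex FA.
  have [M xM] := l2P x; exists (2 * normc (-1 : R[i]) ^+ 2 * 1 ^+ 2 + 2 * M) => n.
  apply: (@le_trans _ _ (psum n (fun w => (2 * normc (-1 : R[i]) ^+ 2) *: (normc (x w - g w) ^+ 2 : R^o) + (2 : R) *: (normc (x w) ^+ 2 : R^o)))).
    apply: ler_psum => w; have := normc_sqr_le (-1) (x w - g w) (x w).
    by rewrite mulN1r opprB subrK.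
  rewrite psumD !psumZ lerD// ler_wpM2l//; last exact: hA.
  by rewrite mulr_ge0// sqr_ge0.
pose l := L2seq (asboolT sg : g \in l2_pred).
exists l => e e0; have e2 : 0 < e / 2 by rewrite divr_gt0.
have [A FA hA] := near_g _ e2; apply: filterS FA => x Ax /=.
apply: (@le_lt_trans _ _ (e / 2)); last by rewrite ltr_pdivrMr// ltr_pMr// ltr1n.
rewrite -(@ler_pXn2r _ 2)// ?nnegrE ?sqrtr_ge0 ?(ltW e2)// sqr_sqrtr ?l2norm_sqr_ge0//.
apply: tot_le; first exact: square_summable_summable (l2P _).
move=> n; rewrite (le_trans _ (hA x Ax n))// ler_psum// => w.
rewrite -[X in X ^+ 2]/(normc (g w - x w)) -[X in normc X]opprB.
by rewrite normcN.
Qed.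

End SquareSummable.

Section FockHilbert.
Variables (T : finType) (R : realType).
Implicit Types x y : l2seq T R.

Definition l2cnm x : R[i] := (l2nm x)%:C.

Lemma l2cnm_complete (F : set_system (l2seq T R)) : ProperFilter F ->
  (forall e : R[i], 0 < e -> exists2 A, F A & forall x y, A x -> A y -> l2cnm (x - y) < e) ->
  exists l, forall e : R[i], 0 < e -> F [set x | l2cnm (l - x) < e].
Proof.
move=> FF cF; have [e e0|l hl] := @l2_complete T R F FF.
  have [|A FA hA] := cF e%:C; first by rewrite ltcR.
  by exists A => // x y Ax Ay; have := hA x y Ax Ay; rewrite ltcR.
exists l => e e0; have /complex_realP[r er] : e \is Num.real by rewrite gtr0_real.
rewrite er ltcR in e0 *; apply: filterS (hl r e0) => x /=.
by rewrite ltcR.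
Qed.

Lemma l2cnm_ge0 x : 0 <= l2cnm x.
Proof. by rewrite lecR sqrtr_ge0. Qed.

Lemma l2cnm_sqr x : l2cnm x ^+ 2 = l2ip x x.
Proof. by rewrite l2ip_norm -rmorphXn /= sqr_sqrtr// l2norm_sqr_ge0. Qed.

Lemma l2cnm_eq0 x : l2cnm x = 0 -> x = 0.
Proof. by move=> /complexI; exact: l2nm_eq0. Qed.

Definition fock_prehilbert : @prehilbert R[i] (@conjc R) :=
  @Prehilbert R[i] (@conjc R) (l2seq T R) (@l2ip T R) l2cnm (@l2ipPl T R) (@l2ip_herm T R)
    l2cnm_ge0 l2cnm_sqr l2cnm_eq0 l2cnm_complete.

Lemma mulr_conjc (a : R[i]) : a * a^* = `|a| ^+ 2.
Proof. by rewrite -normc_sqr rmorphXn. Qed.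

Lemma norm_conjc (a : R[i]) : `|a^*| = `|a|.
Proof. by rewrite normc_def [in RHS]normc_def; case: a => a b /=; rewrite sqrrN. Qed.

Definition fock_hilbert : complex_hilbert R :=
  hilbert_of mulr_conjc norm_conjc fock_prehilbert.

End FockHilbert.

(** * Arbitrary complex Hilbert spaces *)

Section HilbertFacts.
Variables (R : realType) (F : complex_hilbert R).
Implicit Types x y z : F.

Lemma innerPl a x y z : inner F (a *: x + y) z = a * inner F x z + inner F y z.
Proof. exact: linearPl. Qed.

Lemma inner_herm x y : inner F x y = conjc (inner F y x).
Proof. by have := @hermC _ false (@conjc R) _ (inner F) x y; rewrite expr0 mul1r. Qed.

Lemma inner0l y : inner F 0 y = 0.
Proof. exact: linear0l. Qed.

Lemma innerDl x y z : inner F (x + y) z = inner F x z + inner F y z.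
Proof. exact: linearDl. Qed.

Lemma innerZl a x z : inner F (a *: x) z = a * inner F x z.
Proof. by rewrite -[a *: x]addr0 innerPl inner0l addr0. Qed.

Lemma innerBl x y z : inner F (x - y) z = inner F x z - inner F y z.
Proof. by rewrite -scaleN1r innerDl innerZl mulN1r. Qed.

Lemma inner0r y : inner F y 0 = 0.
Proof. by rewrite inner_herm inner0l conjc0. Qed.

Lemma innerDr x y z : inner F z (x + y) = inner F z x + inner F z y.
Proof. by rewrite inner_herm innerDl rmorphD /= -!inner_herm. Qed.

Lemma innerZr a x z : inner F z (a *: x) = conjc a * inner F z x.
Proof. by rewrite inner_herm innerZl rmorphM /= -inner_herm. Qed.

Lemma innerBr x y z : inner F z (x - y) = inner F z x - inner F z y.
Proof. by rewrite inner_herm innerBl rmorphB /= -!inner_herm. Qed.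

Lemma hilbert_eqP x y : (forall z, inner F x z = inner F y z) -> x = y.
Proof.
move=> xy; apply/eqP; rewrite -subr_eq0 -normr_eq0 -sqrf_eq0 inner_norm.
by rewrite innerBl xy subrr.
Qed.

Definition nrm x : R := complex.Re `|x|.

Lemma nrmE x : (nrm x)%:C = `|x|.
Proof. by rewrite RRe_real// ger0_real. Qed.

Lemma nrm_ge0 x : 0 <= nrm x.
Proof. by rewrite -lecR nrmE normr_ge0. Qed.

Lemma nrm_sqr x : (nrm x ^+ 2)%:C = inner F x x.
Proof. by rewrite rmorphXn /= nrmE inner_norm. Qed.

Lemma nrmD x y : nrm (x + y) <= nrm x + nrm y.
Proof. by rewrite -lecR rmorphD /= !nrmE ler_normD. Qed.

Lemma nrmZ a x : nrm (a *: x) = normc a * nrm x.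
Proof. by apply: complexI; rewrite rmorphM /= !nrmE normrZ. Qed.

Lemma nrmN x : nrm (- x) = nrm x.
Proof. by apply: complexI; rewrite !nrmE normrN. Qed.

Lemma nrm_distC x y : nrm (x - y) = nrm (y - x).
Proof. by rewrite -nrmN opprB. Qed.

Lemma nrm0 : nrm (0 : F) = 0.
Proof. by rewrite /nrm normr0. Qed.

Lemma nrm0_eq0 x : nrm x = 0 -> x = 0.
Proof. by move=> x0; apply/eqP; rewrite -normr_eq0 -nrmE x0. Qed.

Lemma Cauchy_Schwarz x y : normc (inner F x y) <= nrm x * nrm y.
Proof.
have [->|y0] := eqVneq y 0; first by rewrite inner0r ComplexField.Normc.normc0 nrm0 mulr0.
have ny : 0 < nrm y by rewrite lt_def nrm_ge0 andbT; apply: contra y0 => /eqP/nrm0_eq0 ->.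
(* The component of [x] orthogonal to [y], scaled by [|y|^2] to avoid a division. *)
have := nrm_sqr ((nrm y ^+ 2)%:C *: x - inner F x y *: y).
rewrite innerBl !innerBr !innerZl !innerZr [inner F y x]inner_herm -(nrm_sqr x) -(nrm_sqr y).
have nc : conjc (nrm y ^+ 2)%:C = (nrm y ^+ 2)%:C by exact: conjc_real.
rewrite !nc; set b := inner F x y; set n2 := nrm y ^+ 2 => h.
have n20 : 0 < n2 by rewrite exprn_gt0.
have : (nrm (n2%:C *: x - b *: y) ^+ 2)%:C = (n2 * (nrm x ^+ 2 * n2 - normc b ^+ 2))%:C.
  have E (p q r : R) : (p * (q * p - r))%:C = p%:C * (q%:C * p%:C - r%:C).
    by rewrite rmorphM rmorphB rmorphM.
  by rewrite h E normc_sqr; ring.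
move=> /complexI h2; have : 0 <= n2 * (nrm x ^+ 2 * n2 - normc b ^+ 2).
  by rewrite -h2 sqr_ge0.
by rewrite pmulr_rge0// subr_ge0 -exprMn ler_pXn2r// ?nnegrE ?normc_ge0// mulr_ge0 ?nrm_ge0.
Qed.

Lemma nrm_le x M : 0 <= M -> nrm x ^+ 2 <= M * nrm x -> nrm x <= M.
Proof.
move=> M0; have [x0|x0] := ltP 0 (nrm x); first by rewrite expr2 ler_pM2r.
by rewrite (le_trans x0).
Qed.

Lemma Cauchy_seq_cvg (u : nat -> F) :
  (forall eps : R, 0 < eps -> exists N, forall i j, (N <= i)%N -> (N <= j)%N -> nrm (u i - u j) < eps) ->
  exists l, forall eps : R, 0 < eps -> exists N, forall i, (N <= i)%N -> nrm (u i - l) < eps.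
Proof.
move=> cu; have : cvg (u @ \oo).
  apply: cauchy_cvg; apply/cauchy_ballP => e e0.
  have /complex_realP[r er] : e \is Num.real by rewrite gtr0_real.
  rewrite er ltcR in e0 *; have [N hN] := cu r e0.
  exists (u @` [set i | (N <= i)%N], u @` [set i | (N <= i)%N]).
    by split; exists N => // i Ni; exists i.
  move=> [_ _] [/= [i Ni <-] [j Nj <-]].
  by rewrite -ball_normE /= -nrmE ltcR hN.
move=> /cvg_ex[l hl]; exists l => e e0.
have e0' : 0 < e%:C by rewrite ltcR.
move/cvgrPdist_lt : hl => /(_ _ e0') [N _ hN]; exists N => i Ni.
by rewrite nrm_distC -ltcR nrmE; exact: hN.
Qed.

Lemma closure_nrm (A : set F) x : (forall r : R, 0 < r -> exists2 y, A y & nrm (x - y) < r) ->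
  closure A x.
Proof.
move=> xA U /nbhs_normP[e /= e0 hU].
have /complex_realP[r er] : e \is Num.real by rewrite gtr0_real.
rewrite er ltcR in e0; have [y Ay xy] := xA r e0; exists y; split => //.
by apply: hU; rewrite /ball_ /= -nrmE er ltcR.
Qed.

End HilbertFacts.

(** * Bounded operators with adjoints *)

Section BoundedOperators.
Variables (R : realType) (F : complex_hilbert R).
Implicit Types x y z : F.

(** Storing the adjoint makes the involution a swap. The adjoint relation forces linearity ([bfP])
    and determines the adjoint ([bopP]). *)
Record bop := Bop {
  bf :> F -> F ;
  bfa : F -> F ;
  bf_adj : forall x y, inner F (bf x) y = inner F x (bfa y) ;
  bf_bound : exists M : R, forall x, nrm (bf x) <= M * nrm x }.
Implicit Types a b c : bop.

Lemma bopP a b : (forall x, a x = b x) -> a = b.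
Proof.
case: a b => [f fa fadj fb] [g ga gadj gb] /= /funext fg; move: fadj fb; rewrite {f}fg => fadj fb.
have fga : fa = ga.
  apply/funext => y; apply: hilbert_eqP => x.
  by rewrite inner_herm -fadj gadj -inner_herm.
by move: fadj; rewrite fga => fadj; congr Bop; exact: Prop_irrelevance.
Qed.

Lemma bfP a (k : R[i]) x y : a (k *: x + y) = k *: a x + a y.
Proof. by apply: hilbert_eqP => z; rewrite bf_adj !innerPl -!bf_adj. Qed.

HB.instance Definition _ a := GRing.isLinear.Build R[i] F F *:%R (bf a) (fun k => bfP a k).

Lemma bf_bound_pos a : exists2 M : R, 0 <= M & forall x, nrm (a x) <= M * nrm x.
Proof.
have [M aM] := bf_bound a; exists `|M| => // x.
by rewrite (le_trans (aM x))// ler_wpM2r ?nrm_ge0// ler_norm.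
Qed.

Lemma bop_continuous a : continuous (a : F -> F).
Proof.
move=> x; apply/cvgrPdist_lt => e e0.
have /complex_realP[r er] : e \is Num.real by rewrite gtr0_real.
rewrite er ltcR in e0 *; have [M M0 aM] := bf_bound_pos a.
have M1 : 0 < M + 1 by rewrite ltr_wpDl.
have d0 : 0 < (r / (M + 1))%:C by rewrite ltcR divr_gt0.
near=> y; rewrite -linearB -nrmE ltcR (le_lt_trans (aM _))//.
have : nrm (x - y) < r / (M + 1).
  by rewrite -ltcR nrmE; near: y; apply: cvgr_dist_lt.
rewrite ltr_pdivlMr// mulrDr mulr1 [_ * M]mulrC; apply: le_lt_trans.
by rewrite lerDl nrm_ge0.
Unshelve. all: by end_near. Qed.

Lemma bfa_le a M : 0 <= M -> (forall x, nrm (a x) <= M * nrm x) -> forall x, nrm (bfa a x) <= M * nrm x.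
Proof.
move=> M0 aM y; apply: nrm_le; first by rewrite mulr_ge0// nrm_ge0.
have -> : nrm (bfa a y) ^+ 2 = normc (inner F (a (bfa a y)) y).
  by rewrite bf_adj -nrm_sqr normc_real// sqr_ge0.
rewrite (le_trans (Cauchy_Schwarz _ _))// -mulrA [nrm y * _]mulrC mulrA.
by rewrite ler_wpM2r ?nrm_ge0.
Qed.

Lemma bfa_bound a : exists M : R, forall x, nrm (bfa a x) <= M * nrm x.
Proof. by have [M M0 aM] := bf_bound_pos a; exists M; exact: bfa_le. Qed.

Lemma bfa_adj a x y : inner F (bfa a x) y = inner F x (a y).
Proof. by rewrite inner_herm -bf_adj -inner_herm. Qed.

Definition bop_star a := Bop (bfa_adj a) (bfa_bound a).

Lemma bop_starK : involutive bop_star. Proof. by move=> a; apply: bopP. Qed.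

Lemma bop0_adj x y : inner F (0 : F) y = inner F x (0 : F).
Proof. by rewrite inner0l inner0r. Qed.
Lemma bop0_bound : exists M : R, forall x, nrm (0 : F) <= M * nrm x.
Proof. by exists 0 => x; rewrite nrm0 mul0r. Qed.
Definition bop0 := @Bop (fun=> 0) (fun=> 0) bop0_adj bop0_bound.

Lemma bop_lin_adj (k : R[i]) a b x y :
  inner F (k *: a x + b x) y = inner F x (conjc k *: bfa a y + bfa b y).
Proof. by rewrite innerPl innerDr innerZr conjcK !bf_adj. Qed.
Lemma bop_lin_bound (k : R[i]) a b : exists M : R, forall x, nrm (k *: a x + b x) <= M * nrm x.
Proof.
have [M M0 aM] := bf_bound_pos a; have [L L0 bL] := bf_bound_pos b.
exists (normc k * M + L) => x; rewrite (le_trans (nrmD _ _))// mulrDl nrmZ -mulrA lerD//.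
by rewrite ler_wpM2l ?normc_ge0.
Qed.
Definition bop_lin k a b := Bop (bop_lin_adj k a b) (bop_lin_bound k a b).

Lemma bop1_bound : exists M : R, forall x, nrm x <= M * nrm x.
Proof. by exists 1 => x; rewrite mul1r. Qed.
Definition bop1 := @Bop id id (fun _ _ => erefl) bop1_bound.

Lemma bop_mul_adj a b x y : inner F (a (b x)) y = inner F x (bfa b (bfa a y)).
Proof. by rewrite !bf_adj. Qed.
Lemma bop_mul_bound a b : exists M : R, forall x, nrm (a (b x)) <= M * nrm x.
Proof.
have [M M0 aM] := bf_bound_pos a; have [L L0 bL] := bf_bound_pos b.
exists (M * L) => x; rewrite (le_trans (aM _))// -mulrA ler_wpM2l//.
Qed.
Definition bop_mul a b := Bop (bop_mul_adj a b) (bop_mul_bound a b).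

HB.instance Definition _ := gen_eqMixin bop.
HB.instance Definition _ := gen_choiceMixin bop.

Definition bop_add a b := bop_lin 1 a b.
Definition bop_opp a := bop_lin (-1) a bop0.
Definition bop_scale k a := bop_lin k a bop0.

Fact bop_addA : associative bop_add.
Proof. by move=> a b c; apply: bopP => x /=; rewrite !scale1r addrA. Qed.
Fact bop_addC : commutative bop_add.
Proof. by move=> a b; apply: bopP => x /=; rewrite !scale1r addrC. Qed.
Fact bop_add0 : left_id bop0 bop_add.
Proof. by move=> a; apply: bopP => x /=; rewrite scaler0 add0r. Qed.
Fact bop_addN : left_inverse bop0 bop_opp bop_add.
Proof. by move=> a; apply: bopP => x /=; rewrite addr0 scale1r scaleN1r addNr. Qed.
HB.instance Definition _ := GRing.isZmodule.Build bop bop_addA bop_addC bop_add0 bop_addN.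

Lemma bopDE a b x : (a + b) x = a x + b x.
Proof. by rewrite -[a x]scale1r. Qed.

Fact bop_scaleA k l a : bop_scale k (bop_scale l a) = bop_scale (k * l) a.
Proof. by apply: bopP => x /=; rewrite !addr0 scalerA. Qed.
Fact bop_scale1 : left_id 1 bop_scale.
Proof. by move=> a; apply: bopP => x /=; rewrite addr0 scale1r. Qed.
Fact bop_scaleDr : right_distributive bop_scale +%R.
Proof. by move=> k a b; apply: bopP => x; rewrite /= !addr0 ?scale1r scalerDr. Qed.
Fact bop_scaleDl a : {morph bop_scale^~ a : k l / k + l}.
Proof. by move=> k l; apply: bopP => x; rewrite /= !addr0 ?scale1r scalerDl. Qed.
HB.instance Definition _ := @GRing.Zmodule_isLmodule.Build R[i] bop bop_scale
  bop_scaleA bop_scale1 bop_scaleDr bop_scaleDl.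

Lemma bopZE (k : R[i]) a x : (k *: a) x = k *: a x.
Proof. exact: addr0. Qed.

End BoundedOperators.

(** * The C*-algebra of bounded operators and its vector state *)

Section OperatorAlgebra.
Variables (R : realType) (F : complex_hilbert R) (Om : F).
Hypothesis Om1 : inner F Om Om = 1.

Definition bopalg : Type := bop F.
HB.instance Definition _ := GRing.Lmodule.on bopalg.
Implicit Types a b c : bopalg.

Definition bopalg_mul a b : bopalg := bop_mul a b.
Definition bopalg1 : bopalg := bop1 F.

Fact bopalg_mulA : associative bopalg_mul. Proof. by move=> a b c; apply: bopP. Qed.
Fact bopalg_mul1l : left_id bopalg1 bopalg_mul. Proof. by move=> a; apply: bopP. Qed.
Fact bopalg_mul1r : right_id bopalg1 bopalg_mul. Proof. by move=> a; apply: bopP. Qed.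
Fact bopalg_mulDl : left_distributive bopalg_mul +%R.
Proof. by move=> a b c; apply: bopP. Qed.
Fact bopalg_mulDr : right_distributive bopalg_mul +%R.
Proof. by move=> a b c; apply: bopP => x /=; rewrite bfP. Qed.
Fact bopalg_1neq0 : bopalg1 != 0.
Proof.
apply/eqP => /(congr1 (fun a : bop F => inner F (a Om) Om)) /=.
by rewrite Om1 inner0l; apply/eqP; exact: oner_neq0.
Qed.
HB.instance Definition _ := GRing.Zmodule_isNzRing.Build bopalg
  bopalg_mulA bopalg_mul1l bopalg_mul1r bopalg_mulDl bopalg_mulDr bopalg_1neq0.

Fact bopalg_scaleAl (k : R[i]) a b : k *: (a * b) = (k *: a) * b.
Proof. by apply: bopP. Qed.
HB.instance Definition _ := @GRing.LSemiModule_isLSemiAlgebra.Build R[i] bopalg bopalg_scaleAl.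

Fact bopalg_scaleAr (k : R[i]) a b : k *: (a * b) = a * (k *: b).
Proof. by apply: bopP => x /=; rewrite !addr0 linearZ. Qed.
HB.instance Definition _ := @GRing.LSemiAlgebra_isSemiAlgebra.Build R[i] bopalg bopalg_scaleAr.

Definition bop_norm a : R := sup [set nrm (a x) | x in [set x | nrm x <= 1]].

Lemma bop_norm_has_sup a : has_sup [set nrm (a x) | x in [set x | nrm x <= 1]].
Proof.
split; first by exists (nrm (a 0)), 0 => //=; rewrite nrm0 ler01.
have [M M0 aM] := bf_bound_pos a; exists M => _ [x x1 <-].
by rewrite (le_trans (aM x))// ler_piMr.
Qed.

Lemma bop_norm_ge0 a : 0 <= bop_norm a.
Proof.
apply: (le_trans (nrm_ge0 (a 0))); apply: (sup_ubound (bop_norm_has_sup a).2).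
by exists 0 => //=; rewrite nrm0 ler01.
Qed.

Lemma bop_normP a x : nrm (a x) <= bop_norm a * nrm x.
Proof.
have [x0|x0] := eqVneq (nrm x) 0; first by rewrite (nrm0_eq0 x0) linear0 nrm0 mulr0.
have xp : 0 < nrm x by rewrite lt_def x0 nrm_ge0.
have ->: nrm (a x) = nrm (a ((nrm x)^-1%:C *: x)) * nrm x.
  by rewrite linearZ nrmZ normc_real ?invr_ge0 ?nrm_ge0// mulrAC mulVf// mul1r.
rewrite ler_wpM2r ?nrm_ge0//; apply: (sup_ubound (bop_norm_has_sup a).2).
by eexists; last reflexivity; rewrite /= nrmZ normc_real ?invr_ge0 ?nrm_ge0// mulVf.
Qed.

Lemma bop_norm_le a M : 0 <= M -> (forall x, nrm (a x) <= M * nrm x) -> bop_norm a <= M.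
Proof.
move=> M0 aM; apply: ge_sup; first exact: (bop_norm_has_sup a).1.
by move=> _ [x x1 <-]; rewrite (le_trans (aM x))// ler_piMr.
Qed.

Definition bop_adj a : bopalg := bop_star a.

Lemma bop_norm_adj a : bop_norm (bop_adj a) <= bop_norm a.
Proof. by apply: bop_norm_le (bop_norm_ge0 a) _; apply: bfa_le (bop_norm_ge0 a) (bop_normP a). Qed.

Lemma bop_star_conj_linear (k : R[i]) a b :
  bop_adj (k *: a + b) = conjc k *: bop_adj a + bop_adj b.
Proof.
apply: bopP => x; apply: hilbert_eqP => z.
have adjE c : inner F (bop_adj c x) z = inner F x (c z) by exact: bfa_adj.
have -> : inner F ((conjc k *: bop_adj a + bop_adj b) x) z =
    conjc k * inner F (bop_adj a x) z + inner F (bop_adj b x) z.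
  by rewrite bopDE innerDl bopZE innerZl.
by rewrite !adjE bopDE innerDr bopZE innerZr.
Qed.

Lemma bop_adjB a b : bop_adj (a - b) = bop_adj a - bop_adj b.
Proof. by rewrite addrC -scaleN1r bop_star_conj_linear rmorphN rmorph1 scaleN1r addrC. Qed.

Lemma bop_starM a b : bop_adj (a * b) = bop_adj b * bop_adj a.
Proof. exact: bopP. Qed.

Lemma bop_norm0_eq0 a : bop_norm a = 0 -> a = 0.
Proof.
move=> a0; apply: bopP => x; apply: nrm0_eq0.
by apply/eqP; rewrite eq_le nrm_ge0 andbT; have := bop_normP a x; rewrite a0 mul0r.
Qed.

Lemma bop_normD a b : bop_norm (a + b) <= bop_norm a + bop_norm b.
Proof.
apply: bop_norm_le; first by rewrite addr_ge0 ?bop_norm_ge0.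
by move=> x; rewrite bopDE (le_trans (nrmD _ _))// mulrDl lerD// bop_normP.
Qed.

Lemma bop_normZ_le (k : R[i]) a : bop_norm (k *: a) <= normc k * bop_norm a.
Proof.
apply: bop_norm_le; first by rewrite mulr_ge0 ?bop_norm_ge0 ?normc_ge0.
by move=> x; rewrite bopZE nrmZ -mulrA ler_wpM2l ?normc_ge0 ?bop_normP.
Qed.

Lemma bop_normZ (k : R[i]) a : bop_norm (k *: a) = normc k * bop_norm a.
Proof.
apply/eqP; rewrite eq_le bop_normZ_le /=.
have [->|k0] := eqVneq k 0; first by rewrite ComplexField.Normc.normc0 mul0r bop_norm_ge0.
have nk : 0 < normc k.
  by rewrite lt_def normc_ge0 andbT; apply: contra k0 => /eqP/ComplexField.Normc.eq0_normc ->.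
have := bop_normZ_le k^-1 (k *: a); rewrite scalerA mulVf// scale1r.
rewrite -(ler_pM2l nk) mulrA -ComplexField.Normc.normcM mulfV//.
by rewrite ComplexField.Normc.normc1 mul1r.
Qed.

Lemma bop_normM a b : bop_norm (a * b) <= bop_norm a * bop_norm b.
Proof.
apply: bop_norm_le; first by rewrite mulr_ge0 ?bop_norm_ge0.
move=> x; rewrite (le_trans (bop_normP a (b x)))// -mulrA.
by rewrite ler_wpM2l ?bop_norm_ge0 ?bop_normP.
Qed.

Lemma bop_C_identity a : bop_norm (bop_adj a * a) = bop_norm a ^+ 2.
Proof.
apply/eqP; rewrite eq_le; apply/andP; split.
  by rewrite (le_trans (bop_normM _ _))// expr2 ler_wpM2r ?bop_norm_ge0 ?bop_norm_adj.
rewrite -[leRHS]sqr_sqrtr ?bop_norm_ge0// ler_pXn2r ?nnegrE ?bop_norm_ge0 ?sqrtr_ge0//.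
apply: bop_norm_le (sqrtr_ge0 _) _ => x.
rewrite -(@ler_pXn2r _ 2)// ?nnegrE ?mulr_ge0 ?sqrtr_ge0 ?nrm_ge0//.
rewrite exprMn sqr_sqrtr ?bop_norm_ge0//.
have -> : nrm (a x) ^+ 2 = normc (inner F ((bop_adj a * a) x) x).
  transitivity (normc (inner F (bfa a (a x)) x)) => //.
  by rewrite bfa_adj -nrm_sqr normc_real// sqr_ge0.
rewrite (le_trans (Cauchy_Schwarz _ _))// expr2 mulrA ler_wpM2r ?nrm_ge0//.
exact: (bop_normP (bop_adj a * a)).
Qed.

Lemma bopB_E a b x : (a - b) x = a x - b x.
Proof. by rewrite bopDE -scaleN1r bopZE scaleN1r. Qed.

Lemma bop_limit (u : nat -> bopalg) x :
  (forall eps : R, 0 < eps -> exists N, forall i j, (N <= i)%N -> (N <= j)%N ->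
     bop_norm (u i - u j) < eps) ->
  exists l, forall eps : R, 0 < eps -> exists N, forall i, (N <= i)%N -> nrm (u i x - l) < eps.
Proof.
move=> cu; apply: Cauchy_seq_cvg => e e0.
have x1 : 0 < nrm x + 1 by rewrite ltr_wpDl ?nrm_ge0.
have [N hN] := cu (e / (nrm x + 1)) (divr_gt0 e0 x1); exists N => i j Ni Nj.
rewrite -bopB_E (le_lt_trans (bop_normP _ _))//.
apply: (@le_lt_trans _ _ (e / (nrm x + 1) * nrm x)).
  by rewrite ler_wpM2r ?nrm_ge0// ltW// hN.
by rewrite -mulrA gtr_pMr// mulrC ltr_pdivrMr// mul1r ltrDl.
Qed.

(** Pointwise limits of the operators and of their adjoints exist, and the adjoint relation passes
    to the limit. The Cauchy bound is uniform over vectors, so the convergence is in norm. *)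
Lemma bop_complete (u : nat -> bopalg) :
  (forall eps : R, 0 < eps -> exists N, forall i j, (N <= i)%N -> (N <= j)%N ->
     bop_norm (u i - u j) < eps) ->
  exists l, forall eps : R, 0 < eps -> exists N, forall i, (N <= i)%N -> bop_norm (u i - l) < eps.
Proof.
move=> cu; have [l hl] := choice (fun x => bop_limit x cu).
have cu' (eps : R) : 0 < eps -> exists N, forall i j, (N <= i)%N -> (N <= j)%N ->
    bop_norm (bop_adj (u i) - bop_adj (u j)) < eps.
  move=> /cu [N hN]; exists N => i j Ni Nj; apply: le_lt_trans (hN i j Ni Nj).
  by rewrite -bop_adjB bop_norm_adj.
have [l' hl'] := choice (fun x => bop_limit x cu').
have l_adj x y : inner F (l x) y = inner F x (l' y).
  apply/eqP; rewrite -subr_eq0; apply/eqP/ComplexField.Normc.eq0_normc/eqP.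
  rewrite eq_le normc_ge0 andbT; apply/ler_addgt0Pr => e e0; rewrite add0r.
  have y1 : 0 < nrm y + nrm x + 1 by rewrite ltr_wpDl ?addr_ge0 ?nrm_ge0.
  have d0 := divr_gt0 e0 y1; set d := e / _ in d0.
  have [N1 h1] := hl x _ d0; have [N2 h2] := hl' y _ d0.
  pose i := maxn N1 N2.
  have -> : inner F (l x) y - inner F x (l' y) =
      - inner F (u i x - l x) y + inner F x (bop_adj (u i) y - l' y).
    by rewrite innerBl innerBr bf_adj; ring.
  rewrite (le_trans (normc_leD _ _))// normcN.
  apply: (@le_trans _ _ (d * nrm y + nrm x * d)).
    rewrite lerD// (le_trans (Cauchy_Schwarz _ _))//.
      by rewrite ler_wpM2r ?nrm_ge0// ltW// h1// leq_maxl.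
    by rewrite ler_wpM2l ?nrm_ge0// ltW// h2// leq_maxr.
  rewrite [nrm x * d]mulrC -mulrDr /d -mulrA ler_piMr ?ltW//.
  by rewrite mulrC ltr_pdivrMr// mul1r ltrDl.
have l_near e : 0 < e -> exists N, forall i, (N <= i)%N -> forall x, nrm (u i x - l x) <= e * nrm x.
  move=> e0; have [N hN] := cu e e0; exists N => i Ni x.
  apply/ler_addgt0Pr => d d0; have [M hM] := hl x d d0.
  pose j := maxn N M.
  have -> : u i x - l x = (u i - u j) x + (u j x - l x) by rewrite bopB_E addrA subrK.
  rewrite (le_trans (nrmD _ _))// lerD//; last by rewrite ltW// hM// leq_maxr.
  by rewrite (le_trans (bop_normP _ _))// ler_wpM2r ?nrm_ge0// ltW// hN// leq_maxl.
have l_bound : exists M : R, forall x, nrm (l x) <= M * nrm x.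
  have [N hN] := l_near 1 ltr01; have [M aM] := bf_bound (u N).
  exists (M + 1) => x; have -> : l x = u N x - (u N x - l x) by rewrite subKr.
  by rewrite (le_trans (nrmD _ _))// nrmN mulrDl lerD// hN.
exists (Bop l_adj l_bound : bopalg) => e e0; have e2 : 0 < e / 2 by rewrite divr_gt0.
have [N hN] := l_near _ e2; exists N => i Ni.
apply: (@le_lt_trans _ _ (e / 2)); last by rewrite ltr_pdivrMr// ltr_pMr// ltr1n.
apply: bop_norm_le (ltW e2) _ => x; rewrite bopB_E; exact: hN.
Qed.

Definition bop_cstar : cstarAlgebra R :=
  @CstarAlgebra R bopalg bop_adj bop_norm bop_star_conj_linear bop_starM
    (@bop_starK R F) bop_norm0_eq0 bop_normD bop_normZ bop_normM bop_C_identity bop_complete.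

Definition bop_state (a : bop_cstar) : R[i] := inner F ((a : bopalg) Om) Om.

Fact bop_state_linear : scalar bop_state.
Proof. by move=> k a b; rewrite /bop_state bopDE innerDl bopZE innerZl. Qed.
HB.instance Definition _ := GRing.isLinear.Build R[i] bop_cstar R[i] *%R bop_state bop_state_linear.

Lemma bop_state_is_state : is_state (bop_state : {scalar bop_cstar}).
Proof.
split=> [|a]; first exact: Om1.
rewrite /= /bop_state -[(_ * _)%R]/(bopalg_mul _ _) /= bfa_adj -nrm_sqr.
by rewrite lecR sqr_ge0.
Qed.

End OperatorAlgebra.

(** * The Fock space model *)

Section FockModel.
Variables (T : finType) (R : realType).
Notation F := (fock_hilbert T R).
Implicit Types (t s : T) (x y : l2seq T R).

Lemma fock_innerE (x y : F) : inner F x y = l2ip x y.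
Proof. by []. Qed.

Lemma fock_nrmE (x : F) : nrm x = l2nm x.
Proof. by []. Qed.

(** In coordinates, creation prepends a letter and annihilation removes it; reversal of words ([fl])
    conjugates left operators into right ones. *)
Definition cr t (f : seq T -> R[i]^o) : seq T -> R[i]^o :=
  fun w => if w is s :: v then (if s == t then f v else 0) else 0.
Definition an t (f : seq T -> R[i]^o) : seq T -> R[i]^o := fun w => f (t :: w).
Definition fl (f : seq T -> R[i]^o) : seq T -> R[i]^o := fun w => f (rev w).

Lemma psum_cr n t f : psum n.+1 (fun w => normc (cr t f w) ^+ 2) = psum n (fun w => normc (f w) ^+ 2) :> R.
Proof.
have n0 : normc (0 : R[i]) ^+ 2 = 0 by rewrite ComplexField.Normc.normc0 expr0n.
rewrite /= n0 add0r (bigD1 t)//= big1 ?addr0.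
  by apply: eq_psum => w; rewrite eqxx.
by move=> s st; rewrite psum_eq0// => w; rewrite (negbTE st).
Qed.

Lemma l2_cr t x : cr t x \in @l2_pred T R.
Proof.
apply/asboolP; have [M xM] := l2P x; exists M => n.
apply: (le_trans (psum_nondecreasing (f := fun w => normc (cr t x w) ^+ 2) _ (leqnSn n))).
  by move=> w; exact: sqr_ge0.
by rewrite psum_cr.
Qed.

Lemma psum_an n t f : psum n (fun w => normc (an t f w) ^+ 2) <= psum n.+1 (fun w => normc (f w) ^+ 2) :> R.
Proof.
rewrite /= (bigD1 t)//= addrCA lerDl addr_ge0 ?sqr_ge0// sumr_ge0// => s _.
by apply: psum_ge0 => w; exact: sqr_ge0.
Qed.

Lemma l2_an t x : an t x \in @l2_pred T R.
Proof. by apply/asboolP; have [M xM] := l2P x; exists M => n; apply: le_trans (psum_an n t x) (xM _). Qed.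

Lemma l2_fl x : fl x \in @l2_pred T R.
Proof.
apply/asboolP; have [M xM] := l2P x; exists M => n.
by rewrite (psum_rev n (fun w => normc (x w) ^+ 2)).
Qed.

Lemma ctot0 : ctot (fun _ : seq T => 0 : R[i]) = 0.
Proof.
have s0 : csummable (fun _ : seq T => 0 : R[i]).
  by exists 0 => n; rewrite psum_eq0// => w; rewrite ComplexField.Normc.normc0 normr0.
rewrite -[RHS](addNr (ctot (fun _ : seq T => 0 : R[i]))) -mulN1r -ctotP//.
by congr (ctot _); apply/funext => w; rewrite mulr0 addr0.
Qed.

Definition crF t (x : F) : F := L2seq (l2_cr t x).
Definition anF t (x : F) : F := L2seq (l2_an t x).
Definition flF (x : F) : F := L2seq (l2_fl x).

Lemma crF_adj t (x y : F) : inner F (crF t x) y = inner F x (anF t y).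
Proof.
rewrite !fock_innerE /l2ip ctot_shift; last exact: square_summable_conj (l2P _) (l2P _).
rewrite /= mul0r add0r (bigD1 t)//= big1 ?addr0; last first.
  by move=> s st; rewrite -[RHS]ctot0; congr (ctot _); apply/funext => w; rewrite (negbTE st) mul0r.
by congr (ctot _); apply/funext => w; rewrite eqxx.
Qed.

Lemma crF_bound t : exists M : R, forall x : F, nrm (crF t x) <= M * nrm x.
Proof.
exists 1 => x; rewrite mul1r !fock_nrmE ler_wsqrtr//.
apply: tot_le; first exact: square_summable_summable (l2P _).
case=> [|n]; first exact: l2norm_sqr_ge0.
rewrite psum_cr; apply: (psum_le_tot n (square_summable_summable (l2P x))) => w; exact: sqr_ge0.
Qed.

Lemma flF_adj (x y : F) : inner F (flF x) y = inner F x (flF y).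
Proof.
rewrite !fock_innerE /l2ip -[RHS]ctot_rev; congr (ctot _); apply/funext => w.
by rewrite /= /fl revK.
Qed.

Lemma flF_bound : exists M : R, forall x : F, nrm (flF x) <= M * nrm x.
Proof.
by exists 1 => x; rewrite mul1r !fock_nrmE /l2nm /l2norm_sqr (tot_rev (fun w => normc (x w) ^+ 2)).
Qed.

Lemma l2_vac : (fun w => (w == [::])%:R) \in @l2_pred T R.
Proof.
apply/asboolP; exists 1; case=> [|n]; first exact: ler01.
rewrite (psum_pick (v := [::])) ?eqxx ?ComplexField.Normc.normc1 ?expr1n//.
by move=> w /negbTE wv; rewrite [_ == _]wv ComplexField.Normc.normc0 expr0n.
Qed.
Definition Om : F := L2seq l2_vac.

Lemma inner_Om (x : F) : inner F x Om = (x : l2seq T R) [::].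
Proof.
rewrite fock_innerE /l2ip ctot_shift; last exact: square_summable_conj (l2P _) (l2P _).
rewrite /= rmorph1 mulr1 big1 ?addr0// => t _; rewrite -[RHS]ctot0.
by congr (ctot _); apply/funext => w; rewrite rmorph0 mulr0.
Qed.

Lemma Om1 : inner F Om Om = 1.
Proof. by rewrite inner_Om. Qed.

Notation B := (bop_cstar Om1).

Definition crB t : B := Bop (crF_adj t) (crF_bound t).
Definition flB : B := Bop flF_adj flF_bound.

Notation app a := (bf (a : bop F)).

Lemma appP (a b : B) : (forall x, app a x = app b x) -> a = b.
Proof. exact: (@bopP R F (a : bop F) (b : bop F)). Qed.
Lemma appD (a b : B) x : app (a + b) x = app a x + app b x.
Proof. exact: bopDE. Qed.
Lemma appZ (k : R[i]) (a : B) x : app (k *: a) x = k *: app a x.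
Proof. exact: bopZE. Qed.
Lemma appM (a b : B) x : app (a * b) x = app a (app b x).
Proof. by []. Qed.
Lemma appPr (a : B) k x y : app a (k *: x + y) = k *: app a x + app a y.
Proof. exact: bfP. Qed.
Lemma app_sumr (I : Type) (r : seq I) (P : pred I) (a : B) (f : I -> F) :
  app a (\sum_(i <- r | P i) f i) = \sum_(i <- r | P i) app a (f i).
Proof. exact: (linear_sum (bf (a : bop F) : {linear F -> F})). Qed.
Lemma app1 x : app (1 : B) x = x.
Proof. by []. Qed.
Lemma app_sum (I : Type) (r : seq I) (P : pred I) (a : I -> B) x :
  app (\sum_(i <- r | P i) a i) x = \sum_(i <- r | P i) app (a i) x.
Proof. exact: (big_morph (fun a : B => app a x) (fun a b => appD a b x) erefl). Qed.

Lemma starD (A : cstarAlgebra R) (a b : A) : star (a + b) = star a + star b.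
Proof. by rewrite -[a]scale1r star_conj_linear rmorph1 !scale1r. Qed.
Lemma star0 (A : cstarAlgebra R) : star (0 : A) = 0.
Proof. by apply: (addrI (star 0)); rewrite -starD !addr0. Qed.
Lemma starZ (A : cstarAlgebra R) (k : R[i]) (a : A) : star (k *: a) = conjc k *: star a.
Proof. by rewrite -[k *: a]addr0 star_conj_linear star0 addr0. Qed.

Lemma star_flB : star flB = flB. Proof. exact: appP. Qed.
Lemma flBK : flB * flB = 1.
Proof. by apply: appP => x; apply: l2eqP => w; rewrite /= /fl revK. Qed.

Lemma star_cr_cr s t : star (crB s) * crB t = (s == t)%:R.
Proof.
apply: appP => x; apply: l2eqP => w; rewrite /= /an /=.
by case: eqP => _; rewrite ?mulr0n ?mulr1n.
Qed.

Definition lcr (h : {ffun T -> R^o}) : B := \sum_t (h t)%:C *: crB t.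
Definition lop h : B := lcr h + star (lcr h).
Definition rcr h : B := flB * lcr h * flB.
Definition rop h : B := flB * lop h * flB.

Lemma star_rcr h : star (rcr h) = flB * star (lcr h) * flB.
Proof. by rewrite !starM star_flB mulrA. Qed.
Lemma ropE h : rop h = rcr h + star (rcr h).
Proof. by rewrite star_rcr -mulrDl -mulrDr. Qed.

Lemma lcrP (a : R) g h : lcr (a *: g + h) = a%:C *: lcr g + lcr h.
Proof.
rewrite /lcr scaler_sumr -big_split; apply: eq_bigr => t _.
by rewrite !ffunE rmorphD rmorphM scalerDl scalerA.
Qed.

Lemma lopP (a : R) g h : lop (a *: g + h) = a%:C *: lop g + lop h.
Proof. by rewrite /lop lcrP starD starZ conjc_real scalerDr addrACA. Qed.
Lemma ropP (a : R) g h : rop (a *: g + h) = a%:C *: rop g + rop h.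
Proof. by rewrite /rop lopP mulrDr mulrDl -scalerAr -scalerAl. Qed.

Lemma star_lcr h : star (lcr h) = \sum_t (h t)%:C *: star (crB t).
Proof.
rewrite (big_morph _ (@starD B) (star0 B)); apply: eq_bigr => t _.
by rewrite starZ conjc_real.
Qed.

Lemma star_lcr_lcr g h : star (lcr g) * lcr h = (euclid_ip g h)%:C *: 1.
Proof.
rewrite star_lcr /lcr mulr_suml rmorph_sum scaler_suml; apply: eq_bigr => s _.
rewrite mulr_sumr (bigD1 s)//= -scalerAl -scalerAr star_cr_cr eqxx scalerA -rmorphM.
rewrite big1 ?addr0// => t ts; rewrite -scalerAl -scalerAr star_cr_cr eq_sym (negbTE ts).
by rewrite mulr0n !scaler0.
Qed.

Lemma star_lcr_Om h : app (star (lcr h)) Om = 0.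
Proof.
rewrite star_lcr app_sum big1// => t _; rewrite appZ.
by rewrite [X in _ *: X](_ : _ = 0) ?scaler0//; apply: l2eqP.
Qed.

Lemma inner_lcr_Om h (x : F) : inner F (app (lcr h) x) Om = 0.
Proof. by rewrite (bf_adj (lcr h : bop F)) -[bfa _ _]/(app (star (lcr h)) Om) star_lcr_Om inner0r. Qed.

Lemma flB_Om : app flB Om = Om.
Proof. by apply: l2eqP => w; rewrite /= /fl; case: w => //= t w; rewrite rev_cons; case: (rev w). Qed.

Lemma flB_cr t : app flB (app (crB t) Om) = app (crB t) Om.
Proof.
apply: l2eqP => -[|s [|u w]] //=; rewrite /fl /= !rev_cons.
by case: (rev w) => [|v r] /=; rewrite ?if_same// ; case: r => /=; rewrite !if_same.
Qed.

Lemma lop_Om h : app (lop h) Om = app (lcr h) Om.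
Proof. by rewrite appD star_lcr_Om addr0. Qed.

Lemma rcr_Om h : app (rcr h) Om = app (lcr h) Om.
Proof.
have lcrE : app (lcr h) Om = \sum_t (h t)%:C *: app (crB t) Om.
  by rewrite app_sum; apply: eq_bigr => t _; rewrite appZ.
rewrite !appM flB_Om lcrE linear_sum; apply: eq_bigr => t _.
by rewrite linearZ; congr (_ *: _); exact: flB_cr.
Qed.

Lemma rop_Om h : app (rop h) Om = app (lop h) Om.
Proof. by rewrite ropE appD rcr_Om star_rcr !appM flB_Om star_lcr_Om linear0 addr0 lop_Om. Qed.

Definition rcB t : B := flB * crB t * flB.

Lemma rcB_E t (x : F) w :
  (app (rcB t) x : l2seq T R) w =
  if rev w is s :: v then (if s == t then (x : l2seq T R) (rev v) else 0) else 0.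
Proof. by []. Qed.

Lemma star_rcB_E t (x : F) w : (app (star (rcB t)) x : l2seq T R) w = (x : l2seq T R) (rcons w t).
Proof. by rewrite /= /fl /an /= rev_cons revK. Qed.

Lemma cr_rc s t : crB s * rcB t = rcB t * crB s.
Proof.
apply: appP => x; apply: l2eqP => w; rewrite !appM rcB_E.
case: w => [|u w] //; rewrite rev_cons -[LHS]/(if u == s then (app (rcB t) x : l2seq T R) w else 0) rcB_E.
case: (rev w) => [|a b] /=; first by rewrite /= !if_same.
rewrite rev_rcons -[RHS]/(if a == t then if u == s then (x : l2seq T R) (rev b) else 0 else 0).
by case: (u == s); case: (a == t).
Qed.

(** A letter created on the right can be removed from the left only when it is the whole word, so
    the two operators fail to commute on the vacuum component alone. *)
Lemma star_cr_rc s t (x : F) : app (star (crB s) * rcB t) x =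
  app (rcB t * star (crB s)) x + ((s == t)%:R * (x : l2seq T R) [::]) *: Om.
Proof.
apply: l2eqP => w; rewrite -[RHS]/((app (rcB t) (app (star (crB s)) x) : l2seq T R) w +
  (s == t)%:R * (x : l2seq T R) [::] * (w == [::])%:R) rcB_E.
rewrite -[LHS]/((app (rcB t) x : l2seq T R) (s :: w)) rcB_E rev_cons.
have [/eqP|] := boolP (w == [::]).
  by move=> ->; rewrite /= mulr1 add0r; case: eqP => _; rewrite ?mul1r ?mul0r.
rewrite mulr0 addr0 -size_eq0 -size_rev; case: (rev w) => [|a b] //= _.
by rewrite rev_rcons.
Qed.

Lemma star_rc_cr s t (x : F) : app (star (rcB t) * crB s) x =
  app (crB s * star (rcB t)) x + ((s == t)%:R * (x : l2seq T R) [::]) *: Om.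
Proof.
apply: l2eqP => w; rewrite !appM star_rcB_E.
rewrite -[RHS]/((if w is u :: v then (if u == s then (app (star (rcB t)) x : l2seq T R) v else 0) else 0) +
  (s == t)%:R * (x : l2seq T R) [::] * (w == [::])%:R).
case: w => [|u w]; first by rewrite /= add0r mulr1 eq_sym; case: eqP => _; rewrite ?mul1r ?mul0r.
by rewrite star_rcB_E /= mulr0 addr0.
Qed.

(** The defects in [star_cr_rc] and [star_rc_cr] are the same multiple of the vacuum, and one occurs
    on each side. *)
Lemma lop_rop_letter s t : (crB s + star (crB s)) * (rcB t + star (rcB t)) =
  (rcB t + star (rcB t)) * (crB s + star (crB s)).
Proof.
rewrite !mulrDl !mulrDr cr_rc.
have -> : star (crB s) * star (rcB t) = star (rcB t) * star (crB s) by rewrite -!starM cr_rc.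
apply: appP => x; rewrite !appD star_cr_rc star_rc_cr.
set p := (_ * _) *: Om; set u := app _ x; set v := app _ x; set v' := app _ x; set q := app _ x.
by rewrite -!addrA; congr (_ + _); rewrite addrCA.
Qed.

Lemma lopE h : lop h = \sum_t (h t)%:C *: (crB t + star (crB t)).
Proof. by rewrite /lop star_lcr /lcr -big_split; apply: eq_bigr => t _; rewrite scalerDr. Qed.

Lemma ropE_sum h : rop h = \sum_t (h t)%:C *: (rcB t + star (rcB t)).
Proof.
rewrite /rop lopE mulr_sumr mulr_suml; apply: eq_bigr => t _.
by rewrite -scalerAr -scalerAl !starM star_flB mulrDr mulrDl !mulrA.
Qed.

Lemma lop_rop g h : lop g * rop h = rop h * lop g.
Proof.
rewrite lopE ropE_sum mulr_suml mulr_sumr; apply: eq_bigr => s _.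
rewrite mulr_sumr mulr_suml; apply: eq_bigr => t _.
by rewrite -!scalerAl -!scalerAr lop_rop_letter !scalerA mulrC.
Qed.

Lemma lcr_rcr g h : lcr g * rcr h = rcr h * lcr g.
Proof.
have -> : rcr h = \sum_t (h t)%:C *: rcB t.
  rewrite /rcr /lcr mulr_sumr mulr_suml; apply: eq_bigr => t _.
  by rewrite -scalerAr -scalerAl.
rewrite /lcr mulr_suml mulr_sumr; apply: eq_bigr => s _.
rewrite mulr_sumr mulr_suml; apply: eq_bigr => t _.
by rewrite -!scalerAl -!scalerAr cr_rc !scalerA mulrC.
Qed.

Notation H := (euclid_hilbert R T).

Definition felt (u : seq H) : F := foldr (fun h x => app (lcr h) x) Om u.

Lemma felt_multilinear (u v : seq H) (a : R) (x y : H) :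
  felt (u ++ (a *: x + y) :: v) = a%:C *: felt (u ++ x :: v) + felt (u ++ y :: v).
Proof.
elim: u => [|h u ih] /=; last by rewrite ih linearP.
by rewrite -appZ -appD -lcrP.
Qed.

Lemma app_adj (a : B) (x y : F) : inner F (app a x) y = inner F x (app (star a) y).
Proof. exact: (bf_adj (a : bop F)). Qed.

Lemma felt_inner (u v : seq H) : inner F (felt u) (felt v) =
  if size u == size v then (\prod_(p <- zip u v) inner H p.1 p.2)%:C else 0.
Proof.
elim: u v => [|h u ih] [|g v].
- by rewrite big_nil; exact: Om1.
- rewrite [LHS](_ : _ = conjc (inner F (app (lcr g) (felt v)) Om)); last exact: (@inner_herm R F Om).
  by rewrite inner_lcr_Om conjc0.
- exact: inner_lcr_Om.
- rewrite -[felt (h :: u)]/(app (lcr h) (felt u)) -[felt (g :: v)]/(app (lcr g) (felt v)).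
  rewrite app_adj -appM star_lcr_lcr appZ innerZr conjc_real app1 ih [size _ == _ in RHS]eqSS.
  by case: ifP => _; rewrite ?mulr0// big_cons rmorphM.
Qed.

Definition fspan (x : F) := exists s : seq (R[i] * seq H), x = \sum_(p <- s) p.1 *: felt p.2.

Lemma fspanP k x y : fspan x -> fspan y -> fspan (k *: x + y).
Proof.
move=> [r ->] [s ->]; exists ([seq (k * p.1, p.2) | p <- r] ++ s).
by rewrite big_cat big_map scaler_sumr; congr (_ + _); apply: eq_bigr => p _; rewrite scalerA.
Qed.

Lemma fspan0 : fspan 0. Proof. by exists [::]; rewrite big_nil. Qed.

Lemma fspan_sum (I : Type) (r : seq I) (f : I -> F) :
  (forall i, fspan (f i)) -> fspan (\sum_(i <- r) f i).
Proof.
move=> hf; elim: r => [|i r ih]; first by rewrite big_nil; exact: fspan0.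
by rewrite big_cons -[f i]scale1r; exact: fspanP.
Qed.

Lemma fspan_lcr h x : fspan x -> fspan (app (lcr h) x).
Proof.
move=> [s ->]; exists [seq (p.1, (h : H) :: p.2) | p <- s].
by rewrite linear_sum big_map; apply: eq_bigr => p _; rewrite linearZ.
Qed.

Lemma crB_lcr t : crB t = lcr [ffun s => (s == t)%:R].
Proof.
rewrite /lcr (bigD1 t)//= ffunE eqxx scale1r big1 ?addr0// => s st.
by rewrite ffunE (negbTE st) scale0r.
Qed.

(** Restriction to words shorter than [n], written with creation operators so that it visibly lies
    in the span of the elementary tensors. *)
Fixpoint ftrunc n (x : F) : F :=
  if n is n'.+1 then (x : l2seq T R) [::] *: Om + \sum_t app (crB t) (ftrunc n' (app (star (crB t)) x))
  else 0.

Lemma fspan_ftrunc n x : fspan (ftrunc n x).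
Proof.
elim: n x => [|n ih] x; first exact: fspan0.
apply: fspanP; first by exists [:: (1, [::])]; rewrite big_seq1 scale1r.
by apply: fspan_sum => t; rewrite crB_lcr; exact: fspan_lcr.
Qed.

(** Pythagoras by first letter: a squared norm is the empty-word term plus the squared norms of the
    annihilated vectors, to which the induction applies. *)
Lemma ftrunc_tail n (x : F) : l2norm_sqr (x - ftrunc n x : l2seq T R) =
  l2norm_sqr (x : l2seq T R) - psum n (fun w => normc ((x : l2seq T R) w) ^+ 2).
Proof.
elim: n x => [|n ih] x; first by rewrite !subr0.
have E y : l2norm_sqr (y : l2seq T R) = normc ((y : l2seq T R) [::]) ^+ 2 + \sum_t l2norm_sqr (app (star (crB t)) (y : F) : l2seq T R).
  by rewrite /l2norm_sqr tot_shift//; exact: square_summable_summable (l2P _).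
rewrite E; have -> : ((x - ftrunc n.+1 x : F) : l2seq T R) [::] = 0.
  rewrite -!inner_Om innerBl innerDl innerZl Om1 mulr1 [X in _ - (_ + X)](_ : _ = 0) ?addr0 ?inner_Om ?subrr//.
  rewrite -inner_Om (big_morph (fun y : F => inner F y Om) (fun y z : F => innerDl y z Om) (inner0l (Om : F))) big1// => t _.
  by rewrite crB_lcr inner_lcr_Om.
have S t : app (star (crB t)) (x - ftrunc n.+1 x) = app (star (crB t)) x - ftrunc n (app (star (crB t)) x).
  rewrite -scaleN1r addrC appPr scaleN1r addrC; congr (_ - _).
  have -> : ftrunc n.+1 x = (x : l2seq T R) [::] *: Om + \sum_t app (crB t) (ftrunc n (app (star (crB t)) x)) by [].
  rewrite appPr [X in _ *: X](_ : _ = 0); last by apply: l2eqP.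
  rewrite scaler0 add0r app_sumr (bigD1 t)// -appM star_cr_cr eqxx app1 big1; first exact: addr0.
  by move=> s st; rewrite -appM star_cr_cr eq_sym (negbTE st).
rewrite ComplexField.Normc.normc0 expr0n add0r (eq_bigr _ (fun t _ => congr1 (fun y : F => l2norm_sqr (y : l2seq T R)) (S t))).
by rewrite (eq_bigr _ (fun t _ => ih _)) [in RHS]E sumrB opprD addrACA subrr add0r.
Qed.

Lemma felt_total : closure [set x : F | fspan x] = setT.
Proof.
apply/seteqP; split=> // x _; apply: closure_nrm => r r0.
have r2 : 0 < r ^+ 2 by rewrite exprn_gt0.
have /cvgrPdist_lt/(_ _ r2) [n _ /(_ n (leqnn n)) hn] := cvg_psum (square_summable_summable (l2P (x : l2seq T R))).
exists (ftrunc n x); first exact: fspan_ftrunc.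
rewrite -(@ltr_pXn2r _ 2)// ?nnegrE ?nrm_ge0 ?(ltW r0)//.
rewrite fock_nrmE sqr_sqrtr ?l2norm_sqr_ge0// ftrunc_tail.
exact: le_lt_trans (ler_norm _) hn.
Qed.

Definition fock_full : full_fock H :=
  @FullFock R H F felt felt_multilinear felt_inner felt_total.

Section ModelSystem.
Variables (n m : nat) (e : 'I_(n + m) -> {ffun T -> R^o}).

Definition fop (k : 'I_(n + m)) : B := if (k < n)%N then lop (e k) else rop (e k).
Definition fcr (k : 'I_(n + m)) : B := if (k < n)%N then lcr (e k) else rcr (e k).

Lemma fopE k : fop k = fcr k + star (fcr k).
Proof. by rewrite /fop /fcr; case: ifP => _ //; exact: ropE. Qed.

Lemma star_fop k : star (fop k) = fop k.
Proof. by rewrite fopE starD starK addrC. Qed.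

Lemma fcr_Om k : app (fcr k) Om = app (lcr (e k)) Om.
Proof. by rewrite /fcr; case: ifP => _ //; exact: rcr_Om. Qed.

Lemma star_fcr_Om k : app (star (fcr k)) Om = 0.
Proof.
rewrite /fcr; case: ifP => _; first exact: star_lcr_Om.
by rewrite star_rcr !appM flB_Om star_lcr_Om linear0.
Qed.

Notation psi := (@bop_state R F Om Om1 : {scalar B}).

Lemma fop_cov i j : psi (fop i * fop j) = (euclid_ip (e i) (e j))%:C.
Proof.
rewrite -[LHS]/(inner F (app (fop i) (app (fop j) Om)) Om) app_adj star_fop !fopE !appD.
rewrite !star_fcr_Om !addr0 !fcr_Om app_adj -appM star_lcr_lcr appZ innerZr conjc_real.
by rewrite Om1 mulr1 euclid_ipC.
Qed.

Lemma foldr_fop (w : seq 'I_(n + m)) (x : F) :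
  app (\prod_(k <- w) fop k) x = foldr (fun k y => app (fop k) y) x w.
Proof. by elim: w => [|k w ih]; rewrite ?big_nil// big_cons appM ih. Qed.

Lemma rcr_felt h (u : seq H) : app (rcr h) (felt u) = felt (rcons u h).
Proof.
by elim: u => [|g u ih] /=; [exact: rcr_Om|rewrite -ih -!appM lcr_rcr].
Qed.

Lemma fop_clt : bifree_clt psi fop.
Proof.
split; first exact: star_fop.
exists H, fock_full, e, (fun k => bf (fcr k : bop F)), (fun k => bf (star (fcr k) : bop F)).
split.
- by move=> i j; rewrite fop_cov.
- move=> k; rewrite /fcr; case: (k < n)%N; split; try exact: bop_continuous.
    by [].
  exact: rcr_felt.
- by move=> k x y; exact: app_adj.
- move=> w; rewrite -[LHS]/(inner F (app (\prod_(k <- w) fop k) Om) Om) foldr_fop.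
  congr (inner F _ _); elim: w => // k w ih.
  by rewrite -[LHS]/(app (fop k) (foldr (fun k y => app (fop k) y) Om w)) ih fopE appD.
Qed.

Definition lvec (w : seq 'I_(n + m)) : F := foldr (fun k x => app (lop (e k)) x) Om w.
Definition ltau w : R[i] := inner F (lvec w) Om.
Let C k j := euclid_ip (e k) (e j).

Lemma ltau_cons k w : ltau (k :: w) = inner F (app (star (lcr (e k))) (lvec w)) Om.
Proof.
rewrite /ltau -[lvec _]/(app (lop (e k)) (lvec w)) appD innerDl inner_lcr_Om add0r.
by [].
Qed.

Lemma app0 (a : B) : app a 0 = 0.
Proof. exact: (linear0 (bf (a : bop F) : {linear F -> F})). Qed.
Lemma appDr (a : B) (x y : F) : app a (x + y) = app a x + app a y.
Proof. exact: (linearD (bf (a : bop F) : {linear F -> F})). Qed.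
Lemma appZr (a : B) (c : R[i]) (x : F) : app a (c *: x) = c *: app a x.
Proof. by rewrite -[c *: x]addr0 appPr app0 addr0. Qed.
Lemma inner_OmD (x y : F) : inner F (x + y) Om = inner F x Om + inner F y Om.
Proof. exact: innerDl. Qed.
Lemma ltau_nil : ltau [::] = 1.
Proof. exact: Om1. Qed.

(** The annihilator contracts with some later letter [j], and the letters [u] in between contribute
    their own moment. In the induction two successive contractions are regrouped by [spl_spl], which
    rebuilds the moment of the longer prefix. *)
Lemma star_lcr_lvec k w : app (star (lcr (e k))) (lvec w) =
  spl (fun u j v => ((C k j)%:C * ltau u) *: lvec v) w.
Proof.
have [N] := ubnP (size w); elim: N w k => // N ih [|j w] k wN; first exact: star_lcr_Om.
have szw : (size w < N)%N by [].
rewrite -[lvec (j :: w)]/(app (lop (e j)) (lvec w)) appD appDr -appM star_lcr_lcr appZ app1 ih//.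
rewrite [spl _ (j :: w)]/= ltau_nil mulr1; congr (_ + _).
rewrite (spl_morph (F := app (star (lcr (e k)))) _ _ (app0 _) (appDr _)).
rewrite (eq_spl (g := fun u i v => spl (fun a p b =>
    ((C j i)%:C * ltau u * ((C k p)%:C * ltau a)) *: lvec b) v)); last first.
  move=> u i v wE; rewrite appZr ih; last first.
    by apply: leq_ltn_trans szw; rewrite wE size_cat /= (leq_trans (leqnSn _)) ?leq_addl.
  rewrite (spl_morph (F := fun x : F => _ *: x) _ _ (scaler0 _ _) (scalerDr _)).
  by apply: eq_spl => a p b _; rewrite scalerA.
rewrite (spl_spl (fun u i a p b => ((C j i)%:C * ltau u * ((C k p)%:C * ltau a)) *: lvec b)).
apply: eq_spl => u p b wE; rewrite ltau_cons ih; last first.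
  by apply: leq_ltn_trans szw; rewrite wE size_cat leq_addr.
rewrite (spl_morph (F := fun x : F => inner F x Om) _ _ (inner0l _) inner_OmD).
rewrite (spl_morph (F := fun c : R[i] => _ * c) _ _ (mulr0 _) (mulrDr _)).
rewrite (spl_morph (F := fun c : R[i] => c *: lvec b) _ _ (scale0r _) (fun c d => scalerDl (lvec b) c d)).
apply: eq_spl => u' i v' _; congr (_ *: _); rewrite innerZl -/(ltau v'); ring.
Qed.

Definition fmo (w : seq 'I_(n + m)) : R := complex.Re (ltau w).

Lemma ltau_loop k w : ltau (k :: w) = spl (fun u j v => (C k j)%:C * ltau u * ltau v) w.
Proof.
rewrite ltau_cons star_lcr_lvec.
rewrite (spl_morph (F := fun x : F => inner F x Om) _ _ (inner0l _) inner_OmD).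
by apply: eq_spl => u j v _; rewrite innerZl.
Qed.

Lemma ltau_real w : ltau w = (fmo w)%:C.
Proof.
have [N] := ubnP (size w); elim: N w => // N ih [|j w] wN; first by rewrite /fmo /ltau Om1.
rewrite /fmo ltau_loop (eq_spl (g := fun u i v => (C j i * fmo u * fmo v)%:C)).
  by rewrite -(spl_morph (F := fun x : R => x%:C) _ _ (rmorph0 _) (rmorphD (real_complex R))).
move=> u i v wE; have lt z : (size z <= size w)%N -> (size z < N)%N by move=> /leq_ltn_trans; apply.
rewrite !ih ?rmorphM//; apply: lt; rewrite wE size_cat /=; [exact: leq_trans (leq_addl _ _)|exact: leq_addr].
Qed.

Lemma fmo_nil : fmo [::] = 1.
Proof. by rewrite /fmo /ltau Om1. Qed.

Lemma fmo_loop k w : fmo (k :: w) = spl (fun u j v => C k j * fmo u * fmo v) w.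
Proof.
apply: (@complexI R); rewrite -ltau_real ltau_loop.
rewrite (spl_morph (F := fun x : R => x%:C) _ _ (rmorph0 _) (rmorphD (real_complex R))).
by apply: eq_spl => u j v _; rewrite !ltau_real !rmorphM.
Qed.

(** A right field operator commutes past the left ones and agrees with its left counterpart on the
    vacuum. *)
Lemma rop_lvec k w : app (rop (e k)) (lvec w) = lvec (rcons w k).
Proof.
elim: w => [|j w ih]; first exact: rop_Om.
by rewrite -[lvec _]/(app (lop (e j)) (lvec w)) -appM -lop_rop appM ih.
Qed.

(** Right variables acting on the vacuum append their letters one after the other, the last factor
    acting first; this is the reversal. *)
Lemma fop_moment (s : seq 'I_n) (t : seq 'I_m) :
  psi ((\prod_(i <- s) fop (lshift m i)) * (\prod_(j <- t) fop (rshift n j))) =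
  (fmo (map (@lshift n m) s ++ map (@rshift n m) (rev t)))%:C.
Proof.
rewrite -ltau_real; congr (inner F _ Om); rewrite appM.
have -> : app (\prod_(j <- t) fop (rshift n j)) Om = lvec (map (@rshift n m) (rev t)).
  elim: t => [|j t ih]; first by rewrite big_nil.
  rewrite big_cons appM ih rev_cons map_rcons -rop_lvec /fop.
  by rewrite ltnNge leq_addr.
elim: s => [|i s ih]; first by rewrite big_nil.
by rewrite big_cons appM ih {1}/fop [X in if X then _ else _](ltn_ord i).
Qed.

End ModelSystem.

End FockModel.

Lemma conjc_scale (R : realType) (a : R) (b : R[i]) : conjc (a%:C * b) = a%:C * conjc b.
Proof. by rewrite rmorphM; congr (_ * _); exact: conjc_real. Qed.

(** * Annihilation operators on an arbitrary full Fock space *)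

Section FockAnnihilation.
Variables (R : realType) (H : real_hilbert R) (F : full_fock H).
Implicit Types (x y : F) (u v : seq H).

(** By totality, a vector orthogonal to all elementary tensors is orthogonal to vectors arbitrarily
    close to it, hence 0. *)
Lemma fock_eqP x y : (forall u, inner F x (elt F u) = inner F y (elt F u)) -> x = y.
Proof.
move=> xy; apply/eqP; rewrite -subr_eq0; apply/eqP/nrm0_eq0/eqP.
rewrite eq_le nrm_ge0 andbT; apply/ler_addgt0Pr => r r0; rewrite add0r.
have : closure [set x : F | exists s : seq (R[i] * seq H), x = \sum_(p <- s) p.1 *: elt F p.2] (x - y).
  by rewrite elt_total.
have r0' : 0 < r%:C by rewrite ltcR.
case/(_ _ (nbhsx_ballx (x - y) r%:C r0')) => z [[s zE] xyz].
apply: nrm_le; first exact: ltW.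
have zs : inner F (x - y) z = 0.
  rewrite zE (big_morph (inner F (x - y)) (fun a b => innerDr a b (x - y)) (inner0r (x - y))).
  by rewrite big1// => p _; rewrite innerZr innerBl xy subrr mulr0.
have -> : nrm (x - y) ^+ 2 = normc (inner F (x - y) (x - y - z)).
  by rewrite innerBr zs subr0 -nrm_sqr normc_real// sqr_ge0.
rewrite (le_trans (Cauchy_Schwarz _ _))// mulrC ler_wpM2r ?nrm_ge0// ltW//.
by move: xyz; rewrite -ball_normE /= -nrmE ltcR.
Qed.

Lemma elt_inner_cons h g u v :
  inner F (elt F (h :: u)) (elt F (g :: v)) = (inner H h g)%:C * inner F (elt F u) (elt F v).
Proof. by rewrite !elt_inner /= eqSS; case: ifP => _; rewrite ?mulr0// big_cons rmorphM. Qed.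

Lemma elt_inner_rcons h g u v :
  inner F (elt F (rcons u h)) (elt F (rcons v g)) = (inner H h g)%:C * inner F (elt F u) (elt F v).
Proof.
rewrite !elt_inner !size_rcons eqSS; case: eqP => [uv|_]; last by rewrite mulr0.
by rewrite zip_rcons// -cats1 big_cat big_seq1 rmorphM mulrC.
Qed.

Variables (e : H) (c c' : {linear F -> F}).
Hypothesis cc' : is_adjoint c c'.

Let adj_elt u v : inner F (c' (elt F u)) (elt F v) = conjc (inner F (c (elt F v)) (elt F u)).
Proof. by rewrite cc' -inner_herm. Qed.

Lemma left_annihilation u : left_creation e c ->
  c' (elt F u) = if u is g :: u' then (inner H e g)%:C *: elt F u' else 0.
Proof.
move=> [_ cE]; apply: fock_eqP => v; rewrite adj_elt cE.
case: u => [|g u']; first by rewrite inner0l elt_inner conjc0.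
by rewrite innerZl elt_inner_cons conjc_scale -inner_herm.
Qed.

Lemma right_annihilation u : right_creation e c ->
  c' (elt F u) = if rev u is g :: u' then (inner H e g)%:C *: elt F (rev u') else 0.
Proof.
move=> [_ cE]; apply: fock_eqP => v; rewrite adj_elt cE.
case/lastP: u => [|u' g]; first by rewrite inner0l elt_inner size_rcons conjc0.
by rewrite rev_rcons revK innerZl elt_inner_rcons conjc_scale -inner_herm.
Qed.

End FockAnnihilation.

(** * Uniqueness of the moments *)

Section CltMoments.
Variables (R : realType) (n m : nat) (G : 'I_(n + m) -> 'I_(n + m) -> R[i]).
Implicit Types (s : seq (R[i] * seq 'I_(n + m))).

(* The action of creation plus annihilation on formal combinations of words,
   a word standing for the tensor of the corresponding vectors. *)
Definition word_step (k : 'I_(n + m)) (p : R[i] * seq 'I_(n + m)) : seq (R[i] * seq 'I_(n + m)) :=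
  if (k < n)%N
  then (p.1, k :: p.2) :: (if p.2 is g :: u then [:: (p.1 * G k g, u)] else [::])
  else (p.1, rcons p.2 k) :: (if rev p.2 is g :: u then [:: (p.1 * G k g, rev u)] else [::]).

Definition comb_step k s := flatten (map (word_step k) s).

Definition clt_moment (w : seq 'I_(n + m)) : R[i] :=
  \sum_(p <- foldr comb_step [:: (1, [::])] w) p.1 * (p.2 == [::])%:R.

(** The Fock space in the hypothesis is arbitrary; [val] interprets formal combinations in it and
    intertwines [comb_step] with creation plus annihilation. The vacuum coefficient is then a
    function of [G] alone. *)
Lemma clt_momentE (A : cstarAlgebra R) (phi : {scalar A}) (S : 'I_(n + m) -> A) :
  bifree_clt phi S -> (forall i j, phi (S i * S j) = G i j) ->
  forall w, phi (\prod_(k <- w) S k) = clt_moment w.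
Proof.
move=> [_ [H [F [e [c [c' [GE cr adj mE]]]]]]] SG w; rewrite mE.
pose val s := \sum_(p <- s) p.1 *: elt F (map e p.2).
have stepE k (p : R[i] * seq 'I_(n + m)) : val (word_step k p) = c k (p.1 *: elt F (map e p.2)) + c' k (p.1 *: elt F (map e p.2)).
  rewrite !linearZ; have := cr k; rewrite /word_step /val; case: (k < n)%N => ck /=.
    rewrite (left_annihilation (adj k) _ ck) ck.2; case: p => a [|g u] /=.
      by rewrite big_seq1 scaler0 addr0.
    by rewrite big_cons big_seq1 /= scalerA GE SG.
  rewrite (right_annihilation (adj k) _ ck) ck.2 -map_rev; case: p => a u /=; case: (rev u) => [|g v] /=.
    by rewrite big_seq1 /= map_rcons scaler0 addr0.
  by rewrite big_cons big_seq1 /= map_rcons -map_rev scalerA GE SG.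
have combE k s : val (comb_step k s) = c k (val s) + c' k (val s).
  rewrite /val /comb_step; elim: s => [|p s ih] /=; first by rewrite !big_nil !linear0 addr0.
  by rewrite big_cat /= -/(val _) stepE ih !big_cons !linearD addrACA.
have -> : foldr (fun k x => c k x + c' k x) (vacuum F) w = val (foldr comb_step [:: (1, [::])] w).
  by elim: w => [|k w ih] /=; [rewrite /val big_seq1 scale1r|rewrite ih combE].
rewrite /val /clt_moment; move: (foldr _ _ _) => s.
rewrite (big_morph (fun x => inner F x (vacuum F)) (fun x y => innerDl x y _) (inner0l _)).
apply: eq_bigr => p _; rewrite innerZl elt_inner size_map; congr (_ * _).
by case: p => a [|g u]; rewrite /= ?big_nil.
Qed.

End CltMoments.

Lemma clt_cov_psd (R : realType) (n m : nat) (A : cstarAlgebra R) (phi : {scalar A})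
    (S : 'I_(n + m) -> A) : bifree_clt phi S ->
  let cov : 'M[R]_(n + m) := \matrix_(i, j) complex.Re (phi (S i * S j)) in
  (forall i j, phi (S i * S j) = (cov i j)%:C) /\ positive_mx cov.
Proof.
move=> [_ [H [F [e [c [c' [GE _ _ _]]]]]]] cov.
have covE i j : cov i j = inner H (e i) (e j) by rewrite mxE -GE.
split=> [i j|]; first by rewrite covE GE.
have innerC (x y : H) : inner H x y = inner H y x.
  by have := @hermC _ false idfun _ (inner H) x y; rewrite expr0 mul1r.
split=> [|v]; first by apply/matrixP => i j; rewrite mxE !covE innerC.
pose x : H := \sum_i v 0 i *: e i.
suff -> : (v *m cov *m v^T) 0 0 = `|x| ^+ 2 by rewrite sqr_ge0.
have sumr (y : H) : inner H y x = \sum_i v 0 i * inner H y (e i).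
  by rewrite linear_sumr; apply: eq_bigr => i _; rewrite linearZr_LR.
rewrite inner_norm sumr mxE; apply: eq_bigr => i _; rewrite !mxE mulrC; congr (_ * _).
by rewrite innerC sumr; apply: eq_bigr => j _; rewrite covE innerC.
Qed.

(** * Words with two acting ends *)

Section Sides.
Variable X : Type.
Implicit Types (s : bool) (q : X) (w : seq X).

(** [s = true] is the left end of a word and [s = false] the right one; [near s w] reads [w] from
    the acting end. One argument then serves both [lambda] and [rho]. *)
Definition push s q w := if s then q :: w else rcons w q.
Definition near s w := if s then w else rev w.

Lemma near_push s q w : near s (push s q w) = q :: near s w.
Proof. by case: s => //=; rewrite rev_rcons. Qed.

Lemma nearK s : involutive (near s).
Proof. by case: s => // w; exact: revK. Qed.

Lemma push_near s q w v : near s w = q :: v -> w = push s q (near s v).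
Proof. by move=> h; rewrite -[w](nearK s) h; case: s {h} => //=; rewrite rev_cons. Qed.

Lemma sorted_near (e : rel X) s w : symmetric e -> sorted e (near s w) = sorted e w.
Proof.
move=> es; case: s => //; rewrite /near rev_sorted.
by case: w => //= a w; elim: w a => //= b w ih a; rewrite es ih.
Qed.

Lemma sorted_push (e : rel X) s q w : symmetric e ->
  sorted e (push s q w) = (if near s w is a :: _ then e q a else true) && sorted e w.
Proof.
move=> es; rewrite -(sorted_near s (push s q w) es) near_push -(sorted_near s w es).
by case: (near s w).
Qed.

Lemma all_push (a : pred X) s q w : all a (push s q w) = a q && all a w.
Proof. by case: s => //=; rewrite all_rcons. Qed.

End Sides.

Lemma map_push X Y (f : X -> Y) s q w : map f (push s q w) = push s (f q) (map f w).
Proof. by case: s => //=; rewrite map_rcons. Qed.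

Lemma map_near X Y (f : X -> Y) s w : map f (near s w) = near s (map f w).
Proof. by case: s => //=; rewrite map_rev. Qed.

Section ReducedWords.
Variables (K : fieldType) (I : eqType) (X : I -> svspace K) (P : free_product X).
Implicit Types (w : seq (letter X)) (s : bool).

Definition outside s k w := if near s w is a :: _ then tag a != k else true.

Lemma reduced_push s k (x : X k) w :
  reduced (push s (mkletter x) w) = [&& sv_coef (X k) x == 0, outside s k w & reduced w].
Proof.
rewrite /reduced sorted_push; last by move=> a b; rewrite eq_sym.
rewrite all_push /outside /=; move: (_ == 0) (sorted _ _) (all _ _) => c S E.
by case: (near s w) => [|a v]; rewrite ?(eq_sym k); case: c; rewrite /= ?andbF ?andbA.
Qed.

Definition tens_side s k (x : X k) w : P :=
  sv_coef (X k) x *: tens P w + tens P (push s (mkletter (centre x)) w).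

Lemma centre_coef k (x : X k) : sv_coef (X k) (centre x) == 0.
Proof. by rewrite /centre linearB linearZ /= sv_coef_vec mulr1 subrr. Qed.

Lemma tens_push_linear s k (a : K) (x y : X k) w :
  sv_coef (X k) x == 0 -> sv_coef (X k) y == 0 -> outside s k w -> reduced w ->
  tens P (push s (mkletter (a *: x + y)) w) =
  a *: tens P (push s (mkletter x) w) + tens P (push s (mkletter y) w).
Proof.
move=> x0 y0 ow rw; have := tens_multilinear P.
case: s ow => ow h; first by apply: (h [::] w); rewrite (@reduced_push true) ?x0 ?y0 ow.
have := h w [::] k a x y; rewrite !cats1; apply.
  by rewrite (@reduced_push false) x0 ow.
by rewrite (@reduced_push false) y0 ow.
Qed.

Lemma tens_push0 s k w : outside s k w -> reduced w -> tens P (push s (mkletter (0 : X k)) w) = 0.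
Proof.
move=> ow rw; have c0 : sv_coef (X k) 0 == 0 by rewrite linear0.
have := tens_push_linear 1 c0 c0 ow rw; rewrite scale1r addr0 scale1r.
by move=> /esym/(canRL (addrK _)); rewrite subrr.
Qed.

Lemma tens_side_vec s k w : outside s k w -> reduced w ->
  tens_side s (sv_vec (X k)) w = tens P w.
Proof.
move=> ow rw; rewrite /tens_side sv_coef_vec scale1r /centre sv_coef_vec scale1r subrr.
by rewrite tens_push0// addr0.
Qed.

End ReducedWords.

(** * Bi-freeness determines the joint moments *)

Section BifreeMoments.
Variables (R : realType) (I J : eqType) (side : J -> bool) (M : I -> seq J -> R[i]).
Notation comb := (seq (R[i] * seq (I * seq J))).

(* The action of one variable on formal combinations of words whose letter
   [(b, u)] stands for the centred vector obtained from the vacuum of the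
   [b]-th factor by applying the variables [u]. *)
Definition bifree_word_step (z : I * J) (p : R[i] * seq (I * seq J)) : comb :=
  let: (b, k) := z in let s := side k in
  let fresh a w := [:: (a * M b [:: k], w); (a, push s (b, [:: k]) w)] in
  if near s p.2 is (b', u) :: v then
    if b' == b then
      let w := near s v in
      [:: (p.1 * M b (k :: u), w), (p.1, push s (b, k :: u) w) & fresh (- (p.1 * M b u)) w]
    else fresh p.1 p.2
  else fresh p.1 p.2.

Definition bifree_moment (w : seq (I * J)) : R[i] :=
  \sum_(p <- foldr (fun z s => flatten (map (bifree_word_step z) s)) [:: (1, [::])] w)
    p.1 * (p.2 == [::])%:R.

Let alternating (w : seq (I * seq J)) := sorted (fun a b => a.1 != b.1) w.

Let alternating_push s b u w : alternating (push s (b, u) w) =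
  (if near s w is a :: _ then b != a.1 else true) && alternating w.
Proof. by rewrite /alternating sorted_push//; move=> a c; rewrite eq_sym. Qed.

Lemma alternating_step z p : alternating p.2 -> all (fun p => alternating p.2) (bifree_word_step z p).
Proof.
case: z p => b k [a w] /= aw; rewrite /bifree_word_step /=.
case E : (near (side k) w) => [|[b' u] v] /=; first by rewrite aw alternating_push E aw.
case: ifP => [/eqP bb|/negbT bb] /=; last by rewrite aw alternating_push E /= eq_sym bb aw.
move: aw; rewrite (push_near E) alternating_push nearK bb => /andP[bv av].
by rewrite av !alternating_push nearK bv av.
Qed.

Variables (A : cstarAlgebra R) (phi : {scalar A}) (Z : I -> J -> A).
Hypothesis ZM : forall b u, phi (\prod_(k <- u) Z b k) = M b u.
Variables (X : I -> svspace R[i]) (P : free_product X)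
  (T : forall b, J -> {linear X b -> X b}) (Op : I -> J -> {linear P -> P}).
Hypothesis OpE : forall b k (x : X b) w, reduced w -> outside (side k) b w ->
  Op b k (tens_side P (side k) x w) = tens_side P (side k) (T b k x) w.
Hypothesis momentE : forall w : seq (I * J),
  phi (\prod_(z <- w) Z z.1 z.2) = sv_coef P (foldr (fun z x => Op z.1 z.2 x) (sv_vec P) w).

Let wop b u : X b := foldr (fun k x => T b k x) (sv_vec (X b)) u.
Let cw (w : seq (I * seq J)) : seq (letter X) := map (fun q => mkletter (centre (wop q.1 q.2))) w.

Let tens_side_nil b s s' (x : X b) : tens_side P s x [::] = tens_side P s' x [::].
Proof. by case: s; case: s'. Qed.

(** The moment formula itself, on a word of a single colour, identifies this coefficient: everything
    happens in one tensor factor, where left and right actions look alike. *)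
Let wop_coef b u : sv_coef (X b) (wop b u) = M b u.
Proof.
rewrite -ZM; have := momentE (map (pair b) u); rewrite big_map => ->.
have -> : foldr (fun z x => Op z.1 z.2 x) (sv_vec P) (map (pair b) u) = tens_side P true (wop b u) [::].
  elim: u => [|k u ih] /=; first by rewrite tens_side_vec// tens_nil.
  have o : outside (side k) b ([::] : seq (letter X)) by rewrite /outside; case: (side k).
  by rewrite ih (tens_side_nil true (side k)) OpE//; exact: tens_side_nil.
rewrite /tens_side linearD linearZ /= tens_nil sv_coef_vec mulr1 tens_coef ?addr0//.
by rewrite (@reduced_push _ _ X true) centre_coef.
Qed.

Let cw_near s w : near s (cw w) = cw (near s w). Proof. by rewrite /cw map_near. Qed.
Let cw_push s b u w : cw (push s (b, u) w) = push s (mkletter (centre (wop b u))) (cw w).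
Proof. by rewrite /cw map_push. Qed.

Let cw_reduced w : alternating w -> reduced (cw w).
Proof.
move=> aw; rewrite /reduced /cw sorted_map; apply/andP; split; first exact: aw.
by rewrite all_map; apply/allP => q _ /=; exact: centre_coef.
Qed.

Let val (s : comb) : P := \sum_(p <- s) p.1 *: tens P (cw p.2).

Let Op_fresh b k w : alternating w -> outside (side k) b (cw w) ->
  Op b k (tens P (cw w)) =
  M b [:: k] *: tens P (cw w) + tens P (cw (push (side k) (b, [:: k]) w)).
Proof.
move=> aw ow; have rw := cw_reduced aw.
rewrite -{1}(tens_side_vec P ow rw) OpE// -[T b k _]/(wop b [:: k]).
by rewrite /tens_side wop_coef cw_push.
Qed.

(** When the near letter has colour [b], its vector is [wop b u] minus [M b u] times the state
    vector. Applying [T b k] yields [wop b (k :: u)] minus a multiple of [wop b [:: k]], and both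
    are split again into scalar and centred parts. *)
Let val_step z p : alternating p.2 -> val (bifree_word_step z p) = Op z.1 z.2 (p.1 *: tens P (cw p.2)).
Proof.
case: z p => b k [a w] /= aw; rewrite linearZ /bifree_word_step /=.
have fresh c v : alternating v -> outside (side k) b (cw v) ->
    val [:: (c * M b [:: k], v); (c, push (side k) (b, [:: k]) v)] = c *: Op b k (tens P (cw v)).
  move=> av ov; rewrite Op_fresh// /val big_cons big_seq1 /=.
  by rewrite scalerDr scalerA.
case E : (near (side k) w) => [|[b' u] v] /=.
  by apply: fresh => //; rewrite /outside cw_near E.
case: ifP => [/eqP bb|/negbT bb]; last by apply: fresh => //; rewrite /outside cw_near E.
subst b'; move: aw; rewrite (push_near E) alternating_push nearK => /andP[bv av].
set w' := near (side k) v in av *.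
have ow : outside (side k) b (cw w').
  by rewrite /outside cw_near /w' nearK; case: (v) bv => //= q v'; rewrite eq_sym.
have rw := cw_reduced av.
rewrite {1}/val 2!big_cons /= -/(val _) [X in _ + (_ + X)](fresh _ _ av ow).
have -> : tens P (cw (push (side k) (b, u) w')) =
    tens_side P (side k) (wop b u) (cw w') - M b u *: tens P (cw w').
  by rewrite /tens_side wop_coef cw_push addrC addKr.
rewrite linearB [Op b k (M b u *: _)]linearZ /= OpE// -[T b k _]/(wop b (k :: u)) /tens_side wop_coef -cw_push.
by rewrite !scalerDr scalerN !scalerA scaleNr addrA.
Qed.

Lemma bifree_momentE w : phi (\prod_(z <- w) Z z.1 z.2) = bifree_moment w.
Proof.
rewrite momentE /bifree_moment.
set s := foldr _ [:: _] w.
have [sE sA] : foldr (fun z x => Op z.1 z.2 x) (sv_vec P) w = val s /\ all (fun p => alternating p.2) s.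
  rewrite /s; elim: w {s} => [|z w [ih1 ih2]] /=; first by rewrite /val big_seq1 scale1r tens_nil.
  rewrite ih1; move: ih2; set r := foldr _ _ _; elim: r => [|p r ih] /=; first by rewrite /val !big_nil linear0.
  move=> /andP[ap ar]; have [h1 h2] := ih ar; rewrite all_cat h2 alternating_step//; split=> //.
  by rewrite /val big_cons linearD -/(val r) h1 big_cat -(val_step z ap).
rewrite sE /val linear_sum; apply: eq_big_seq => p ps; rewrite linearZ /=; congr (_ * _).
have ap := allP sA p ps; case: p ap {ps} => a [|q u] /= ap; first by rewrite tens_nil sv_coef_vec.
by rewrite tens_coef//; exact: (@cw_reduced (q :: u) ap).
Qed.

End BifreeMoments.

(** * Finitely supported functions on words *)

Section FinitelySupported.
Variables (T : finType) (R : realType).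

Definition c00_pred : {pred seq T -> R[i]^o} :=
  fun f => `[<exists n, forall w, (n <= size w)%N -> f w = 0>].

Lemma c00_submod : GRing.submod_closed c00_pred.
Proof.
split=> [|a f g /asboolP [n fn] /asboolP [m gm]]; apply/asboolP; first by exists 0%N.
exists (maxn n m) => w; rewrite geq_max => /andP[nw mw].
by rewrite -[LHS]/(a * f w + g w) fn// gm// mulr0 addr0.
Qed.
HB.instance Definition _ := GRing.isSubmodClosed.Build R[i] (seq T -> R[i]^o) c00_pred c00_submod.

(** The algebraic Fock space: a free product is universal for all linear maps, so expansions in its
    basis must be finite. *)
Record c00 := C00 { c00val :> seq T -> R[i]^o ; c00valP : c00val \in c00_pred }.
HB.instance Definition _ := [isSub for c00val].
HB.instance Definition _ := [Choice of c00 by <:].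
HB.instance Definition _ := [SubChoice_isSubLmodule of c00 by <:].
Implicit Types x y p : c00.

Lemma c00E a x y w : (a *: x + y) w = a * x w + y w. Proof. by []. Qed.
Lemma c00DE x y w : (x + y) w = x w + y w. Proof. by []. Qed.
Lemma c00ZE (a : R[i]) x w : (a *: x) w = a * x w. Proof. by []. Qed.
Lemma c00BE x y w : (x - y) w = x w - y w. Proof. by []. Qed.
Lemma c00_eqP x y : (forall w, x w = y w) -> x = y.
Proof. by move=> xy; apply/val_inj/funext. Qed.

Definition bound x : nat := projT1 (cid (asboolP _ (c00valP x))).
Lemma boundP x w : (bound x <= size w)%N -> x w = 0.
Proof. by rewrite /bound; case: cid => n h /=; exact: h. Qed.

Lemma delta_c00 v : (fun w => (w == v)%:R) \in c00_pred.
Proof. by apply/asboolP; exists (size v).+1 => w; case: eqP => // ->; rewrite ltnn. Qed.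
Definition delta v : c00 := C00 (delta_c00 v).

Lemma deltaE v w : delta v w = (w == v)%:R. Proof. by []. Qed.

Lemma psum_ind (V : nmodType) (Q : V -> Prop) n (f : seq T -> V) :
  Q 0 -> (forall x y : V, Q x -> Q y -> Q (x + y)) -> (forall w, Q (f w)) -> Q (psum n f).
Proof.
move=> Q0 QD; elim: n f => [|n ih] f Qf //=; apply: (QD) => //.
elim: (index_enum T) => [|t r ihr]; rewrite ?big_nil ?big_cons//.
by apply: (QD) => //; exact: ih.
Qed.

Lemma c00_expansion x n : (bound x <= n)%N -> x = psum n (fun v => x v *: delta v).
Proof.
move=> xn; apply: c00_eqP => w.
rewrite (psum_morph (h := fun y : c00 => y w) _ _ erefl) //.
have [wn|nw] := ltnP (size w) n.
  by rewrite (psum_pick (v := w))// ?c00ZE ?deltaE ?eqxx ?mulr1// => v /negbTE vw; rewrite c00ZE deltaE eq_sym vw mulr0.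
rewrite psum_eq0 ?boundP ?(leq_trans xn nw)// => v; rewrite c00ZE deltaE.
by case: eqP => [<-|_]; rewrite ?mulr0// boundP ?mul0r ?(leq_trans xn nw).
Qed.

Section LinearExtension.
Variables (Z : lmodType R[i]) (f : seq T -> Z).

Definition ext x : Z := psum (bound x) (fun v => x v *: f v).

Lemma extE x n : (forall w, (n <= size w)%N -> x w = 0) -> ext x = psum n (fun v => x v *: f v).
Proof.
move=> xn; rewrite /ext.
rewrite -(psum_stable (n := n) (m := maxn n (bound x)) _ (leq_maxl _ _)); last by move=> w nw; rewrite xn// scale0r.
by rewrite -(psum_stable (n := bound x) (m := maxn n (bound x)) _ (leq_maxr _ _))// => w nw; rewrite boundP// scale0r.
Qed.

Lemma ext_linear : linear ext.
Proof.
move=> a x y; set n := maxn (bound x) (bound y).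
have hx w : (n <= size w)%N -> x w = 0 by rewrite geq_max => /andP[h _]; exact: boundP.
have hy w : (n <= size w)%N -> y w = 0 by rewrite geq_max => /andP[_ h]; exact: boundP.
rewrite (extE hx) (extE hy) (@extE _ n) => [|w nw]; last by rewrite c00E hx// hy// mulr0 addr0.
rewrite -psumZ -psumD; apply: eq_psum => w.
by rewrite c00E scalerDl scalerA.
Qed.
HB.instance Definition _ := GRing.isLinear.Build R[i] c00 Z *:%R ext ext_linear.

Lemma ext_delta v : ext (delta v) = f v.
Proof.
rewrite (@extE _ (size v).+1) => [|w]; last by rewrite deltaE; case: eqP => // ->; rewrite ltnn.
rewrite (psum_pick (v := v))// ?deltaE ?eqxx ?scale1r// => w /negbTE wv.
by rewrite deltaE wv scale0r.
Qed.
End LinearExtension.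

Lemma c00_linear_eq (Z : lmodType R[i]) (g g' : {linear c00 -> Z}) :
  (forall v, g (delta v) = g' (delta v)) -> g =1 g'.
Proof.
move=> gg' x; rewrite (c00_expansion (leqnn (bound x))).
rewrite (psum_morph (h := g) _ _ (linear0 g) (linearD g)) (psum_morph (h := g') _ _ (linear0 g') (linearD g')).
by apply: eq_psum => w; rewrite !linearZ gg'.
Qed.

Definition c00_coef x : R[i] := x [::].
Lemma c00_coef_scalar : scalar c00_coef. Proof. by []. Qed.
HB.instance Definition _ := GRing.isLinear.Build R[i] c00 R[i] *%R c00_coef c00_coef_scalar.
Definition c00_sv : svspace R[i] :=
  @SvSpace R[i] c00 (delta [::]) c00_coef erefl.

Lemma c00_l2 x : c00val x \in @l2_pred T R.
Proof.
apply/asboolP; exists (psum (bound x) (fun w => normc (x w) ^+ 2)) => n.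
apply: (@le_trans _ _ (psum (maxn (bound x) n) (fun w => normc (x w) ^+ 2))).
  by apply: psum_nondecreasing; rewrite ?leq_maxr// => w; exact: sqr_ge0.
rewrite (psum_stable (n := bound x)) ?leq_maxl// => w bw.
by rewrite boundP// ComplexField.Normc.normc0 expr0n.
Qed.
Definition incl x : fock_hilbert T R := L2seq (c00_l2 x).

Lemma incl_inj x y : incl x = incl y -> x = y.
Proof. by move=> /(congr1 (fun z : l2seq T R => l2val z)) xy; exact: val_inj. Qed.
Lemma inclP a x y : incl (a *: x + y) = a *: incl x + incl y.
Proof. exact: l2eqP. Qed.

Lemma cr_c00 t x : cr t x \in c00_pred.
Proof.
apply/asboolP; exists (bound x).+1 => -[|s w] //= wn.
by case: eqP => // _; apply: boundP.
Qed.
Lemma an_c00 t x : an t x \in c00_pred.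
Proof. by apply/asboolP; exists (bound x) => w bw; apply: boundP; exact: leqW. Qed.
Lemma fl_c00 x : fl x \in c00_pred.
Proof. by apply/asboolP; exists (bound x) => w bw; apply: boundP; rewrite size_rev. Qed.
Definition crC t x : c00 := C00 (cr_c00 t x).
Definition anC t x : c00 := C00 (an_c00 t x).
Definition flC x : c00 := C00 (fl_c00 x).
Lemma crC_linear t : linear (crC t).
Proof.
move=> a x y; apply: c00_eqP => -[|s w]; rewrite c00E /= ?mulr0 ?addr0//.
by case: (s == t); rewrite ?mulr0 ?addr0.
Qed.
Lemma anC_linear t : linear (anC t). Proof. by move=> a x y; exact: c00_eqP. Qed.
Lemma flC_linear : linear flC. Proof. by move=> a x y; exact: c00_eqP. Qed.
HB.instance Definition _ t := GRing.isLinear.Build R[i] c00 c00 *:%R (crC t) (crC_linear t).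
HB.instance Definition _ t := GRing.isLinear.Build R[i] c00 c00 *:%R (anC t) (anC_linear t).
HB.instance Definition _ := GRing.isLinear.Build R[i] c00 c00 *:%R flC flC_linear.
Lemma flCK : involutive flC.
Proof. by move=> x; apply: c00_eqP => w; rewrite /= /fl revK. Qed.
Lemma flC_delta v : flC (delta v) = delta (rev v).
Proof. by apply: c00_eqP => w; rewrite -[LHS]/((rev w == v)%:R) deltaE -{1}[v]revK (inj_eq (can_inj revK)). Qed.

End FinitelySupported.

(** * Bi-freeness in the Fock space *)

Section ColouredFock.
Variables (N : nat) (R : realType).
Notation T := (bool * 'I_N)%type.
Notation X := (fun _ : bool => c00_sv 'I_N R).
Notation W := (c00 T R).
Implicit Types (b : bool) (v : seq T) (x y : c00 'I_N R) (G : W) (w : seq (letter X)).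

Fixpoint pre b v : seq 'I_N := if v is (c, j) :: v' then if c == b then j :: pre b v' else [::] else [::].
Fixpoint post b v : seq T := if v is (c, j) :: v' then if c == b then post b v' else v else [::].

Lemma size_pre_post b v : (size (pre b v) + size (post b v))%N = size v.
Proof. by elim: v => [|[c j] v ih] //=; case: ifP => //= _; rewrite addSn ih. Qed.

(* [V_b (x (x) G)]: the first tensor factor is the maximal [b]-coloured prefix. *)
Definition tlf b x (G : seq T -> R[i]) : seq T -> R[i]^o := fun v => x (pre b v) * G (post b v).

Lemma tlf_c00 b x G : tlf b x G \in @c00_pred T R.
Proof.
apply/asboolP; exists (bound x + bound G)%N => v; rewrite -(size_pre_post b v) /tlf => h.
have [xb|bx] := leqP (bound x) (size (pre b v)); first by rewrite boundP// mul0r.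
have -> : G (post b v) = 0 by apply: boundP; rewrite -(leq_add2l (bound x)) (leq_trans h)// leq_add2r ltnW.
by rewrite mulr0.
Qed.
Definition tl b x G : W := C00 (tlf_c00 b x G).

Lemma tlE b x G v : tl b x G v = x (pre b v) * G (post b v). Proof. by []. Qed.

Fixpoint tensw w : W := if w is a :: w' then tl (tag a) (tagged a) (tensw w') else delta R [::].

Lemma tensw_cons (a : letter X) w v :
  tensw (a :: w) v = (tagged a : c00 'I_N R) (pre (tag a) v) * tensw w (post (tag a) v).
Proof. by []. Qed.

Lemma tensw_nil_coef w : reduced w -> (0 < size w)%N -> tensw w [::] = 0.
Proof.
case: w => [//|a w] /andP[_ /andP[/eqP a0 _]] _; rewrite tensw_cons.
by rewrite [X in X * _]a0 mul0r.
Qed.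

Lemma tensw_multilinear : multilinear_on_reduced tensw.
Proof.
move=> u w k a x y _ _; apply: c00_eqP => v; rewrite c00E.
elim: u v => [|b u ih] v; rewrite ?cat_cons !tensw_cons; first by rewrite c00E mulrDl mulrA.
by rewrite ih mulrDr mulrCA.
Qed.

Notation code := (seq (bool * seq 'I_N)).
Implicit Types (c : code).
(** [dl] makes a basis letter out of a block. Proper codes and coloured words correspond through
    [flat] and [blocks], so reduced words of basis letters index the basis of the free product. *)
Definition dl (q : bool * seq 'I_N) : letter X := @mkletter _ _ X q.1 (delta R q.2).
Definition flat c : seq T := flatten (map (fun q => map (pair q.1) q.2) c).
Definition proper_code c := sorted (fun p q : bool * seq 'I_N => p.1 != q.1) c && all (fun q => q.2 != [::]) c.
Fixpoint blocks v : code :=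
  if v is (b, j) :: v' then
    if blocks v' is (b', u) :: c then if b' == b then (b, j :: u) :: c else (b, [:: j]) :: blocks v'
    else [:: (b, [:: j])]
  else [::].

Lemma blocks_cons b j v : blocks ((b, j) :: v) =
  if blocks v is (b', u) :: c then if b' == b then (b, j :: u) :: c else (b, [:: j]) :: blocks v
  else [:: (b, [:: j])].
Proof. by []. Qed.

Lemma reduced_dl c : reduced (map dl c) = proper_code c.
Proof.
rewrite /reduced /proper_code sorted_map all_map; congr (_ && _); apply: eq_all => q.
rewrite -[LHS]/((([::] == q.2)%:R : R[i]) == 0) [[::] == _]eq_sym.
by rewrite pnatr_eq0 eqb0.
Qed.

Lemma blocks_proper v : proper_code (blocks v).
Proof.
elim: v => [|[b j] v ih] //=; case: (blocks v) ih => [|[b' u] c] //=.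
rewrite /proper_code; case: eqP => [->|/eqP bb] /=.
  by case: c => [|q c] //= /and3P[/andP[-> ->] _ /andP[-> ->]].
by rewrite (eq_sym b) bb.
Qed.

Lemma blocksK v : flat (blocks v) = v.
Proof.
elim: v => [|[b j] v ih] //=; case: (blocks v) ih => [|[b' u] c] /= <- //.
by case: eqP => [->|].
Qed.

Lemma flatK c : proper_code c -> blocks (flat c) = c.
Proof.
elim: c => [|[b u] c ih] // pc.
have pc' : proper_code c by move: pc; rewrite /proper_code /= => /andP[/path_sorted -> /andP[_ ->]].
have ec : if blocks (flat c) is (b', _) :: _ then b' != b else true.
  rewrite ih//; move: pc; rewrite /proper_code /=; case: (c) => [|[b' u'] c'] //=.
  by rewrite eq_sym => /andP[/andP[]].
have u0 : u != [::] by move: pc; rewrite /proper_code /= => /andP[_ /andP[]].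
rewrite -[flat (_ :: _)]/(map (pair b) u ++ flat c).
elim: u u0 {pc} => // j [|i u] ihu _; rewrite map_cons cat_cons blocks_cons.
  by rewrite cat0s ih//; move: ec; rewrite ih//; case: (c) => [|[b' u'] c'] //= /negbTE ->.
by rewrite ihu// eqxx.
Qed.

Lemma pre_post_cat b v : v = map (pair b) (pre b v) ++ post b v.
Proof. by elim: v => [|[c j] v ih] //=; case: eqP => //= ->; rewrite -ih. Qed.

Lemma pre_cat b u v : (if v is (b', _) :: _ then b' != b else true) ->
  pre b (map (pair b) u ++ v) = u /\ post b (map (pair b) u ++ v) = v.
Proof.
move=> hv; elim: u => [|j u [ih1 ih2]] /=; last by rewrite eqxx ih1 ih2.
by case: v hv => [|[b' j] v] //= /negbTE ->.
Qed.

Lemma tensw_dl c : proper_code c -> tensw (map dl c) = delta R (flat c).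
Proof.
elim: c => [|[b u] c ih] // pc.
have pc' : proper_code c by move: pc; rewrite /proper_code /= => /andP[/path_sorted -> /andP[_ ->]].
have hc : is_true (if flat c is (b', _) :: _ then b' != b else true).
  move: pc; rewrite /proper_code; case: (c) => [//|[b' u'] c'] /= /andP[/andP[bb _] /andP[_ /andP[u0 _]]].
  by case: u' u0 => //= j u' _; rewrite eq_sym.
rewrite /= ih//; apply: c00_eqP => v; rewrite tlE !deltaE /= -natrM mulnb; congr (_%:R).
rewrite -[flat (_ :: _)]/(map (pair b) u ++ flat c).
congr (nat_of_bool _).
apply/idP/eqP => [/andP[/eqP pu /eqP pv]|->]; first by rewrite {1}(pre_post_cat b v) pu pv.
by have [-> ->] := pre_cat u hc; rewrite !eqxx.
Qed.

Lemma reduced_tags w : sorted (fun a b : letter X => tag a != tag b) w =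
  sorted (fun a b : bool => a != b) (map (@tag _ _) w).
Proof. by rewrite sorted_map. Qed.

(** Letters are expanded in the basis one at a time from the left; those already treated are kept as
    [map dl c]. *)
Lemma multilinear_eq (Z : lmodType R[i]) (f g : seq (letter X) -> Z) :
  multilinear_on_reduced f -> multilinear_on_reduced g ->
  (forall c, proper_code c -> f (map dl c) = g (map dl c)) ->
  forall w, reduced w -> f w = g w.
Proof.
move=> mf mg fg w rw; suff : forall c, reduced (map dl c ++ w) -> f (map dl c ++ w) = g (map dl c ++ w).
  by move=> /(_ [::]); apply.
elim: w {rw} => [|[b x] w ih] c rw.
  by rewrite cats0 in rw *; rewrite fg// -reduced_dl.
pose U := map dl c; have redE y : y [::] = 0 -> reduced (U ++ @mkletter _ _ X b y :: w).
  move=> y0; move: rw; rewrite /reduced -/U !all_cat /= !reduced_tags !map_cat /=.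
  by case/andP => -> /andP[-> /andP[_ ->]]; rewrite [c00_coef _]y0 eqxx.
(* Multilinearity is available on reduced words only, so the predicate carries [y [::] = 0]
   along. *)
pose Q y := y [::] = 0 /\ f (U ++ @mkletter _ _ X b y :: w) = g (U ++ @mkletter _ _ X b y :: w).
have QP a y z : Q y -> Q z -> Q (a *: y + z).
  move=> [y0 fy] [z0 fz]; split; first by rewrite c00E y0 z0 mulr0 addr0.
  by rewrite mf ?mg ?fy ?fz//; exact: redE.
have Q0 : Q 0.
  split=> //; have z0 (h : seq (letter X) -> Z) : multilinear_on_reduced h -> h (U ++ @mkletter _ _ X b 0 :: w) = 0.
    move=> mh; have r0 := redE 0 erefl; have := mh U w b 1 0 0 r0 r0.
    rewrite scale1r addr0 scale1r => /esym/(canRL (addrK _)); by rewrite subrr.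
  by rewrite !z0.
have x0 : x [::] = 0.
  move: rw; rewrite /reduced all_cat /= => /andP[_ /andP[_ /andP[/eqP h _]]]; exact: h.
suff : Q x by case.
(* The empty word has coefficient 0, and its vector is replaced by 0 because [delta R [::]] is not
   centred. *)
have -> : x = psum (bound x) (fun v : seq 'I_N => x v *: (if v == [::] then 0 else delta R v)).
  rewrite {1}(c00_expansion (leqnn (bound x))); apply: eq_psum => v.
  by case: eqP => [->|//]; rewrite x0 !scale0r.
apply: psum_ind => [//|y z Qy Qz|v]; first by rewrite -[y]scale1r; exact: QP.
rewrite -[_ *: _]addr0; apply: QP => //; case: eqP => [//|/eqP v0]; split.
  by rewrite deltaE eq_sym (negbTE v0).
have := ih (c ++ [:: (b, v)]); rewrite map_cat -catA /=; apply.
by apply: redE; rewrite deltaE eq_sym (negbTE v0).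
Qed.

(** The linear map is forced on basis words by their block decomposition, and [multilinear_eq]
    carries the agreement over to all reduced words. *)
Lemma tensw_universal (Z : lmodType R[i]) (f : seq (letter X) -> Z) :
  multilinear_on_reduced f ->
  exists g : {linear c00_sv T R -> Z}, (forall w, reduced w -> g (tensw w) = f w) /\
    forall g' : {linear c00_sv T R -> Z}, (forall w, reduced w -> g' (tensw w) = f w) -> g' =1 g.
Proof.
move=> mf; pose g : {linear c00 T R -> Z} := ext (fun v => f (map dl (blocks v))).
exists g; split=> [w rw|g' g'E].
  apply: (multilinear_eq (f := fun w => g (tensw w)) _ mf _ rw).
    by move=> u v k a x y rx ry; rewrite tensw_multilinear// linearP.
  by move=> c pc; rewrite tensw_dl// [LHS]ext_delta flatK.
apply: c00_linear_eq => v; rewrite [RHS]ext_delta -{1}(blocksK v) -tensw_dl ?blocks_proper//.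
by apply: g'E; rewrite reduced_dl blocks_proper.
Qed.

Definition fock_free_product : free_product X :=
  @FreeProd R[i] bool X (c00_sv T R) tensw erefl tensw_nil_coef tensw_multilinear tensw_universal.

Definition fl_letter (a : letter X) : letter X := @mkletter _ _ X (tag a) (flC (tagged a)).
Definition fl_word w := rev (map fl_letter w).

Lemma reduced_fl w : reduced (fl_word w) = reduced w.
Proof.
rewrite /reduced /fl_word -[rev _]/(near false _) sorted_near; last by move=> a b; rewrite eq_sym.
by rewrite sorted_map all_rev all_map.
Qed.

Lemma flat_rev c : flat (rev (map (fun q => (q.1, rev q.2)) c)) = rev (flat c).
Proof.
elim: c => [|[b u] c ih] //=; rewrite rev_cons /flat map_rcons flatten_rcons -/(flat _) ih.
by rewrite [RHS](_ : _ = rev (map (pair b) u ++ flat c))// rev_cat map_rev.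
Qed.

(** Reversing the order of the factors and each factor itself reverses the underlying words; by
    multilinearity basis letters suffice. This reduces right actions to left ones. *)
Lemma tensw_fl w : reduced w -> flC (tensw (fl_word w)) = tensw w.
Proof.
apply: (multilinear_eq (f := fun w => flC (tensw (fl_word w))) _ tensw_multilinear).
  move=> u v k a x y rx ry.
  have E z : fl_word (u ++ @mkletter _ _ X k z :: v) = fl_word v ++ @mkletter _ _ X k (flC z) :: fl_word u.
    by rewrite /fl_word map_cat rev_cat /= rev_cons cat_rcons.
  rewrite !E linearP tensw_multilinear -?E ?reduced_fl//.
  exact: linearP.
move=> c pc; have E : fl_word (map dl c) = map dl (rev (map (fun q => (q.1, rev q.2)) c)).
  rewrite /fl_word map_rev -!map_comp; congr rev; apply: eq_map => q /=.
  by rewrite /fl_letter /= flC_delta.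
rewrite E !tensw_dl// ?flat_rev; first by rewrite flC_delta revK.
by rewrite -reduced_dl -E reduced_fl reduced_dl.
Qed.

Definition tr b x G : W := flC (tl b (flC x) (flC G)).

Lemma tensw_outside b w v : (if w is a :: _ then tag a != b else true) -> reduced w ->
  pre b v != [::] -> tensw w v = 0.
Proof.
move=> wb rw; case: v => [//|[c j] v] /=; have [->|_] //= := eqVneq c b; move=> _.
case: w wb rw => [_ _|a w wb /andP[_ /andP[/eqP a0 _]]]; first by rewrite deltaE.
by rewrite tensw_cons /= eq_sym (negbTE wb) [X in X * _]a0 mul0r.
Qed.

(** [tensw w] vanishes on words with a non-empty prefix of colour [b], so [tl] at the state vector
    fixes it; hence the scalar and centred parts of [x] recombine. *)
Lemma tens_left_tl b x w : (if w is a :: _ then tag a != b else true) -> reduced w ->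
  @tens_left _ _ X fock_free_product b x w = tl b x (tensw w).
Proof.
move=> wb rw; apply: c00_eqP => v; rewrite /tens_left [RHS]tlE c00DE c00ZE.
rewrite -[tens _ (_ :: _)]/(tl b (@centre _ _ X b x) (tensw w)) tlE /centre c00BE c00ZE deltaE.
rewrite -[sv_coef _ _]/(x [::]) -[tens _ w]/(tensw w) mulrBl.
have [pv|pv] := eqVneq (pre b v) [::].
  have -> : post b v = v by rewrite {2}(pre_post_cat b v) pv.
  by rewrite pv mulr1 addrC subrK.
by rewrite mulr0 mul0r subr0 (tensw_outside wb)// mulr0 add0r.
Qed.

Lemma tens_right_tr b x w : (if rev w is a :: _ then tag a != b else true) -> reduced w ->
  @tens_right _ _ X fock_free_product b x w = tr b x (tensw w).
Proof.
move=> wb rw; have wb' : is_true (if fl_word w is a :: _ then tag a != b else true).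
  by rewrite /fl_word -map_rev; case: (rev w) wb.
have rw' : reduced (fl_word w) by rewrite reduced_fl.
have := tens_left_tl (flC x) wb' rw'; rewrite -[in tensw (fl_word w)](flCK (tensw (fl_word w))) tensw_fl//.
move=> /(congr1 (@flC T R)); rewrite -/(tr b x (tensw w)) => <-.
rewrite /tens_left /tens_right linearP; congr (_ *: _ + _); first by rewrite -[RHS]/(flC (tensw (fl_word w))) tensw_fl.
have cx : @centre _ _ X b (flC x) = flC (@centre _ _ X b x).
  have cE z : @centre _ _ X b z = z - (z : c00 'I_N R) [::] *: delta R [::] by [].
  rewrite !cE [RHS](linearB (@flC 'I_N R)) (linearZ_LR (@flC 'I_N R)); congr (_ - _ *: _).
  by apply/esym; exact: flC_delta.
have -> : @mkletter _ _ X b (centre (flC x : X b)) :: fl_word w = fl_word (rcons w (@mkletter _ _ X b (@centre _ _ X b x))).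
  by rewrite /fl_word map_rcons rev_rcons cx.
symmetry; apply: tensw_fl; rewrite (@reduced_push _ _ X false) centre_coef rw andbT.
exact: wb.
Qed.

Notation F := (fock_hilbert T R).
Notation B := (bop_cstar (Om1 T R)).
Notation app a := (bf (a : bop F)).
Notation psi := (@bop_state R F (Om T R) (Om1 T R) : {scalar B}).

(* [L] is [lambda_b (S)], and [a] is its bounded extension to the Fock space. *)
Definition acts b (a : B) (S : {linear c00 'I_N R -> c00 'I_N R}) (L : {linear W -> W}) :=
  (forall G, incl (L G) = app a (incl G)) /\
  forall x G, L (tl b x G) = tl b (S x) G.

Lemma acts_uniqueL b b' a S S' L L' : acts b a S L -> acts b' a S' L' -> L =1 L'.
Proof. by move=> [h _] [h' _] G; apply: incl_inj; rewrite h h'. Qed.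

Lemma tl_delta b y u : tl b y (delta R [::]) (map (pair b) u) = y u.
Proof.
have [pu qu] := @pre_cat b u [::] isT; rewrite cats0 in pu qu.
by rewrite tlE pu qu deltaE eqxx mulr1.
Qed.

Lemma acts_uniqueS b a S S' L L' : acts b a S L -> acts b a S' L' -> S =1 S'.
Proof.
move=> h h' x; apply: c00_eqP => u; rewrite -(tl_delta b) -[RHS](tl_delta b).
by rewrite -h.2 -h'.2 (acts_uniqueL h h').
Qed.

Lemma tlP b (k : R[i]) x y G : tl b (k *: x + y) G = k *: tl b x G + tl b y G.
Proof. by apply: c00_eqP => v; rewrite c00E !tlE c00E mulrDl mulrA. Qed.

Lemma acts1 b : acts b 1 idfun idfun.
Proof. by split. Qed.

Lemma acts_lin b (k : R[i]) a a' S S' L L' : acts b a S L -> acts b a' S' L' ->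
  acts b (k *: a + a') (k \*: S \+ S') (k \*: L \+ L').
Proof.
move=> [h1 h2] [h1' h2']; split=> [G|x G]; last by rewrite /= h2 h2' tlP.
by rewrite -[LHS]/(incl (k *: L G + L' G)) inclP h1 h1' appD appZ.
Qed.

Lemma acts_mul b a a' S S' L L' : acts b a S L -> acts b a' S' L' ->
  acts b (a * a') (S \o S') (L \o L').
Proof. by move=> [h1 h2] [h1' h2']; split=> [G|x G] /=; [rewrite h1 h1'|rewrite h2' h2]. Qed.

Lemma acts_cr b j : acts b (crB R (b, j)) (crC j) (crC (b, j)).
Proof.
split=> [G|x G]; first exact: l2eqP.
apply: c00_eqP => -[|[c i] v]; rewrite [RHS]tlE /=; first by rewrite mul0r.
rewrite /tlf xpair_eqE; have [_|_] /= := eqVneq c b; last by rewrite mul0r.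
by case: (i == j); rewrite ?mul0r.
Qed.

Lemma acts_an b j : acts b (star (crB R (b, j))) (anC j) (anC (b, j)).
Proof.
split=> [G|x G]; first exact: l2eqP.
by apply: c00_eqP => v; rewrite [RHS]tlE /= /an /= /tlf /= eqxx.
Qed.

(** Operators coming from the tensor factor of colour [b]. They form a subalgebra, so membership is
    checked on generators. *)
Definition faithful b (a : B) := exists S L, acts b a S L.

Lemma faithful_subalgebra b : is_subalgebra (faithful b).
Proof.
split=> [|k a a' [S [L h]] [S' [L' h']]|a a' [S [L h]] [S' [L' h']]].
- by do 2 eexists; exact: acts1.
- by do 2 eexists; exact: acts_lin h h'.
- by do 2 eexists; exact: acts_mul h h'.
Qed.

Lemma faithful_lop b (h : {ffun T -> R^o}) : (forall j, h (~~ b, j) = 0) -> faithful b (lop h).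
Proof.
move=> h0; rewrite lopE.
have [f1 fP fM] := faithful_subalgebra b.
have f0 : faithful b 0 by have := fP (-1) _ _ f1 f1; rewrite scaleN1r addNr.
have fD a a' : faithful b a -> faithful b a' -> faithful b (a + a').
  by move=> fa fa'; rewrite -[a]scale1r; exact: fP.
apply: (big_ind (faithful b)) => // -[c j] _; have [->|cb] := eqVneq c b; last first.
  have -> : c = ~~ b by move: cb; case: (c); case: (b).
  by rewrite h0 scale0r.
rewrite -[_ *: _]addr0; apply: fP => //.
by apply: fD; do 2 eexists; [exact: acts_cr|exact: acts_an].
Qed.

Lemma faithful_generated b (G : set B) : (forall a, G a -> faithful b a) ->
  forall a, generated_algebra G a -> faithful b a.
Proof. by move=> hG a; apply; split => //; exact: faithful_subalgebra. Qed.

(* Conjugation by the flip exchanges left and right operators. *)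
Definition flip_op (a : B) : B := flB T R * a * flB T R.

Lemma flip_opP (k : R[i]) a a' : flip_op (k *: a + a') = k *: flip_op a + flip_op a'.
Proof. by rewrite /flip_op mulrDr mulrDl -scalerAr -scalerAl. Qed.
Lemma flip_opM a a' : flip_op (a * a') = flip_op a * flip_op a'.
Proof. by rewrite /flip_op !mulrA -[_ * flB T R * flB T R]mulrA flBK mulr1. Qed.
Lemma flip_op1 : flip_op 1 = 1. Proof. by rewrite /flip_op mulr1 flBK. Qed.
Lemma flip_opK : involutive flip_op.
Proof. by move=> a; rewrite /flip_op !mulrA flBK mul1r -mulrA flBK mulr1. Qed.

Lemma flip_generated (G G' : set B) : (forall a, G a -> G' (flip_op a)) ->
  forall a, generated_algebra G a -> generated_algebra G' (flip_op a).
Proof.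
move=> GG' a ga V [[V1 VP VM] G'V].
apply: (ga (fun a => V (flip_op a))); split=> [|b Gb]; last by apply: G'V; exact: GG'.
split=> [|k b c Vb Vc|b c Vb Vc]; first by rewrite flip_op1.
  by rewrite flip_opP; exact: VP.
by rewrite flip_opM; exact: VM.
Qed.

Section Bifree.
Variables (lf rf : bool -> set B).
Hypothesis lfE : forall b a, lf b a -> faithful b a.
Hypothesis rfE : forall b a, rf b a -> faithful b (flip_op a).

(** A choice of the pair [(S, L)], with a default value elsewhere. The choices respect sums and
    products because [acts] determines both maps. *)
Let sel b (a : B) : {linear c00 'I_N R -> c00 'I_N R} * {linear W -> W} :=
  if pselect (faithful b a) is left h
  then let S := cid h in (projT1 S, projT1 (cid (projT2 S)))
  else (idfun : {linear c00 'I_N R -> c00 'I_N R}, idfun : {linear W -> W}).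

Let selP b a : faithful b a -> acts b a (sel b a).1 (sel b a).2.
Proof. by rewrite /sel; case: pselect => // h _; case: cid => S hS /=; case: cid. Qed.

Let lrep b a : {linear c00_sv 'I_N R -> c00_sv 'I_N R} := (sel b a).1.
Let rrep b a : {linear c00_sv 'I_N R -> c00_sv 'I_N R} := @flC 'I_N R \o (sel b (flip_op a)).1 \o @flC 'I_N R.
Let lam b a : {linear c00_sv T R -> c00_sv T R} := (sel b a).2.
Let rho b a : {linear c00_sv T R -> c00_sv T R} := @flC T R \o (sel b (flip_op a)).2 \o @flC T R.

Let sel_id x b : (sel b 1).1 x = x.
Proof. by apply: (acts_uniqueS (selP _) (acts1 b)); do 2 eexists; exact: acts1. Qed.

Let sel_lin b (k : R[i]) a a' x : faithful b a -> faithful b a' ->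
  (sel b (k *: a + a')).1 x = k *: (sel b a).1 x + (sel b a').1 x.
Proof.
move=> /selP fa /selP fa'; have h := acts_lin k fa fa'.
by apply: (acts_uniqueS (selP _) h); do 2 eexists; exact: h.
Qed.

Let sel_mul b a a' x : faithful b a -> faithful b a' ->
  (sel b (a * a')).1 x = (sel b a).1 ((sel b a').1 x).
Proof.
move=> /selP fa /selP fa'; have h := acts_mul fa fa'.
by apply: (acts_uniqueS (selP _) h); do 2 eexists; exact: h.
Qed.

(** The right face is represented by conjugating left actions with the flip. Applied to the vacuum,
    the bounded operators stay among finitely supported vectors, where they act as [lam] and [rho],
    so the vacuum coefficients agree. *)
Lemma fock_bifree : bifree psi lf rf.
Proof.
exists X, fock_free_product, lrep, rrep, lam, rho; split.
- move=> b; split; split=> [v|k a a' fa fa' v|a a' fa fa' v].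
  + exact: sel_id.
  + by apply: sel_lin; exact: lfE.
  + by apply: sel_mul; exact: lfE.
  + by rewrite /rrep /= flip_op1 sel_id flCK.
  + by rewrite /rrep /= flip_opP sel_lin ?linearP//; exact: rfE.
  + by rewrite /rrep /= flip_opM sel_mul ?flCK//; exact: rfE.
- move=> b a /lfE/selP [_ h] x w rw ow.
  by rewrite !tens_left_tl//; exact: h.
- move=> b a /rfE/selP [_ h] x w rw ow.
  rewrite !tens_right_tr// /tr /rho /rrep /=.
  by rewrite !flCK h.
- move=> w wE; rewrite -[LHS]/(inner F (app (\prod_(z <- w) z.2) (Om T R)) (Om T R)) inner_Om.
  suff -> : app (\prod_(z <- w) z.2) (Om T R) = incl (foldr (fun (z : bool * bool * B) (y : fock_free_product) =>
    (if z.1.1 then lam else rho) z.1.2 z.2 y) (sv_vec fock_free_product) w : W) by [].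
  elim: w wE => [|[[s b] a] w ih] wE; first by rewrite big_nil; exact: l2eqP.
  rewrite big_cons appM ih => [|s' b' a' h]; last by apply: wE; rewrite inE h orbT.
  have := wE s b a (mem_head _ _) => /=; case: s {wE} => [/lfE/selP[h _]|/rfE/selP[h _]].
    by rewrite -h.
  have flE (y : W) : incl (flC y) = app (flB T R) (incl y) by exact: l2eqP.
  have aE (y : W) : app a (incl y) = incl (flC ((sel b (flip_op a)).2 (flC y))).
    by rewrite flE h flE -{1}(flip_opK a) !appM.
  exact: aE.
Qed.

End Bifree.

End ColouredFock.

(** * The entropy dimension *)

Section Perturbation.
Variables (R : realType) (n m : nat) (cov : 'M[R]_(n + m)).
Notation N := (n + m)%N.

(** Colour [true] carries the covariance of the given system, colour [false] the standard
    semicircular one. *)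
Definition model_moment (w : seq (bool * 'I_N)) : R[i] :=
  bifree_moment (fun k : 'I_N => (k < n)%N)
    (fun b => clt_moment (fun i j => if b then (cov i j)%:C else (i == j)%:R)) w.

Section Space.
Variables (A : cstarAlgebra R) (phi : {scalar A}) (S : 'I_N -> A).
Hypothesis S_clt : bifree_clt phi S.
Hypothesis S_cov : forall i j, phi (S i * S j) = (cov i j)%:C.
Variables (B : cstarAlgebra R) (psi : {scalar B}) (Z' S' : 'I_N -> B).
Hypothesis ZS : perturbation_space phi S psi Z' S'.

(** All auxiliary spaces thus share their joint moments, so the entropy can be computed from the
    Fock model. *)
Lemma perturbation_moments w :
  psi (\prod_(z <- w) (if z.1 then Z' else S') z.2) = model_moment w.
Proof.
have [_ _ Z'E [S'_clt S'_cov] [X [P [l [r [lam [rho [_ lamE rhoE mE]]]]]]]] := ZS.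
pose Zb (b : bool) := if b then Z' else S'.
have lE b (k : 'I_N) : (k < n)%N ->
    generated_algebra ((if b then Z' else S') @` range (@lshift n m)) (Zb b k).
  move=> kn V [_ GV]; apply: GV; exists k => //; exists (Ordinal kn) => //; exact: val_inj.
have rE b (k : 'I_N) : (k < n)%N = false ->
    generated_algebra ((if b then Z' else S') @` range (@rshift n m)) (Zb b k).
  move=> /negbT; rewrite -leqNgt => nk V [_ GV]; apply: GV; exists k => //.
  have kn : (k - n < m)%N by rewrite ltn_subLR.
  by exists (Ordinal kn) => //; apply: val_inj; rewrite /= subnKC.
refine (@bifree_momentE R _ _ (fun k : 'I_N => (k < n)%N) _ B psi Zb _ X P
  (fun b k => if (k < n)%N then l b (Zb b k) else r b (Zb b k))
  (fun b k => if (k < n)%N then lam b (Zb b k) else rho b (Zb b k)) _ _ w).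
- move=> [] u; last by apply: clt_momentE.
  by rewrite -(clt_momentE S_clt S_cov u); exact: Z'E.
- move=> b k x v rv ov; case: ifP ov => kn ov.
    by apply: (lamE b _ (lE b k kn)).
  by apply: (rhoE b _ (rE b k kn)).
- move=> v; have := mE [seq ((z.2 < n)%N, z.1, Zb z.1 z.2) | z : bool * 'I_N <- v].
  rewrite big_map => ->; last first.
    move=> s b a /mapP[[b' k] _ [-> -> ->]] /=; case: ifP => kn; [exact: lE|exact: rE].
  congr (sv_coef P _); elim: v => //= z v ->; by case: (z.2 < n)%N.
Qed.

End Space.

(** Each factor expands into two terms; the prefix [v] of the choices already made carries the
    induction. *)
Lemma perturbed_moment_eq (A B : cstarAlgebra R) (phi : {scalar A}) (psi : {scalar B})
    (Z S : 'I_N -> A) (Z' S' : 'I_N -> B) (c : R[i]) :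
  (forall w, phi (\prod_(z <- w) (if z.1 then Z else S) z.2) =
             psi (\prod_(z <- w) (if z.1 then Z' else S') z.2)) ->
  forall w, phi (\prod_(k <- w) (Z k + c *: S k)) = psi (\prod_(k <- w) (Z' k + c *: S' k)).
Proof.
move=> h w; pose PA (v : seq (bool * 'I_N)) := \prod_(z <- v) (if z.1 then Z else S) z.2.
pose PB (v : seq (bool * 'I_N)) := \prod_(z <- v) (if z.1 then Z' else S') z.2.
suff : forall v, phi (PA v * \prod_(k <- w) (Z k + c *: S k)) = psi (PB v * \prod_(k <- w) (Z' k + c *: S' k)).
  by move=> /(_ [::]); rewrite /PA /PB !big_nil !mul1r.
elim: w => [|k w ih] v; first by rewrite !big_nil !mulr1; exact: h.
have PAr b : PA v * (if b then Z else S) k = PA (rcons v (b, k)) by rewrite /PA -cats1 big_cat big_seq1.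
have PBr b : PB v * (if b then Z' else S') k = PB (rcons v (b, k)) by rewrite /PB -cats1 big_cat big_seq1.
rewrite !big_cons !mulrA !mulrDr -!scalerAr !mulrDl -!scalerAl !linearD !linearZ /=.
rewrite (PAr true) (PAr false) (PBr true) (PBr false).
by rewrite !ih.
Qed.

Variable V : 'M[R]_N.
Hypothesis VV : V *m V^T = cov.

(** Rows of a square root [V] of [cov] in one colour and an orthonormal basis in the other; vectors
    of different colours are orthogonal. *)
Definition model_vec (b : bool) (k : 'I_N) : {ffun bool * 'I_N -> R^o} :=
  [ffun t => if t.1 == b then (if b then V k t.2 else (t.2 == k)%:R) else 0].

Lemma model_ip b c i j : euclid_ip (model_vec b i) (model_vec c j) =
  if b == c then (if b then cov i j else (i == j)%:R) else 0.
Proof.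
transitivity (\sum_s \sum_k model_vec b i (s, k) * model_vec c j (s, k)).
  by rewrite pair_bigA /euclid_ip; apply: eq_bigr => -[s k].
rewrite (bigD1 b)//= [X in _ + X]big1 ?addr0; last first.
  by move=> s sb; rewrite big1// => k _; rewrite !ffunE /= (negbTE sb) mul0r.
rewrite (eq_bigr (fun k => if b == c then (if b then V i k * V j k else (k == i)%:R * (k == j)%:R) else 0)); last first.
  move=> k _; rewrite !ffunE /= eqxx; have [<-|_] := eqVneq b c; last by rewrite mulr0.
  by case: (b).
case: eqP => _; last by rewrite big1.
case: b; first by rewrite -VV mxE; apply: eq_bigr => k _; rewrite mxE.
rewrite (bigD1 i)//= eqxx mul1r big1 ?addr0// => k /negbTE ki.
by rewrite ki mul0r.
Qed.

Notation T := (bool * 'I_N)%type.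
Notation B := (bop_cstar (Om1 T R)).
Notation psi := (@bop_state R (fock_hilbert T R) (Om T R) (Om1 T R) : {scalar B}).

Definition model_var (b : bool) : 'I_N -> B := fop (model_vec b).

Lemma model_vec0 b k j : model_vec b k (~~ b, j) = 0.
Proof. by rewrite ffunE /=; case: b. Qed.

Lemma model_bifree : bifree psi
  (fun b => generated_algebra ((if b then model_var true else model_var false) @` range (@lshift n m)))
  (fun b => generated_algebra ((if b then model_var true else model_var false) @` range (@rshift n m))).
Proof.
have varE b : (if b then model_var true else model_var false) = model_var b by case: b.
apply: fock_bifree => b a; rewrite varE.
  apply: faithful_generated => _ [_ [i _ <-] <-]; rewrite /model_var /fop /= (ltn_ord i).
  by apply: faithful_lop => j; exact: model_vec0.
move=> /(@flip_generated _ _ _ [set lop (model_vec b k) | k in setT]) h.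
apply: (faithful_generated _ (h _)) => [_ [k _ <-]|_ [_ [j _ <-] <-]].
  by apply: faithful_lop => j; exact: model_vec0.
exists (rshift n j) => //; rewrite /model_var /fop /= ltnNge leq_addr /=.
by rewrite -[rop _]/(flip_op (lop _)) flip_opK.
Qed.

Lemma model_perturbation (A : cstarAlgebra R) (phi : {scalar A}) (S : 'I_N -> A) :
  bifree_clt phi S -> (forall i j, phi (S i * S j) = (cov i j)%:C) ->
  perturbation_space phi S psi (model_var true) (model_var false).
Proof.
move=> S_clt S_cov; split.
- exact: bop_state_is_state.
- exact: star_fop.
- move=> w; rewrite (clt_momentE S_clt S_cov w); apply: clt_momentE; first exact: fop_clt.
  by move=> i j; rewrite fop_cov model_ip.
- split=> [|i j]; first exact: fop_clt.
  by rewrite fop_cov model_ip /= rmorph_nat.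
- exact: model_bifree.
Qed.

(** Field operators are linear in their vector, so a perturbed variable is again a field operator,
    with covariance [cov + c^2 I] by [model_vec_ip]. *)
Lemma model_varD (c : R) k : model_var true k + c%:C *: model_var false k =
  fop (fun k => c *: model_vec false k + model_vec true k) k.
Proof. by rewrite /model_var /fop addrC; case: ifP => _; rewrite (lopP, ropP). Qed.

Lemma model_perturbed_moment (c : R) (s : seq 'I_n) (t : seq 'I_m) :
  psi (\prod_(k <- map (@lshift n m) s ++ map (@rshift n m) t) (model_var true k + c%:C *: model_var false k)) =
  (fmo (fun k => c *: model_vec false k + model_vec true k)
     (map (@lshift n m) s ++ map (@rshift n m) (rev t)))%:C.
Proof.
rewrite (eq_bigr _ (fun k _ => model_varD c k)) -fop_moment; congr bop_state.
by rewrite big_cat !big_map.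
Qed.

Lemma model_vec_ip (c : R) i j :
  euclid_ip (c *: model_vec false i + model_vec true i) (c *: model_vec false j + model_vec true j) =
  (cov + (c ^+ 2)%:M) i j.
Proof.
have ipr x y z : euclid_ip z (c *: x + y) = c * euclid_ip z x + euclid_ip z y :> R.
  by rewrite euclid_ipC /= euclid_ipPl !(euclid_ipC _ z).
rewrite euclid_ipPl !ipr !model_ip /= !mxE mulr0 addr0 add0r addrC mulrA -expr2.
by case: eqP => _; rewrite ?mulr1 ?mulr0 ?mulr1n ?mulr0n.
Qed.

End Perturbation.

Lemma psd_shift (R : realType) N (C : 'M[R]_N) (eps : R) : positive_mx C -> 0 <= eps ->
  positive_mx (C + eps%:M).
Proof.
move=> [symC psdC] eps0; split=> [|v]; first by rewrite linearD /= symC tr_scalar_mx.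
rewrite mulmxDr mulmxDl [leRHS]mxE; apply: addr_ge0; first exact: psdC.
rewrite mul_mx_scalar -scalemxAl !mxE mulr_ge0// sumr_ge0// => i _.
by rewrite mxE -expr2 sqr_ge0.
Qed.

(** Positivity at the sum and the difference of two basis vectors. *)
Lemma psd_entry_le1 (R : realType) N (C : 'M[R]_N) : positive_mx C -> (forall i, C i i = 1) ->
  forall i j, `|C i j| <= 1.
Proof.
move=> [symC psdC] C1 i j.
have bil a b : ((delta_mx 0 a : 'rV[R]_N) *m C *m (delta_mx 0 b : 'rV[R]_N)^T) 0 0 = C a b.
  by rewrite trmx_delta -rowE -colE !mxE.
have aD (X Y : 'M[R]_1) : (X + Y) 0 0 = X 0 0 + Y 0 0 by rewrite mxE.
have aZ (s : R) (X : 'M[R]_1) : (s *: X) 0 0 = s * X 0 0 by rewrite mxE.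
have q (s : R) : s ^+ 2 = 1 -> 0 <= 2 + 2 * s * C i j.
  move=> s1; have := psdC (delta_mx 0 i + s *: delta_mx 0 j).
  rewrite linearD linearZ /= mulmxDr !mulmxDl -!scalemxAr -!scalemxAl !(aD, aZ) !bil !C1.
  have -> : C j i = C i j by rewrite -[in LHS]symC mxE.
  by rewrite mulr1 -expr2 s1; congr (_ <= _); ring.
have := q 1 (expr1n _ _); have := q (-1) (etrans (sqrrN 1) (expr1n _ _)).
by move=> h1 h2; rewrite ler_norml; apply/andP; split; lra.
Qed.

(** [x] stands for [(N - r) ln (sqrt eps)], [d] for the logarithm of the determinant, [a] and [b]
    for the logarithms of the constants of [det_shift_bounds], [l] for [ln 2] and [M] for [N]. *)
Lemma log_bounds (R : realType) (d a b q l M x : R) :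
  a + 2 * x <= d -> d <= b + 2 * x -> 0 <= l -> 0 <= M ->
  let K := `|a| / 2 + `|b| / 2 + `|q| + l + (M + 1) / 2 in
  x - K <= d / 2 + q - l /\ d / 2 + q + (M + 1) / 2 <= x + K.
Proof.
move=> ad db l0 M0 K; have a0 := ler_norm (- a); have b0 := ler_norm b.
have q0 := ler_norm q; have q1 := ler_norm (- q); rewrite !normrN in a0 q1.
have a1 := normr_ge0 a; have b1 := normr_ge0 b.
by rewrite /K; split; lra.
Qed.

Theorem theorem8p4 (R : realType) (n m : nat) (A : cstarAlgebra R)
    (phi : {scalar A}) (S : 'I_(n + m) -> A)
    (phi_state : is_state phi)
    (S_clt : bifree_clt phi S)
    (S_var : forall k, phi (S k * S k) = 1) :
  let cov : 'M[R]_(n + m) := \matrix_(i, j) complex.Re (phi (S i * S j)) in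
  [/\ (forall i j, phi (S i * S j) = (cov i j)%:C) /\ positive_mx cov,
      (forall (B : cstarAlgebra R) (psi : {scalar B}) (T : 'I_(n + m) -> B),
         is_state psi -> bifree_clt psi T ->
         (forall i j, psi (T i * T j) = (cov i j)%:C) ->
         forall w : seq 'I_(n + m),
           psi (\prod_(k <- w) T k) = phi (\prod_(k <- w) S k))
    & entropy_dimension_is phi S (\rank cov)%:R%:E].
Proof.
move=> cov; have [S_cov psd_cov] := clt_cov_psd S_clt.
split=> [//|B psi T _ T_clt T_cov w|].
  by rewrite (clt_momentE S_clt S_cov) (clt_momentE T_clt T_cov).
have [V [_ _ VV]] := psd_cholesky psd_cov.
have model := model_perturbation VV S_clt S_cov.
split; first by do 4 eexists; exact: model.
move=> B psi Z' S' ZS.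
have cov1 i : cov i i = 1 by apply: complexI; rewrite -S_cov S_var.
have [p0 [p1 [p00 p10 detB]]] := det_shift_bounds psd_cov.
set r := \rank cov in detB *.
have rN : (r <= n + m)%N by rewrite /r rank_leq_row.
pose q := (n + m)%:R * ln (Num.sqrt (pi *+ 2)) : R.
(* Collects the constants of the determinant and entropy bounds; none depends on [eps]. *)
pose K : R := `|ln p0| / 2 + `|ln p1| / 2 + `|q| + ln 2 + ((n + m)%:R + 1) / 2.
apply: (@log_growth_limit R _ _ K) => eps eps0 eps1.
have sq2 : Num.sqrt eps ^+ 2 = eps by rewrite sqr_sqrtr// ltW.
pose e k := Num.sqrt eps *: model_vec V false k + model_vec V true k.
pose C := cov + eps%:M.
have /andP[dl du] := detB eps eps0 eps1.
have epsX : 0 < eps ^+ (n + m - r) by rewrite exprn_gt0.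
have det0 : 0 < \det C by apply: lt_le_trans dl; rewrite mulr_gt0.
have C2 k j : `|C k j| <= 2.
  have -> : C k j = cov k j + eps *+ (k == j) by rewrite [LHS]mxE [in X in _ + X]mxE.
  rewrite (le_trans (ler_normD _ _))// (_ : 2 = 1 + 1)// lerD//.
    exact: psd_entry_le1.
  by case: (k == j); rewrite ?mulr1n ?mulr0n ?normr0// ger0_norm// ltW.
have eC i j : euclid_ip (e i) (e j) = C i j by rewrite (model_vec_ip VV) sq2.
have moment (s : seq 'I_n) (t : seq 'I_m) :
    psi ((\prod_(i <- s) (Z' (lshift m i) + (Num.sqrt eps)%:C *: S' (lshift m i))) *
         (\prod_(j <- t) (Z' (rshift n j) + (Num.sqrt eps)%:C *: S' (rshift n j)))) =
    (fmo e (map (@lshift n m) s ++ map (@rshift n m) (rev t)))%:C.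
  (* Both systems are perturbation spaces of [S], so the moments can be moved to the Fock model. *)
  have h w : psi (\prod_(z <- w) (if z.1 then Z' else S') z.2) =
      bop_state (\prod_(z <- w) (if z.1 then model_var V true else model_var V false) z.2).
    by rewrite (perturbation_moments S_clt S_cov ZS) (perturbation_moments S_clt S_cov model).
  rewrite -model_perturbed_moment -(perturbed_moment_eq (Num.sqrt eps)%:C h).
  by congr (psi _); rewrite big_cat !big_map.
have loop k w : fmo e (k :: w) = spl (fun (u : seq 'I_(n + m)) (j : 'I_(n + m)) v => C k j * fmo e u * fmo e v) w.
  by rewrite fmo_loop; apply: eq_spl => u j v _; rewrite eC.
have [lo up] := chi_bounds (Z := fun k => Z' k + (Num.sqrt eps)%:C *: S' k) (psd_shift psd_cov (ltW eps0)) (lt0r_neq0 det0) C2 (fmo_nil e) loop moment.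
have lnE : ln eps = 2 * ln (Num.sqrt eps).
  by rewrite -{1}sq2 lnXn ?sqrtr_gt0// mulr_natl.
have lnX : ln (eps ^+ (n + m - r)) = 2 * (((n + m)%:R - r%:R) * ln (Num.sqrt eps)).
  by rewrite lnXn// lnE -[_ *+ (n + m - r)]mulr_natr natrB//; ring.
have d1 : ln p0 + ln (eps ^+ (n + m - r)) <= ln (\det C).
  by rewrite -lnM ?posrE// ler_ln ?posrE ?mulr_gt0.
have d2 : ln (\det C) <= ln p1 + ln (eps ^+ (n + m - r)).
  by rewrite -lnM ?posrE// ler_ln ?posrE ?mulr_gt0.
rewrite lnX in d1 d2; rewrite -[\det _]/(\det C) -/q in lo up.
set D := \det C in d1 d2 lo up.
have [lb ub] := log_bounds q d1 d2 (ln_ge0 (ler1n R 2)) (ler0n R (n + m)).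
by split; [apply: le_trans lo|apply: (le_trans up)]; rewrite lee_fin.
Qed.
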